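(* Suppose that $\mathcal M\subset\mathcal J^2$ is a monotonicity cone subequation and that $\mathcal F\subset\mathcal J^2$ is a subequation which is $\mathcal M$-monotone, i.e. $\mathcal F+\mathcal M\subset\mathcal F$. Then for every open set $X\subset\mathbb R^n$ one has $$\mathcal F(X)+\widetilde{\mathcal F}(X)\subset\widetilde{\mathcal M}(X);$$ that is, if $u$ is $\mathcal F$-subharmonic on $X$ and $v$ is $\widetilde{\mathcal F}$-subharmonic on $X$, then $u+v$ is $\widetilde{\mathcal M}$-subharmonic on $X$.
   Context: $\mathcal S(n)$ is the space of real symmetric $n\times n$ matrices, $\mathcal P=\{A\in\mathcal S(n):A\ge0\}$, $\mathcal N=(-\infty,0]$, $\mathcal J^2=\mathbb R\times\mathbb R^n\times\mathcal S(n)$. A subequation is a nonempty proper subset $\mathcal F\subset\mathcal J^2$ with (P) $\mathcal F+(\{0\}\times\{0\}\times\mathcal P)\subset\mathcal F$, (N) $\mathcal F+(\mathcal N\times\{0\}\times\{0\})\subset\mathcal F$, (T) $\mathcal F=\overline{\mathrm{Int}\,\mathcal F}$. A monotonicity cone subequation is a closed convex cone $\mathcal M\subset\mathcal J^2$ with vertex at the origin, containing $\mathcal N\times\{0\}\times\mathcal P$, with $\mathcal M=\overline{\mathrm{Int}\,\mathcal M}$. The dual of $\mathcal F\subset\mathcal J^2$ is $\widetilde{\mathcal F}=-(\mathcal J^2\setminus\mathrm{Int}\,\mathcal F)$. For $X\subset\mathbb R^n$ open, $\mathrm{USC}(X)$ is the set of upper semicontinuous functions $X\to[-\infty,\infty)$.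 $u\in\mathrm{USC}(X)$ is $\mathcal F$-subharmonic on $X$ if for every $x_0\in X$ and every $\varphi$ of class $C^2$ near $x_0$ with $u\le\varphi$ near $x_0$ and $u(x_0)=\varphi(x_0)$, one has $(\varphi(x_0),D\varphi(x_0),D^2\varphi(x_0))\in\mathcal F$. $\mathcal F(X)$ denotes the set of $\mathcal F$-subharmonic functions on $X$. *)

(* Defs.v *)
From HB Require Import structures.
From mathcomp Require Export all_boot all_order all_algebra.
From mathcomp Require Export all_classical all_reals all_analysis.

Set Implicit Arguments.
Unset Strict Implicit.
Unset Printing Implicit Defensive.

Import Order.TTheory GRing.Theory Num.Theory.
Import numFieldNormedType.Exports.

Local Open Scope classical_set_scope.
Local Open Scope ring_scope.

Section Jets.
Context {R : realType} {n : nat}.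

(* The ambient space R x R^n x M(n); the jet space J^2 is the closed linear
   subspace [jets] of the triples whose matrix is symmetric. *)
Definition jet : Type := (R^o * 'rV[R]_n * 'M[R]_n)%type.

Definition jets : set jet := [set J | J.2 \is symmetricmx].

(* Interior and closure are taken in J^2 and not in the ambient space, where
   J^2 has empty interior as soon as n >= 2. *)
Definition jet_int (F : set jet) : set jet :=
  interior (F : set (subspace jets)).

Definition jet_closure (F : set jet) : set jet :=
  closure (F : set (subspace jets)).

Definition psd : set 'M[R]_n :=
  [set A | A \is symmetricmx /\ forall x : 'rV[R]_n, 0 <= (x *m A *m x^T) 0 0].

Definition nonpos : set R^o := [set r | r <= 0].

Definition jet_add (A B : set jet) : set jet := [set a + b | a in A & b in B].

Definition subequation (F : set jet) : Prop :=
  [/\ F !=set0 /\ F `<` jets,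
      jet_add F ([set 0] `*` [set 0] `*` psd) `<=` F,
      jet_add F (nonpos `*` [set 0] `*` [set 0]) `<=` F &
      F = jet_closure (jet_int F)].

Definition convex_cone (M : set jet) : Prop :=
  convex_set (M : set (convex_lmodType jet)) /\
  forall (t : R) (J : jet), 0 < t -> M J -> M (t *: J).

Definition monotonicity_cone (M : set jet) : Prop :=
  [/\ M `<=` jets /\ closed (M : set (subspace jets)),
      convex_cone M,
      nonpos `*` [set 0] `*` psd `<=` M &
      M = jet_closure (jet_int M)].

Definition jet_monotone (M F : set jet) : Prop := jet_add F M `<=` F.

Definition jet_dual (F : set jet) : set jet :=
  [set - J | J in jets `\` jet_int F].

End Jets.

Arguments jet : clear implicits.
Arguments jets : clear implicits.

Section Subharmonic.
Context {R : realType} {n : nat}.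

Definition partial (i : 'I_n) (phi : 'rV[R]_n -> R) : 'rV[R]_n -> R :=
  'D_(delta_mx 0 i) phi.

Definition grad (phi : 'rV[R]_n -> R) (x : 'rV[R]_n) : 'rV[R]_n :=
  \row_i partial i phi x.

Definition hess (phi : 'rV[R]_n -> R) (x : 'rV[R]_n) : 'M[R]_n :=
  \matrix_(i, j) partial i (partial j phi) x.

(* [differentiable] is Frechet differentiability, so the entries of [grad] and
   [hess] are genuine partial derivatives wherever they are used here. *)
Definition C2_near (phi : 'rV[R]_n -> R) (x0 : 'rV[R]_n) : Prop :=
  \forall x \near x0,
    [/\ differentiable phi x, differentiable (grad phi) x &
        {for x, continuous (hess phi)}].

Definition jet_of (phi : 'rV[R]_n -> R) (x : 'rV[R]_n) : jet R n :=
  (phi x, grad phi x, hess phi x).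

(* Functions on X are represented by total functions; only their values on X
   matter. *)
Definition USC (X : set 'rV[R]_n) (u : 'rV[R]_n -> \bar R) : Prop :=
  forall x, X x -> (u x < +oo)%E /\
    forall a : R, (u x < a%:E)%E ->
      \forall y \near x, X y -> (u y < a%:E)%E.

Definition subharmonic (F : set (jet R n)) (X : set 'rV[R]_n)
    (u : 'rV[R]_n -> \bar R) : Prop :=
  USC X u /\
  forall (x0 : 'rV[R]_n) (phi : 'rV[R]_n -> R), X x0 -> C2_near phi x0 ->
    (\forall x \near x0, (u x <= (phi x)%:E)%E) -> u x0 = (phi x0)%:E ->
    F (jet_of phi x0).

End Subharmonic.

(* Main.v *)
Require Import Defs.
From mathcomp Require Import ring lra zify.

(** Let phi touch u + v from above at x0, and let J be its jet there. If J were
    not in the dual of M, then -J would be interior to M. Suppose that u and v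
    have jets J_u in F and J_v in the dual of F, at points near x0, such that
    J_u + J_v is essentially below J: its value is not much smaller, its gradient
    is close to that of J, and its Hessian is at most that of J up to a small
    multiple of the identity. Then -J_v is J_u plus an element of N x 0 x P plus a
    jet close to -J, so that -J_v lies in F + M, and so do all jets near it: it is
    interior to F, which is impossible ([incompatible_jets]).

    Such jets are provided by [theorem_on_sums]. There phi is replaced by a
    paraboloid q for which u + v - q has a strict maximum at x0 ([taylor_upper]),
    and u, v by their sup-convolutions f, f2. These are semiconvex, and a
    paraboloid touching f at x touches u at a nearby point Z x, with the same
    gradient and Hessian ([supconv_jet]). With g = f2 - q it remains to find, near
    x0, a point and a radius r at which f and g are within eta r^2 of quadratic
    polynomials whose gradients and Hessians add up to something small and to
    something nonpositive; [touching_paraboloid] then yields test functions.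

    Usually such points come from the theorems of Alexandrov and Jensen on the
    second-order differentiability of semiconvex functions. Since approximation
    at a single scale suffices, counting on a lattice can replace measure theory.

    - For every small slope l the function f + g - l. has a maximum near x0. At
      such a contact point f and g are squeezed between paraboloids of a fixed
      opening, and contact points of slopes that are far apart are far apart
      ([contact_separated]). Hence a fraction of the cells of a lattice of mesh h
      contains contact points, and this fraction does not depend on h.

    - Second differences at scale 2r are averages of second differences at scale
      r. The mean of a bounded convex function of them therefore decreases with
      the scale, and the total decrease is bounded, whatever the number of scales
      ([energy]). So for most scales and most points neighbouring second
      differences almost agree, that is, third differences are small compared
      with r^2. With enough scales some contact point is such a point for f and g
      at once ([good_scale]).

    - Blow-ups of f and g at these points and scales converge along an ultrafilter.
      The limits have vanishing third differences and at most quadratic growth at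
      the origin, so they are quadratic forms ([third0_quadratic]), and convergence
      is uniform on the unit ball. The maximality of f + g - l. at the contact point
      makes the sum of the two forms nonpositive ([simultaneous_quadratic]). *)

Set Implicit Arguments.
Unset Strict Implicit.
Unset Printing Implicit Defensive.

Import Order.TTheory GRing.Theory Num.Def Num.Theory.
Import numFieldNormedType.Exports.

Local Open Scope classical_set_scope.
Local Open Scope ring_scope.

(** * Euclidean structure of row vectors *)

Section Euclid.
Context {R : realType} {n : nat}.
Implicit Types (x y z : 'rV[R]_n) (a b : R) (A B : 'M[R]_n).

Definition dot x y : R := \sum_i x 0 i * y 0 i.
Definition sq x : R := dot x x.

Lemma dotC x y : dot x y = dot y x.
Proof. by apply: eq_bigr => i _; rewrite mulrC. Qed.

Lemma dotDl x y z : dot (x + y) z = dot x z + dot y z.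
Proof. by rewrite -big_split /=; apply: eq_bigr => i _; rewrite mxE mulrDl. Qed.

Lemma dotDr x y z : dot x (y + z) = dot x y + dot x z.
Proof. by rewrite dotC dotDl !(dotC x). Qed.

Lemma dotZl a x y : dot (a *: x) y = a * dot x y.
Proof. by rewrite mulr_sumr; apply: eq_bigr => i _; rewrite mxE mulrA. Qed.

Lemma dotZr a x y : dot x (a *: y) = a * dot x y.
Proof. by rewrite dotC dotZl dotC. Qed.

Lemma dotNl x y : dot (- x) y = - dot x y.
Proof. by rewrite -scaleN1r dotZl mulN1r. Qed.

Lemma dotNr x y : dot x (- y) = - dot x y.
Proof. by rewrite dotC dotNl dotC. Qed.

Lemma dotBl x y z : dot (x - y) z = dot x z - dot y z.
Proof. by rewrite dotDl dotNl. Qed.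

Lemma dotBr x y z : dot x (y - z) = dot x y - dot x z.
Proof. by rewrite dotDr dotNr. Qed.

Lemma dot0l x : dot 0 x = 0.
Proof. by rewrite -(scale0r 0) dotZl mul0r. Qed.

Lemma dot0r x : dot x 0 = 0.
Proof. by rewrite dotC dot0l. Qed.

Definition dotE := (dotDl, dotDr, dotNl, dotNr, dotZl, dotZr).

Lemma dot_mulmx x y : dot x y = (x *m y^T) 0 0.
Proof. by rewrite mxE; apply: eq_bigr => i _; rewrite mxE. Qed.

Lemma dot_delta x i : dot x (delta_mx 0 i) = x 0 i.
Proof.
rewrite /dot (bigD1 i) //= big1 ?addr0 => [|j ji]; rewrite mxE !eqxx ?mulr1 //.
by rewrite (negbTE ji) mulr0.
Qed.

Lemma sqE x : sq x = \sum_i x 0 i ^+ 2.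
Proof. by apply: eq_bigr => i _; rewrite expr2. Qed.

Lemma sq_ge0 x : 0 <= sq x.
Proof. by rewrite sqE sumr_ge0 // => i _; rewrite sqr_ge0. Qed.

Lemma sqZ a x : sq (a *: x) = a ^+ 2 * sq x.
Proof. by rewrite /sq dotZl dotZr mulrA. Qed.

Lemma sqN x : sq (- x) = sq x.
Proof. by rewrite /sq dotNl dotNr opprK. Qed.

Lemma sq0 : sq (0 : 'rV[R]_n) = 0.
Proof. exact: dot0l. Qed.

Lemma sqD x y : sq (x + y) = sq x + 2 * dot x y + sq y.
Proof. by rewrite /sq !dotE (dotC y x); ring. Qed.

Lemma coord_le_norm x i : `|x 0 i| <= `|x|.
Proof.
rewrite [leRHS]/normr /= mx_normrE.
by apply/bigmax_geP; right => /=; exists (0, i).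
Qed.

Lemma norm_le_coord x a : 0 <= a -> (forall i, `|x 0 i| <= a) -> `|x| <= a.
Proof.
move=> a0 h; rewrite [leLHS]/normr /= mx_normrE.
by apply/bigmax_leP; split => // -[i j] _ /=; rewrite ord1.
Qed.

Lemma sq_norm_le x : sq x <= n%:R * `|x| ^+ 2.
Proof.
apply: le_trans (_ : \sum_(i < n) `|x| ^+ 2 <= _); last first.
  by rewrite sumr_const card_ord mulr_natl.
rewrite sqE; apply: ler_sum => i _; rewrite -real_normK ?num_real //.
by rewrite ler_sqr ?nnegrE // coord_le_norm.
Qed.

Lemma norm_sq_le x : `|x| ^+ 2 <= sq x.
Proof.
have h : `|x| <= Num.sqrt (sq x).
  apply: norm_le_coord => [|i]; first exact: sqrtr_ge0.
  rewrite -sqrtr_sqr ler_wsqrtr // sqE (bigD1 i) //= lerDl.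
  by rewrite sumr_ge0 // => j _; rewrite sqr_ge0.
by rewrite -(sqr_sqrtr (sq_ge0 x)) ler_sqr ?nnegrE ?sqrtr_ge0.
Qed.

Lemma sq_eq0 x : sq x <= 0 -> x = 0.
Proof.
move=> h; apply/eqP; rewrite -normr_eq0 -[_ == 0]andTb -[true]/(0 < 2)%N -expf_eq0.
by rewrite eq_le sqr_ge0 andbT (le_trans (norm_sq_le x)).
Qed.

Lemma dot_norm_le x y : `|dot x y| <= n%:R * (`|x| * `|y|).
Proof.
apply: le_trans (ler_norm_sum _ _ _) _.
apply: le_trans (_ : \sum_(i < n) `|x| * `|y| <= _); last first.
  by rewrite sumr_const card_ord mulr_natl.
by apply: ler_sum => i _; rewrite normrM ler_pM ?coord_le_norm.
Qed.

End Euclid.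

(** * Contact points of semiconvex functions *)

Section Contact.
Context {R : realType} {n : nat}.
Implicit Types (f g : 'rV[R]_n -> R) (x y l p : 'rV[R]_n) (K h rho sigma : R).

Definition below K f x p :=
  forall y, f x + dot p (y - x) - K * sq (y - x) <= f y.

(** Equivalent to the convexity of f + K |x|^2. Supporting paraboloids are what
    sup-convolutions come with, and what survives rescaling and limits. *)
Definition semiconvex K f := forall x, exists p, below K f x p.

Definition contact f g x0 rho l x :=
  forall y, `|y - x0| <= rho -> f y + g y - dot l y <= f x + g x - dot l x.

(** At an interior maximum of f + g - l. the supporting paraboloids of f and g add
    up to one of f + g, so their slopes add up to l. *)
Lemma contact_slope K f g x0 rho l x pf pg : 0 <= K -> `|x - x0| < rho ->
  contact f g x0 rho l x -> below K f x pf -> below K g x pg -> pf + pg = l.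
Proof.
move=> K0 xr ct hf hg; apply/eqP; rewrite -subr_eq0; apply/eqP.
set d := pf + pg - l; apply: sq_eq0.
pose gap := rho - `|x - x0|; have gap0 : 0 < gap by rewrite subr_gt0.
pose t := minr (gap / (`|d| + 1)) (1 / (4 * K + 1)).
have d1 : 0 < `|d| + 1 by rewrite ltr_wpDl.
have K1 : 0 < 4 * K + 1 by lra.
have t0 : 0 < t by rewrite lt_min !divr_gt0.
have td : t * `|d| <= gap.
  have : t * (`|d| + 1) <= gap by rewrite -ler_pdivlMr // /t ge_min lexx.
  lra.
have tK : t * (4 * K + 1) <= 1 by rewrite -ler_pdivlMr // /t ge_min lexx orbT.
have /ct : `|(x + t *: d) - x0| <= rho.
  rewrite addrAC; apply: le_trans (ler_normD _ _) _.
  by rewrite normrZ gtr0_norm // -lerBrDl.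
have := hf (x + t *: d); have := hg (x + t *: d).
have -> : x + t *: d - x = t *: d by rewrite addrC addKr.
rewrite dotDr !dotZr !sqZ => h1 h2 h3.
have E : dot pf d + dot pg d - dot l d = sq d by rewrite -dotDl -dotBl.
have E' : t * sq d = t * dot pf d + t * dot pg d - t * dot l d.
  by rewrite -E; ring.
have h4 : t * sq d <= 2 * K * (t ^+ 2 * sq d) by lra.
have h5 : sq d <= 2 * K * t * sq d.
  by rewrite -(ler_pM2l t0); apply: le_trans h4 _; rewrite le_eqVlt; apply/orP; left; apply/eqP; ring.
have s0 := sq_ge0 d.
have : 2 * K * t * sq d <= 1 / 2 * sq d by apply: ler_wpM2r => //; lra.
lra.
Qed.

(** The maximum bounds f + g from above and semiconvexity bounds g from below, so f
    is bounded from above: contact points are points of regularity C^{1,1}. *)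
Lemma contact_above K f g x0 rho l x pf pg :
  contact f g x0 rho l x -> below K g x pg -> pf + pg = l ->
  forall y, `|y - x0| <= rho -> f y <= f x + dot pf (y - x) + K * sq (y - x).
Proof.
move=> ct hg e y /ct; have := hg y.
have : dot l (y - x) = dot pf (y - x) + dot pg (y - x) by rewrite -e dotDl.
rewrite (dotBr l); lra.
Qed.

(** The slope is a Lipschitz function of the contact point, up to the resolution h.
    This takes the place of the estimate of the measure of the contact set in
    Jensen's lemma. *)
Lemma contact_separated K f g x0 rho sigma h l l' x x' :
  0 <= K -> semiconvex K f -> semiconvex K g -> 0 < h -> sigma + h <= rho ->
  `|x - x0| <= sigma -> `|x' - x0| <= sigma -> `|x - x'| <= h ->
  contact f g x0 rho l x -> contact f g x0 rho l' x' ->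
  `|l - l'| <= 8 * K * n%:R * h.
Proof.
move=> K0 hf hg h0 sr xs xs' xx ct ct'.
have [pf hpf] := hf x; have [pg hpg] := hg x.
have xr : `|x - x0| < rho by lra.
have e := contact_slope K0 xr ct hpf hpg.
have key z : `|z| <= h -> dot (l - l') z <= 8 * K * n%:R * h ^+ 2.
  move=> zh.
  have yr : `|x' + z - x0| <= rho.
    by rewrite addrAC (le_trans (ler_normD _ _)) //; lra.
  have := ct' _ yr; have := hpf (x' + z); have := hpg (x' + z).
  have /ct : `|x' - x0| <= rho by lra.
  have : sq (x' + z - x) <= n%:R * (h + h) ^+ 2.
    apply: le_trans (sq_norm_le _) _; apply: ler_wpM2l; first exact: ler0n.
    rewrite ler_sqr ?nnegrE //; last lra.
    rewrite addrAC (le_trans (ler_normD _ _)) // lerD // distrC //.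
  move/(ler_wpM2l K0).
  have : dot l (x' + z - x) = dot pf (x' + z - x) + dot pg (x' + z - x).
    by rewrite -e dotDl.
  rewrite dotBl !dotBr !dotDr => *; lra.
apply: norm_le_coord => [|i]; first by rewrite !mulr_ge0 // ?ler0n // ltW.
rewrite -(ler_pM2r h0) -{1}(gtr0_norm h0) -normrM.
have nd (s : R) : `|s| = 1 -> `|(s * h) *: delta_mx 0 i : 'rV[R]_n| <= h.
  move=> s1; apply: norm_le_coord => [|j]; first lra.
  rewrite !mxE normrM (normrM s) s1 mul1r (gtr0_norm h0) eqxx andTb.
  by case: (j == i); rewrite ?normr1 ?normr0 ?mulr1 ?mulr0 // ltW.
have := key _ (nd 1 (normr1 _)); have := key _ (nd (-1) (normrN1 _)).
rewrite !dotZr dot_delta ler_norml -!mulrA -expr2 => h1 h2; apply/andP; split; lra.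
Qed.

End Contact.

(** * Decay of second differences across the scales of a lattice *)

Section Deficit.
Context {R : realType}.
Implicit Types s m S : R.

(** The gap in Jensen's inequality for the function 1/s, the three points having
    the weights 1/4, 1/2, 1/4. *)
Definition deficit s1 s2 s3 : R :=
  s1^-1 / 4 + s2^-1 / 2 + s3^-1 / 4 - (s1 / 4 + s2 / 2 + s3 / 4)^-1.

Lemma deficitE s1 s2 s3 : 0 < s1 -> 0 < s2 -> 0 < s3 ->
  deficit s1 s2 s3 = ((s1 - s2) ^+ 2 / (s1 * s2) / 8 + (s2 - s3) ^+ 2 / (s2 * s3) / 8
    + (s1 - s3) ^+ 2 / (s1 * s3) / 16) / (s1 / 4 + s2 / 2 + s3 / 4).
Proof.
move=> h1 h2 h3; rewrite /deficit; field.
by rewrite !gt_eqF //=; lra.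
Qed.

Lemma deficit_ge0 s1 s2 s3 : 0 < s1 -> 0 < s2 -> 0 < s3 -> 0 <= deficit s1 s2 s3.
Proof.
move=> h1 h2 h3; rewrite deficitE //.
have m0 : 0 <= s1 / 4 + s2 / 2 + s3 / 4 by lra.
by rewrite divr_ge0 // !addr_ge0 // !divr_ge0 ?sqr_ge0 ?mulr_ge0 // ltW.
Qed.

(** Strict convexity of 1/s on a bounded interval, made quantitative. *)
Lemma deficit_small s1 s2 s3 S : 0 < s1 -> 0 < s2 -> 0 < s3 ->
  s1 <= S -> s2 <= S -> s3 <= S ->
  (s3 - s2) ^+ 2 <= 8 * S ^+ 3 * deficit s1 s2 s3.
Proof.
move=> h1 h2 h3 l1 l2 l3.
set m := s1 / 4 + s2 / 2 + s3 / 4.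
have m0 : 0 < m by rewrite /m; lra.
have mS : m <= S by rewrite /m; lra.
have S0 : 0 < S by lra.
have pos (a b c k : R) : 0 < b -> 0 < c -> 0 <= k -> 0 <= a ^+ 2 / (b * c) / k.
  by move=> ? ? ?; rewrite !divr_ge0 ?sqr_ge0 // mulr_ge0 // ltW.
have d : (s2 - s3) ^+ 2 / (s2 * s3) / 8 / m <= deficit s1 s2 s3.
  rewrite deficitE // -/m ler_pM2r ?invr_gt0 //.
  have := pos (s1 - s2) s1 s2 8 h1 h2 (ler0n _ _).
  have := pos (s1 - s3) s1 s3 16 h1 h3 (ler0n _ _).
  lra.
have S3 : s2 * s3 * m <= S ^+ 3.
  by rewrite !exprS expr0 mulr1 mulrA !ler_pM // ?mulr_ge0 // ltW.
have E : (s3 - s2) ^+ 2 = 8 * (s2 * s3 * m) * ((s2 - s3) ^+ 2 / (s2 * s3) / 8 / m).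
  by field; rewrite !gt_eqF.
have q0 : 0 <= (s2 - s3) ^+ 2 / (s2 * s3) / 8 / m.
  by rewrite divr_ge0 ?pos // ltW.
rewrite E ler_pM // ?mulr_ge0 ?ler_pM2l //; exact: ltW.
Qed.

End Deficit.

Section Boxes.
Context {R : realType} {n : nat}.
Implicit Types (H : 'rV[int]_n -> R) (t e k w : 'rV[int]_n).

Definition cell m (x : {ffun 'I_n -> 'I_m}) : 'rV[int]_n := \row_i (x i : nat)%:Z.

(** The points of the cube at distance at least c from its faces. *)
Definition box m c (x : {ffun 'I_n -> 'I_m}) :=
  [forall i, (c <= x i)%N && (x i + c < m)%N].

Lemma cell_inj m : injective (@cell m).
Proof.
move=> x y /rowP h; apply/ffunP => i; apply: val_inj.
by have := h i; rewrite !mxE => -[].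
Qed.

Lemma abszD_box (c d m x : nat) (a : int) : (c + d <= x)%N && (x + (c + d) < m)%N ->
  (absz a <= d)%N ->
  [/\ (absz (x%:Z + a)%R < m)%N, Posz (absz (x%:Z + a)) = x%:Z + a,
      (c <= absz (x%:Z + a)%R)%N & (absz (x%:Z + a)%R + c < m)%N].
Proof. move=> /andP[h1 h2] h3; split; lia. Qed.

(** The translation by t maps the smaller box injectively into the larger one, and
    the terms that are missed are nonnegative: boundaries cost nothing. *)
Lemma box_shift m c d H t : (forall k, 0 <= H k) ->
  (forall i, (absz (t 0%R i) <= d)%N) ->
  \sum_(x : {ffun 'I_n -> 'I_m} | box (c + d) x) H (cell x + t) <=
  \sum_(x : {ffun 'I_n -> 'I_m} | box c x) H (cell x).
Proof.
move=> H0 td.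
pose phi (x : {ffun 'I_n -> 'I_m}) : {ffun 'I_n -> 'I_m} :=
  [ffun i => insubd (x i) (absz ((x i : nat)%:Z + t 0%R i)%R)].
pose A := [set x : {ffun 'I_n -> 'I_m} | box (c + d) x]%SET.
have P x : x \in A -> cell (phi x) = cell x + t /\ box c (phi x).
  rewrite inE => /forallP bx.
  have v i : (phi x i : nat) = (absz ((x i : nat)%:Z + t 0%R i)%R).
    have [lt_m _ _ _] := abszD_box (bx i) (td i).
    by rewrite ffunE val_insubd lt_m.
  split.
    by apply/rowP => i; rewrite !mxE v; have [_ -> _ _] := abszD_box (bx i) (td i).
  by apply/forallP => i; rewrite v; have [_ _ -> ->] := abszD_box (bx i) (td i).
have inj : {in A &, injective phi}.
  move=> x y xA yA e; apply: cell_inj; apply: (@addIr _ t).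
  by rewrite -(P x xA).1 -(P y yA).1 e.
have -> : \sum_(x : {ffun 'I_n -> 'I_m} | box (c + d) x) H (cell x + t) =
    \sum_(y in phi @: A) H (cell y).
  rewrite big_imset //=; apply: eq_big => x; first by rewrite inE.
  by move=> bx; rewrite (P x _).1 // inE.
rewrite big_mkcond [leRHS]big_mkcond; apply: ler_sum => y _.
case: ifP => [/imsetP[x /P[_ bx] ->]|_]; first by rewrite bx.
by case: ifP.
Qed.

Lemma box_sub m c c' : (c <= c')%N -> forall x : {ffun 'I_n -> 'I_m}, box c' x -> box c x.
Proof.
move=> cc x /forallP h; apply/forallP => i; have /andP[h1 h2] := h i.
apply/andP; split; lia.
Qed.

Lemma ler_sum_box m c c' (F : {ffun 'I_n -> 'I_m} -> R) : (c <= c')%N ->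
  (forall x, 0 <= F x) -> \sum_(x | box c' x) F x <= \sum_(x | box c x) F x.
Proof.
move=> cc F0; rewrite big_mkcond [leRHS]big_mkcond; apply: ler_sum => x _.
by case: ifP => [/(box_sub cc) -> //|_]; case: ifP.
Qed.

End Boxes.

Section Energy.
Context {R : realType} {n : nat}.
Implicit Types (phi : 'rV[int]_n -> R) (t e k w : 'rV[int]_n) (C : R).

Definition second_diff phi w k : R := phi (k + w) + phi (k - w) - 2 * phi k.

Lemma second_diff_double phi w k :
  second_diff phi (w + w) k = second_diff phi w (k - w) + 2 * second_diff phi w k + second_diff phi w (k + w).
Proof.
rewrite /second_diff !subrK !addrK opprD !addrA; ring.
Qed.

(** The second difference in the direction e at scale 2^j, normalized by the scale.
    The constant C serves to make it at least 1 when phi comes from a semiconvex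
    function. *)
Definition level C phi e j k : R := second_diff phi (e *+ 2 ^ j) k / 4 ^+ j + C.

(** The averaging property on which the decay over the scales rests. *)
Lemma levelS C phi e j k : level C phi e j.+1 k =
  level C phi e j (k - e *+ 2 ^ j) / 4 + level C phi e j k / 2
  + level C phi e j (k + e *+ 2 ^ j) / 4.
Proof.
rewrite /level expnS mul2n -addnn mulrnDr second_diff_double exprS.
have h : (4 : R) ^+ j != 0 by rewrite expf_neq0.
by field.
Qed.

Definition level_deficit C phi e j k : R := deficit (level C phi e j (k - e *+ 2 ^ j))
  (level C phi e j k) (level C phi e j (k + e *+ 2 ^ j)).

(** From one scale to the next the sum of the inverse levels decreases by the sum of
    the deficits, and it starts below the number m^n of points. The bound does not
    depend on the number J of scales; the boxes shrink from scale to scale, which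
    gives boundary terms the favourable sign. *)
Lemma energy C phi e m N J :
  (forall j k, 1 <= level C phi e j k) -> (forall i, (absz (e 0%R i) <= N)%N) ->
  \sum_(j < J) \sum_(x : {ffun 'I_n -> 'I_m} | box (2 ^ J * N) x)
     level_deficit C phi e j (cell x) <= (m ^ n)%:R.
Proof.
move=> h eN.
have h0 j k : 0 < level C phi e j k by apply: lt_le_trans (h j k).
pose T j : R := \sum_(x : {ffun 'I_n -> 'I_m} | box (2 ^ j * N) x)
  (level C phi e j (cell x))^-1.
have T0 j : 0 <= T j by apply: sumr_ge0 => x _; rewrite invr_ge0 ltW.
have step j : (j < J)%N -> \sum_(x : {ffun 'I_n -> 'I_m} | box (2 ^ J * N) x)
     level_deficit C phi e j (cell x) <= T j - T j.+1.
  move=> jJ.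
  apply: (@le_trans _ _ (\sum_(x : {ffun 'I_n -> 'I_m} | box (2 ^ j.+1 * N) x)
     level_deficit C phi e j (cell x))).
    apply: ler_sum_box => [|x]; last by rewrite deficit_ge0.
    by rewrite leq_mul2r leq_exp2l ?jJ ?orbT.
  rewrite /level_deficit /deficit sumrB; under [X in _ - X]eq_bigr do rewrite -levelS.
  rewrite lerD2r !big_split /= -!mulr_suml.
  have b t : (forall i, (absz (t 0%R i) <= 2 ^ j * N)%N) ->
      \sum_(x : {ffun 'I_n -> 'I_m} | box (2 ^ j.+1 * N) x)
        (level C phi e j (cell x + t))^-1 <= T j.
    move=> ht; rewrite expnS mul2n -addnn mulnDl.
    apply: (@box_shift _ _ _ _ _ (fun k => (level C phi e j k)^-1)) => // k.
    by rewrite invr_ge0 ltW.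
  have ht i : (absz ((e *+ 2 ^ j) 0%R i) <= 2 ^ j * N)%N.
    by rewrite mulmxnE -mulr_natr natz abszM mulnC leq_mul //.
  have htN i : (absz ((- (e *+ 2 ^ j)) 0%R i) <= 2 ^ j * N)%N.
    by rewrite mxE abszN.
  have := b _ ht; have := b _ htN.
  have : \sum_(x : {ffun 'I_n -> 'I_m} | box (2 ^ j.+1 * N) x)
        (level C phi e j (cell x))^-1 <= T j.
    apply: ler_sum_box => [|x]; last by rewrite invr_ge0 ltW.
    by rewrite leq_mul2r leq_exp2l ?leqnSn ?orbT.
  lra.
apply: (@le_trans _ _ (\sum_(j < J) (T j - T j.+1))).
  by apply: ler_sum => j _; apply: step.
have -> : \sum_(j < J) (T j - T j.+1) = T 0%N - T J.
  rewrite -(big_mkord xpredT (fun j => T j - T j.+1)).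
  under eq_bigr do rewrite -opprB.
  by rewrite sumrN telescope_sumr // opprB.
apply: le_trans (_ : T 0%N <= _); first by rewrite gerBl.
have -> : (m ^ n)%:R = \sum_(x : {ffun 'I_n -> 'I_m}) (1 : R).
  by rewrite sumr_const card_ffun !card_ord.
rewrite /T big_mkcond; apply: ler_sum => x _; case: ifP => // _.
by rewrite invf_le1.
Qed.

End Energy.

Section Pigeonhole.
Context {R : realType} {n : nat}.
Implicit Types (phi psi : 'rV[int]_n -> R) (e z k : 'rV[int]_n).

Definition bounded_by (N : nat) e := forall i, (absz (e 0%R i) <= N)%N.

Lemma sum_inj_le (S T : finType) (P : pred T) (cl : S -> T) (F : T -> R) :
  injective cl -> (forall y, P (cl y)) -> (forall x, 0 <= F x) ->
  \sum_y F (cl y) <= \sum_(x | P x) F x.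
Proof.
move=> inj hP F0.
have -> : \sum_y F (cl y) = \sum_(x in cl @: [set: S]%SET) F x.
  rewrite big_imset /=; last by move=> ? ? _ _; exact: inj.
  by apply: eq_bigl => y; rewrite inE.
rewrite big_mkcond [leRHS]big_mkcond; apply: ler_sum => x _.
by case: ifP => [/imsetP[y _ ->]|_]; [rewrite hP | case: ifP].
Qed.

(** The image of cl is a fraction kappa^-n of all cells. If each of its cells had at
    each scale a deficit above theta in its neighbourhood, the sum of all deficits
    would exceed the bound of [energy] as soon as J is large. *)
Lemma scale_pigeonhole C phi psi (N J m m1 kappa : nat) (theta : R)
    (cl : {ffun 'I_n -> 'I_m1} -> {ffun 'I_n -> 'I_m}) :
  (forall e j k, bounded_by N e -> 1 <= level C phi e j k) ->
  (forall e j k, bounded_by N e -> 1 <= level C psi e j k) ->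
  injective cl -> (forall y, box (2 ^ J * N + 2 ^ J * N) (cl y)) ->
  m = (kappa * m1)%N -> (0 < m1)%N ->
  (2 * ((2 * N).+1 ^ n * (2 * N).+1 ^ n) * kappa ^ n)%:R < J%:R * theta ->
  exists y j, (j < J)%N /\ forall e z, bounded_by N e -> bounded_by N z ->
    level_deficit C phi e j (cell (cl y) + z *+ 2 ^ j) <= theta /\
    level_deficit C psi e j (cell (cl y) + z *+ 2 ^ j) <= theta.
Proof.
move=> hphi hpsi inj bcl mE m10 big_J; apply: contrapT => none.
(* a finite index set for the integer vectors bounded by N *)
pose E := {ffun 'I_n -> 'I_((2 * N).+1)}.
pose vec (e : E) : 'rV[int]_n := \row_i ((e i : nat)%:Z - N%:Z).
have vecN (e : E) : bounded_by N (vec e).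
  move=> i; rewrite mxE; have := ltn_ord (e i); move: (e i : nat) => ei; lia.
have vec_surj (e : 'rV[int]_n) : bounded_by N e -> exists d : E, vec d = e.
  move=> he; exists [ffun i => inord (absz (e 0 i + N%:Z))].
  apply/rowP => i; rewrite mxE ffunE inordK.
    by have := he i; move: (e 0 i) => ei; lia.
  by have := he i; move: (e 0 i) => ei; lia.
pose D (f : 'rV[int]_n -> R) (p : E * E) j (k : 'rV[int]_n) : R :=
  level_deficit C f (vec p.1) j (k + vec p.2 *+ 2 ^ j).
have D0 f p j k : (forall e j k, bounded_by N e -> 1 <= level C f e j k) -> 0 <= D f p j k.
  by move=> hf; apply: deficit_ge0; apply: lt_le_trans (hf _ _ _ (vecN _)).
have upper f p : (forall e j k, bounded_by N e -> 1 <= level C f e j k) ->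
    \sum_(j < J) \sum_y D f p j (cell (cl y)) <= (m ^ n)%:R.
  move=> hf; have h : forall j k, 1 <= level C f (vec p.1) j k by move=> j k; apply: hf.
  apply: le_trans (energy m J h (vecN _)); apply: ler_sum => j _.
  apply: (@le_trans _ _ (\sum_(x : {ffun 'I_n -> 'I_m} |
      box (2 ^ J * N + 2 ^ J * N) x) D f p j (cell x))).
    exact: (sum_inj_le inj bcl (fun x => D0 f p j (cell x) hf)).
  apply: (@box_shift _ _ _ _ _ (level_deficit C f (vec p.1) j)) => [k|i].
    by apply: deficit_ge0; apply: lt_le_trans (h _ _).
  rewrite mulmxnE -mulr_natr natz abszM mulnC leq_mul //; last exact: vecN.
  by rewrite absz_nat leq_exp2l // ltnW.
have bad : forall y (j : 'I_J), theta <=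
    \sum_(p : E * E) (D phi p j (cell (cl y)) + D psi p j (cell (cl y))).
  move=> y j'; apply: contrapT => /negP; rewrite -ltNge => lt_theta; apply: none.
  exists y, j'; split=> // e z /vec_surj[e' <-] /vec_surj[z' <-].
  have le_sum f g : (forall e j k, bounded_by N e -> 1 <= level C f e j k) ->
     (forall e j k, bounded_by N e -> 1 <= level C g e j k) ->
     D f (e', z') j' (cell (cl y)) <= \sum_(p : E * E) (D f p j' (cell (cl y)) + D g p j' (cell (cl y))).
    move=> hf hg; rewrite (bigD1 (e', z')) //= -addrA lerDl addr_ge0 ?D0 //.
    by apply: sumr_ge0 => p _; rewrite addr_ge0 ?D0.
  split; apply: le_trans (ltW lt_theta); first exact: le_sum.
  under eq_bigr do rewrite addrC.
  exact: le_sum.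
have lower : (m1 ^ n)%:R * (J%:R * theta) <=
    \sum_y \sum_(j < J) \sum_(p : E * E) (D phi p j (cell (cl y)) + D psi p j (cell (cl y))).
  apply: le_trans (_ : \sum_(y : {ffun 'I_n -> 'I_m1}) \sum_(j < J) theta <= _).
    by rewrite !sumr_const card_ffun !card_ord !mulr_natl.
  by apply: ler_sum => y _; apply: ler_sum => j _.
have : (m1 ^ n)%:R * (J%:R * theta) <=
    ((2 * N).+1 ^ n * (2 * N).+1 ^ n)%:R * ((m ^ n)%:R + (m ^ n)%:R).
  apply: le_trans lower _; rewrite exchange_big /=.
  under eq_bigr do rewrite exchange_big /=.
  rewrite exchange_big /=.
  apply: le_trans (_ : \sum_(p : E * E) ((m ^ n)%:R + (m ^ n)%:R) <= _); last first.
    by rewrite sumr_const card_prod !card_ffun !card_ord mulr_natl.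
  apply: ler_sum => p _; under eq_bigr do rewrite big_split.
  by rewrite big_split lerD // upper.
rewrite leNgt => /negP; apply.
have -> : ((2 * N).+1 ^ n * (2 * N).+1 ^ n)%:R * ((m ^ n)%:R + (m ^ n)%:R) =
  (m1 ^ n)%:R * ((2 * ((2 * N).+1 ^ n * (2 * N).+1 ^ n) * kappa ^ n)%:R) :> R.
  by rewrite mE expnMn !natrM; ring.
by rewrite ltr_pM2l // ltr0n expn_gt0 m10.
Qed.

End Pigeonhole.

(** * Small third differences at contact points *)

Section Third.
Context {R : realType} {V : lmodType R}.
Implicit Types (f : V -> R) (x h : V).

Definition third_diff f x h : R :=
  f (x + 3 *: h) - 3 * f (x + 2 *: h) + 3 * f (x + h) - f x.

End Third.

Section Lattice.
Context {R : realType} {n : nat}.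
Implicit Types (f g : 'rV[R]_n -> R) (x y l p c : 'rV[R]_n) (K h rho sigma : R).
Implicit Types (e z k w : 'rV[int]_n).

Definition emb e : 'rV[R]_n := \row_i (e 0 i)%:~R.

Lemma embD e z : emb (e + z) = emb e + emb z.
Proof. by apply/rowP => i; rewrite !mxE intrD. Qed.

Lemma embN e : emb (- e) = - emb e.
Proof. by apply/rowP => i; rewrite !mxE intrN. Qed.

Lemma embMn e m : emb (e *+ m) = m%:R *: emb e.
Proof. by apply/rowP => i; rewrite !mxE mulmxnE rmorphMn /= mulr_natl. Qed.

Lemma norm_emb N e : bounded_by N e -> `|emb e| <= N%:R.
Proof.
move=> he; apply: norm_le_coord => [|i]; first exact: ler0n.
by rewrite mxE -intr_norm -abszE -pmulrn ler_nat.
Qed.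

(** The factor h^-2 makes second differences along lattice vectors independent of
    the mesh, so that the constants of the lattice estimates do not depend on h. *)
Definition grid f c h : 'rV[int]_n -> R := fun k => f (c + h *: emb k) / h ^+ 2.

Lemma below_second_diff K f x p (w : 'rV[R]_n) : below K f x p ->
  - (2 * K * sq w) <= f (x + w) + f (x - w) - 2 * f x.
Proof.
move=> b; have := b (x + w); have := b (x - w).
have -> : x - w - x = - w by rewrite addrAC subrr add0r.
have -> : x + w - x = w by rewrite addrAC subrr add0r.
rewrite dotNr sqN; lra.
Qed.

Lemma grid_second_diff f c h e j k : h != 0 ->
  second_diff (grid f c h) (e *+ 2 ^ j) k / 4 ^+ j =
  (f (c + h *: emb k + (2 ^+ j * h) *: emb e)
   + f (c + h *: emb k - (2 ^+ j * h) *: emb e) - 2 * f (c + h *: emb k))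
  / (2 ^+ j * h) ^+ 2.
Proof.
move=> h0; rewrite /second_diff /grid !embD embN embMn natrX !scalerDr scalerN.
rewrite !scalerA (mulrC h) !addrA exprMn -exprM mulnC exprM.
have -> : (2 : R) ^+ 2 = 4 by ring.
have h4 : (4 : R) ^+ j != 0 by rewrite expf_neq0.
by field; rewrite h0 h4.
Qed.

Lemma grid_level_ge1 K f c h N e j k : 0 <= K -> 0 < h -> semiconvex K f -> bounded_by N e ->
  1 <= level (2 * K * (n%:R * N%:R ^+ 2) + 1) (grid f c h) e j k.
Proof.
move=> K0 h0 hf eN; rewrite /level grid_second_diff ?gt_eqF //.
set r := 2 ^+ j * h; have r0 : 0 < r by rewrite mulr_gt0 // exprn_gt0.
have [p /(@below_second_diff _ _ _ _ (r *: emb e)) lo] := hf (c + h *: emb k).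
rewrite addrA lerDr -lerBlDr sub0r ler_pdivlMr ?exprn_gt0 //.
apply: le_trans lo; rewrite mulNr lerN2 sqZ.
have -> : 2 * K * (r ^+ 2 * sq (emb e)) = 2 * K * r ^+ 2 * sq (emb e) by ring.
have -> : 2 * K * (n%:R * N%:R ^+ 2) * r ^+ 2 = 2 * K * r ^+ 2 * (n%:R * N%:R ^+ 2) by ring.
apply: ler_wpM2l; first by rewrite mulr_ge0 ?sqr_ge0 // mulr_ge0.
apply: le_trans (sq_norm_le _) _; apply: ler_wpM2l; first exact: ler0n.
by rewrite ler_sqr ?nnegrE ?norm_emb // ler0n.
Qed.

(** Consecutive second differences differ by a third difference. *)
Lemma grid_third f c h e z k j C : h != 0 ->
  let r := 2 ^+ j * h in
  third_diff f (c + h *: emb k + r *: emb z) (r *: emb e) / r ^+ 2 =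
  level C (grid f c h) e j (k + (z + e) *+ 2 ^ j + e *+ 2 ^ j)
  - level C (grid f c h) e j (k + (z + e) *+ 2 ^ j).
Proof.
move=> h0 r; rewrite /level !grid_second_diff // -/r /third_diff.
rewrite !embD !embMn embD natrX !scalerDr !scalerA (mulrC h) -/r.
have -> : c + (h *: emb k + (r *: emb z + r *: emb e) + r *: emb e) =
  c + h *: emb k + r *: emb z + (2 * r) *: emb e.
  by rewrite mulr2n mulrDl mul1r scalerDl !addrA.
have -> : c + (h *: emb k + (r *: emb z + r *: emb e)) =
  c + h *: emb k + r *: emb z + r *: emb e by rewrite !addrA.
have -> : c + h *: emb k + r *: emb z + (2 * r) *: emb e + r *: emb e =
   c + h *: emb k + r *: emb z + (3 * r) *: emb e.
  by rewrite -[in LHS]addrA -[X in _ + (_ + X)](scale1r) scalerA -scalerDl; congr (_ + _ *: _); ring.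
have -> : c + h *: emb k + r *: emb z + (2 * r) *: emb e - r *: emb e =
   c + h *: emb k + r *: emb z + r *: emb e.
  by rewrite -[in LHS]addrA -scalerBl; congr (_ + _ *: _); ring.
have -> : c + h *: emb k + r *: emb z + r *: emb e + r *: emb e =
   c + h *: emb k + r *: emb z + (2 * r) *: emb e.
  by rewrite -[in LHS]addrA -scalerDl; congr (_ + _ *: _); ring.
rewrite addrK.
have r0 : r != 0 by rewrite mulf_neq0 // expf_neq0.
by field.
Qed.

(** Unlike the lower bound, which holds everywhere, this bound is available only near
    points where f has a paraboloid above it. *)
Lemma grid_level_le K f x p rho C S c h e z k j N :
  0 <= K -> 0 < h -> below K f x p ->
  (forall y, `|y - x| <= rho -> f y <= f x + dot p (y - x) + K * sq (y - x)) ->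
  bounded_by (3 * N) z -> bounded_by N e ->
  `|c + h *: emb k - x| <= 2 ^+ j * h ->
  (4 * N + 1)%:R * (2 ^+ j * h) <= rho ->
  4 * K * (n%:R * (4 * N + 1)%:R ^+ 2) + C <= S ->
  level C (grid f c h) e j (k + z *+ 2 ^ j) <= S.
Proof.
move=> K0 h0 lo up zN eN kx small; apply: le_trans.
rewrite /level grid_second_diff ?gt_eqF // lerD2r.
set r := 2 ^+ j * h in kx small *; have r0 : 0 < r by rewrite mulr_gt0 // exprn_gt0.
rewrite embD embMn natrX !scalerDr !scalerA (mulrC h) -/r addrA.
clearbody r.
have bnd y a : `|a| <= 1 -> y = c + h *: emb k + r *: emb z + (a * r) *: emb e ->
    `|y - x| <= (4 * N + 1)%:R * r.
  move=> a1 ->; have -> : c + h *: emb k + r *: emb z + (a * r) *: emb e - x =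
    (c + h *: emb k - x) + r *: emb z + (a * r) *: emb e by rewrite !(addrAC _ _ (- x)).
  apply: le_trans (ler_normD _ _) _; apply: le_trans (lerD (ler_normD _ _) (lexx _)) _.
  rewrite !normrZ (gtr0_norm r0).
  have h1 := norm_emb zN; have h2 := norm_emb eN.
  have h3 : r * `|emb z| <= r * (3 * N)%:R by rewrite ler_pM2l.
  have h4 : `|a| * r * `|emb e| <= 1 * r * N%:R.
    by rewrite ler_pM ?mulr_ge0 ?ler_wpM2r // ltW.
  move: h3 h4; rewrite natrD !natrM; lra.
have sqb y a : `|a| <= 1 -> y = c + h *: emb k + r *: emb z + (a * r) *: emb e ->
    K * sq (y - x) <= K * (n%:R * ((4 * N + 1)%:R * r) ^+ 2).
  move=> a1 /(bnd _ _ a1) le; apply: ler_wpM2l => //.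
  apply: le_trans (sq_norm_le _) _; apply: ler_wpM2l; first exact: ler0n.
  by rewrite ler_sqr ?nnegrE // mulr_ge0 // ?ler0n // ltW.
set A := c + _ + _ in bnd sqb *.
have E1 : A + r *: emb e = A + (1 * r) *: emb e by rewrite mul1r.
have E2 : A - r *: emb e = A + (-1 * r) *: emb e by rewrite mulN1r scaleNr.
have E0 : A = A + (0 * r) *: emb e by rewrite mul0r scale0r addr0.
have n1 : `|1 : R| <= 1 by rewrite normr1.
have nN1 : `|-1 : R| <= 1 by rewrite normrN1.
have n0 : `|0 : R| <= 1 by rewrite normr0.
have u1 := up _ (le_trans (bnd _ _ n1 E1) small).
have u2 := up _ (le_trans (bnd _ _ nN1 E2) small).
have u0 := lo A.
have s1 := sqb _ _ n1 E1; have s2 := sqb _ _ nN1 E2; have s0 := sqb _ _ n0 E0.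
have D : dot p (A + r *: emb e - x) + dot p (A - r *: emb e - x) = 2 * dot p (A - x).
  by rewrite !(dotDr, dotNr); ring.
rewrite ler_pdivrMr ?exprn_gt0 //.
have -> : 4 * K * (n%:R * (4 * N + 1)%:R ^+ 2) * r ^+ 2 =
  4 * (K * (n%:R * ((4 * N + 1)%:R * r) ^+ 2)) by rewrite exprMn; ring.
lra.
Qed.

End Lattice.

Section GoodScale.
Context {R : realType} {n : nat}.
Implicit Types (f g : 'rV[R]_n -> R) (x l p c : 'rV[R]_n) (K h rho sigma : R).
Implicit Types (e z k w : 'rV[int]_n).

Lemma bounded_byD M N e z : bounded_by M e -> bounded_by N z -> bounded_by (M + N) (e + z).
Proof.
move=> he hz i; rewrite mxE; have := he i; have := hz i.
by move: (e 0 i) (z 0 i) => a b; lia.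
Qed.

Lemma bounded_byN N e : bounded_by N e -> bounded_by N (- e).
Proof. by move=> he i; rewrite mxE abszN. Qed.

Lemma bounded_byW M N e : (M <= N)%N -> bounded_by M e -> bounded_by N e.
Proof. by move=> MN he i; apply: leq_trans MN. Qed.

Lemma round_to_grid (m B : nat) h c x : 0 < h ->
  (forall i, h * B%:R <= x 0 i - c 0 i) ->
  (forall i, x 0 i - c 0 i <= h * (m%:R - B.+1%:R)) ->
  exists a : {ffun 'I_n -> 'I_m}, box B a /\
    forall i, h * (a i)%:R <= x 0 i - c 0 i < h * (a i).+1%:R.
Proof.
move=> h0 lo hi.
pose t i := (x 0 i - c 0 i) / h.
have tlo i : B%:R <= t i by rewrite ler_pdivlMr // mulrC.
have t0 i : 0 <= t i by apply: le_trans (tlo i); rewrite ler0n.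
have thi i : t i <= m%:R - B.+1%:R by rewrite ler_pdivrMr // mulrC.
have tm i : (Num.truncn (t i) + B < m)%N.
  have /andP[h1 _] := truncn_itv (t0 i).
  have : (Num.truncn (t i) + B.+1)%:R <= m%:R :> R.
    by rewrite natrD; have := thi i; lra.
  by rewrite ler_nat addnS.
have tm' i : (Num.truncn (t i) < m)%N by apply: leq_ltn_trans (tm i); rewrite leq_addr.
exists [ffun i => Ordinal (tm' i)]; split.
  by apply/forallP => i; rewrite ffunE /= tm truncn_ge_nat ?tlo ?t0.
move=> i; rewrite ffunE /=; have /andP[h1 h2] := truncn_itv (t0 i).
have -> : x 0 i - c 0 i = h * t i by rewrite /t mulrC divfK ?gt_eqF.
by rewrite ler_pM2l // ltr_pM2l // h1.
Qed.

Lemma level_third_small f K x p rho c h N j k e z (eta S C r : R) : r = 2 ^+ j * h ->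
  0 < K -> 0 < h -> semiconvex K f -> below K f x p ->
  (forall y, `|y - x| <= rho -> f y <= f x + dot p (y - x) + K * sq (y - x)) ->
  bounded_by N z -> bounded_by N e ->
  `|c + h *: emb k - x| <= r -> (4 * N + 1)%:R * r <= rho ->
  C = 2 * K * (n%:R * (2 * N)%:R ^+ 2) + 1 ->
  S = 4 * K * (n%:R * (4 * N + 1)%:R ^+ 2) + C -> 0 < eta ->
  level_deficit C (grid f c h) e j (k + (z + e) *+ 2 ^ j) <= eta ^+ 2 / (8 * S ^+ 3) ->
  `|third_diff f (c + h *: emb k + r *: emb z) (r *: emb e)| <= eta * r ^+ 2.
Proof.
move=> rE K0 h0 hf lo up zN eN kx small CE SE eta0 ld.
have N3 : (3 * N = N + N + N)%N by rewrite !mulSn mul0n addn0 addnA.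
have r0 : 0 < r by rewrite rE mulr_gt0 // exprn_gt0.
have ge1 j' k' : 1 <= level C (grid f c h) e j' k'.
  rewrite CE; apply: grid_level_ge1 => //; first exact: ltW.
  by apply: bounded_byW eN; rewrite leq_pmull.
have gt0 j' k' : 0 < level C (grid f c h) e j' k' by apply: lt_le_trans (ge1 _ _).
have C0 : 0 < C.
  by rewrite CE ltr_wpDl // !mulr_ge0 ?ler0n // ?sqr_ge0 // ltW.
have S0 : 0 < S.
  by rewrite SE ltr_wpDl // !mulr_ge0 ?ler0n // ?sqr_ge0 // ltW.
have leS z' : bounded_by (3 * N) z' -> level C (grid f c h) e j (k + z' *+ 2 ^ j) <= S.
  move=> z'N; apply: (grid_level_le (ltW K0) h0 lo up z'N eN) => //.
  - by rewrite -rE.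
  - by rewrite -rE.
  - by rewrite SE.
have zeN : bounded_by (N + N) (z + e) by apply: bounded_byD.
have l1 : level C (grid f c h) e j (k + (z + e) *+ 2 ^ j - e *+ 2 ^ j) <= S.
  rewrite -addrA -mulrnBl; apply: leS.
  rewrite N3.
  by apply: bounded_byD => //; apply: bounded_byN.
have l2 : level C (grid f c h) e j (k + (z + e) *+ 2 ^ j) <= S.
  by apply: leS; apply: bounded_byW zeN; rewrite N3 leq_addr.
have l3 : level C (grid f c h) e j (k + (z + e) *+ 2 ^ j + e *+ 2 ^ j) <= S.
  rewrite -addrA -mulrnDl; apply: leS.
  rewrite N3.
  exact: bounded_byD.
have := deficit_small (gt0 _ _) (gt0 _ _) (gt0 _ _) l1 l2 l3.
rewrite -/(level_deficit C (grid f c h) e j _) => ds.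
have S3 : 0 < 8 * S ^+ 3 by rewrite mulr_gt0 // exprn_gt0.
have {}ds : (level C (grid f c h) e j (k + (z + e) *+ 2 ^ j + e *+ 2 ^ j)
  - level C (grid f c h) e j (k + (z + e) *+ 2 ^ j)) ^+ 2 <= eta ^+ 2.
  apply: le_trans ds _; rewrite mulrC -ler_pdivlMr //.
move: ds; rewrite -(grid_third f c e z k j C (lt0r_neq0 h0)) -rE => ds.
rewrite -ler_pdivrMr ?exprn_gt0 //.
have -> : `|third_diff f (c + h *: emb k + r *: emb z) (r *: emb e)| / r ^+ 2 =
  `|third_diff f (c + h *: emb k + r *: emb z) (r *: emb e) / r ^+ 2|.
  by rewrite normrM (ger0_norm (x := _^-1)) // invr_ge0 sqr_ge0.
by rewrite -ler_sqr ?nnegrE ?normr_ge0 ?(ltW eta0) // real_normK ?num_real.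
Qed.

(** A discrete counterpart of the theorems of Jensen and Alexandrov. Slopes that
    are multiples of tau h have their contact points in different cells, so the
    fraction of the cells that contain one is bounded below independently of the
    mesh h. This makes it possible to fix the number J of scales first and to take
    h so small that even the largest scale is below eta. *)
Lemma good_scale f g K x0 sigma rho (delta : R) : 0 < K -> semiconvex K f -> semiconvex K g ->
  0 < sigma -> sigma < rho -> 0 < delta ->
  (forall l, `|l| <= delta -> exists x, `|x - x0| <= sigma /\ contact f g x0 rho l x) ->
  forall (N : nat) (eta : R), 0 < eta ->
  exists l x c (r : R), [/\ `|l| <= delta /\ `|x - x0| <= sigma, contact f g x0 rho l x,
    0 < r <= eta, `|c - x| <= r &
    forall z e, bounded_by N z -> bounded_by N e ->
      `|third_diff f (c + r *: emb z) (r *: emb e)| <= eta * r ^+ 2 /\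
      `|third_diff g (c + r *: emb z) (r *: emb e)| <= eta * r ^+ 2].
Proof.
move=> K0 hf hg s0 sr d0 hct N eta eta0.
pose C : R := 2 * K * (n%:R * (2 * N)%:R ^+ 2) + 1.
pose S : R := 4 * K * (n%:R * (4 * N + 1)%:R ^+ 2) + C.
have C0 : 0 < C.
  by rewrite ltr_wpDl // !mulr_ge0 ?ler0n // ?sqr_ge0 // ltW.
have S0 : 0 < S.
  by rewrite ltr_wpDl // !mulr_ge0 ?ler0n // ?sqr_ge0 // ltW.
pose theta := eta ^+ 2 / (8 * S ^+ 3).
have theta0 : 0 < theta by rewrite divr_gt0 ?exprn_gt0 // mulr_gt0 // exprn_gt0.
(* slopes tau * h apart have contact points in different cells, by contact_separated *)
pose tau := 8 * K * n%:R + 1.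
have tau0 : 0 < tau by rewrite ltr_wpDl // !mulr_ge0 ?ler0n // ltW.
(* the ratio of the numbers of cells and of slopes per axis: with h = delta / (tau * m1)
   a cube of kappa * m1 cells per axis contains the contact points, with a margin of 1 *)
pose kappa := Num.bound (2 * (sigma + 1) * tau / delta).
have kappaP : 2 * (sigma + 1) <= kappa%:R * delta / tau.
  rewrite ler_pdivlMr // -ler_pdivrMr //; apply/ltW/archi_boundP.
  have sig1 : 0 < sigma + 1 by lra.
  by rewrite divr_ge0 ?ltW // !mulr_gt0.
pose Q := (2 * ((2 * (2 * N)).+1 ^ n * (2 * (2 * N)).+1 ^ n) * kappa ^ n)%N.
pose J := Num.bound (Q%:R / theta).
have JP : Q%:R < J%:R * theta.
  rewrite -ltr_pdivrMr //; apply: archi_boundP.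
  by rewrite divr_ge0 ?ler0n // ltW.
pose B := (2 ^ J * (2 * N) + 2 ^ J * (2 * N))%N.
pose D := (2 ^ J * (4 * N + 1) + B.+1)%N.
(* D collects all multiples of h that have to stay small *)
pose eps := minr (minr 1 eta) (rho - sigma).
have eps0 : 0 < eps by rewrite !lt_min eta0 subr_gt0 sr ltr01.
pose m1 := (Num.bound (delta * D%:R / (tau * eps))).+1.
pose h := delta / (tau * m1%:R).
have m10 : 0 < m1%:R :> R by rewrite ltr0n.
have h0 : 0 < h by rewrite divr_gt0 // mulr_gt0.
have hD : h * D%:R <= eps.
  rewrite /h mulrAC ler_pdivrMr ?mulr_gt0 // mulrA -ler_pdivrMl ?mulr_gt0 //.
  apply: (@le_trans _ _ (Num.bound (delta * D%:R / (tau * eps)))%:R); last first.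
    by rewrite ler_nat.
  rewrite mulrC (mulrC eps); apply/ltW/archi_boundP.
  have D0 : 0 < D%:R :> R by rewrite ltr0n /D addnS.
  by rewrite divr_ge0 ?ltW // mulr_gt0.
have hD' (a : nat) : (a <= D)%N -> h * a%:R <= eps.
  by move=> aD; apply: le_trans hD; rewrite ler_pM2l // ler_nat.
have eps1 : eps <= 1 by rewrite !ge_min lexx.
have epseta : eps <= eta by rewrite !ge_min lexx orbT.
have epsrho : eps <= rho - sigma by rewrite !ge_min lexx !orbT.
pose m := (kappa * m1)%N.
have side : h * m%:R = kappa%:R * delta / tau.
  by rewrite /h /m natrM; field; rewrite !gt_eqF.
have hm1 : tau * h * m1%:R = delta by rewrite /h; field; rewrite !gt_eqF.
have m1_gt0 : (0 < m1)%N by [].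
have tauK : 8 * K * n%:R < tau by rewrite ltrDl.
clearbody h tau kappa J eps m1.
have th0 : 0 < tau * h by rewrite mulr_gt0.
pose c0 := x0 - const_mx (h * m%:R / 2) : 'rV[R]_n.
pose slope (y : {ffun 'I_n -> 'I_m1}) : 'rV[R]_n := \row_i (tau * h * (y i)%:R).
have slope_le y : `|slope y| <= delta.
  apply: norm_le_coord => [|i]; first exact: ltW.
  rewrite mxE normrM (gtr0_norm th0) normr_nat.
  by rewrite -hm1 (ler_pM2l th0) ler_nat ltnW.
have [X XP] := choice (fun y => hct _ (slope_le y)).
have cellP y : exists a : {ffun 'I_n -> 'I_m}, box B a /\
    forall i, h * (a i)%:R <= X y 0 i - c0 0 i < h * (a i).+1%:R.
  have [Xs _] := XP y.
  have hB : h * B.+1%:R <= 1 by apply: le_trans eps1; apply: hD'; rewrite leq_addl.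
  have sd : 2 * (sigma + 1) <= h * m%:R by rewrite side.
  apply: round_to_grid => // i; rewrite !mxE;
    have := le_trans (coord_le_norm (X y - x0) i) Xs; rewrite !mxE ler_norml => /andP[h1 h2].
    by move: hB; rewrite -[B.+1%:R]natr1 mulrDr mulr1; lra.
  by rewrite mulrBr; lra.
have [cl clP] := choice cellP.
have Xc y : `|c0 + h *: emb (cell (cl y)) - X y| <= h.
  apply: norm_le_coord => [|i]; first exact: ltW.
  have [_ /(_ i) /andP[h1 h2]] := clP y.
  rewrite !mxE -pmulrn.
  move: h1 h2; rewrite !mxE -[(cl y i).+1%:R]natr1 mulrDr mulr1 => h1 h2.
  by rewrite ler_norml; apply/andP; split; lra.
have inj : injective cl.
  move=> y y' e.
  have near : `|X y - X y'| <= h.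
    apply: norm_le_coord => [|i]; first exact: ltW.
    have [_ /(_ i) /andP[h1 h2]] := clP y.
    have [_ /(_ i) /andP[h3 h4]] := clP y'.
    move: h1 h2 h3 h4; rewrite e !mxE -[(cl y' i).+1%:R]natr1 mulrDr mulr1 => h1 h2 h3 h4.
    by rewrite ler_norml; apply/andP; split; lra.
  have sh : sigma + h <= rho.
    have D1 : (1 <= D)%N by rewrite /D addnS.
    by have := hD' 1%N D1; rewrite mulr1; lra.
  have [s1 c1] := XP y; have [s2 c2] := XP y'.
  have sep := contact_separated (ltW K0) hf hg h0 sh s1 s2 near c1 c2.
  apply/ffunP => i; apply: val_inj => /=.
  have : `|tau * h * (y i)%:R - tau * h * (y' i)%:R| < tau * h.
    have := le_lt_trans (le_trans (coord_le_norm (slope y - slope y') i) sep).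
    by rewrite !mxE; apply; rewrite ltr_pM2r.
  rewrite -mulrBr normrM (gtr0_norm th0) -[X in _ < X]mulr1 (ltr_pM2l th0).
  rewrite ltr_norml => /andP[u1 u2].
  have v1 : (y i)%:R < ((y' i).+1)%:R :> R by rewrite -natr1; lra.
  have v2 : (y' i)%:R < ((y i).+1)%:R :> R by rewrite -natr1; lra.
  move: v1 v2; rewrite !ltr_nat !ltnS => v1 v2.
  by apply/eqP; rewrite eqn_leq v1 v2.
have lev u : semiconvex K u -> forall e j k, bounded_by (2 * N) e -> 1 <= level C (grid u c0 h) e j k.
  by move=> hu e j k eN; apply: grid_level_ge1 => //; exact: ltW.
have [y [j [jJ good]]] := scale_pigeonhole (lev f hf) (lev g hg) inj
   (fun y => (clP y).1) (erefl _) m1_gt0 JP.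
have [Xs Xct] := XP y.
exists (slope y), (X y), (c0 + h *: emb (cell (cl y))), (2 ^+ j * h).
have r0 : 0 < 2 ^+ j * h by rewrite mulr_gt0 // exprn_gt0.
have jJ2 : (2 ^ j <= 2 ^ J)%N by rewrite leq_exp2l // ltnW.
have rsmall : (4 * N + 1)%:R * (2 ^+ j * h) <= eps.
  rewrite -natrX mulrA -natrM mulrC; apply: hD'.
  by rewrite mulnC (leq_trans _ (leq_addr _ _)) // leq_mul2r jJ2 orbT.
have hr : h <= 2 ^+ j * h by rewrite ler_peMl ?exprn_ege1 ?ler1n // ltW.
have kx : `|c0 + h *: emb (cell (cl y)) - X y| <= 2 ^+ j * h by apply: le_trans hr.
split=> //.
  rewrite r0 /= (le_trans _ epseta) // (le_trans _ rsmall) // ler_peMl ?(ltW r0) //.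
  by rewrite ler1n addn1.
move=> z e zN eN.
have zeN : bounded_by (2 * N) (z + e).
  by rewrite mul2n -addnn; apply: bounded_byD.
have e2N : bounded_by (2 * N) e by apply: bounded_byW eN; rewrite leq_pmull.
have [gf gg] := good _ _ e2N zeN.
have [pf hpf] := hf (X y); have [pg hpg] := hg (X y).
have Xrho : `|X y - x0| < rho by apply: le_lt_trans sr.
have sl := contact_slope (ltW K0) Xrho Xct hpf hpg.
have inQ y' : `|y' - X y| <= rho - sigma -> `|y' - x0| <= rho.
  move=> h1; have -> : y' - x0 = (y' - X y) + (X y - x0) by rewrite addrA subrK.
  by apply: le_trans (ler_normD _ _) _; lra.
have sl' : pg + pf = slope y by rewrite addrC.
have Xct' : contact g f x0 rho (slope y) (X y).
  by move=> y' /Xct; rewrite (addrC (g y')) (addrC (g _)).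
split.
- apply: (level_third_small (K := K) (p := pf) (rho := rho - sigma) (S := S) (C := C)) gf => //.
    by move=> y' /inQ; apply: (contact_above Xct hpg sl).
  exact: le_trans epsrho.
- apply: (level_third_small (K := K) (p := pg) (rho := rho - sigma) (S := S) (C := C)) gg => //.
    by move=> y' /inQ; apply: (contact_above Xct' hpf sl').
  exact: le_trans epsrho.
Qed.

End GoodScale.

(** * Functions with vanishing third differences *)

Section AdditiveBounded.
Context {R : realType}.

(** The additive function phi t - t phi 1 vanishes on the integers, hence is bounded
    on the whole line, and a bounded additive function is zero. *)
Lemma additive_bounded_linear (phi : R -> R) (B : R) :
  (forall s t, phi (s + t) = phi s + phi t) -> (forall t, `|t| <= 1 -> `|phi t| <= B) ->
  forall t, phi t = t * phi 1.
Proof.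
move=> add bnd.
have phi0 : phi 0 = 0 by have := add 0 0; rewrite addr0; lra.
have phiN t : phi (- t) = - phi t by have := add t (- t); rewrite subrr phi0; lra.
have phiMn t m : phi (t *+ m) = phi t *+ m.
  by elim: m => [|m ih]; rewrite ?mulr0n // !mulrS add ih.
have phin m : phi m%:R = m%:R * phi 1 by rewrite phiMn mulr_natl.
pose psi t := phi t - t * phi 1.
have psiB t : `|psi t| <= B + `|phi 1|.
  have -> : psi t = psi (t - (Num.floor t)%:~R).
    have E m : psi (t - m%:R) = psi t.
      by rewrite /psi add phiN phin; ring.
    have E' m : psi (t + m%:R) = psi t.
      by rewrite /psi add phin; ring.
    case: (Num.floor t) => m; first by rewrite -pmulrn E.
    by rewrite NegzE intrN opprK -pmulrn E'.
  have /andP[h1 h2] := floor_itv t.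
  set s := t - _; have s0 : 0 <= s by rewrite subr_ge0.
  have s1 : s <= 1 by rewrite /s; move: h2; rewrite intrD; lra.
  have ns : `|s| <= 1 by rewrite ger0_norm.
  apply: le_trans (ler_normB _ _) _; apply: lerD; first exact: bnd.
  by rewrite normrM ler_piMl.
move=> t; apply/eqP; rewrite -subr_eq0 -normr_le0; apply/negP => /negP; rewrite -ltNge.
rewrite -/(psi t) => p0.
pose m := Num.bound ((B + `|phi 1|) / `|psi t|).
have : (B + `|phi 1|) / `|psi t| < m%:R.
  by apply: archi_boundP; rewrite divr_ge0 // (le_trans _ (psiB 0)).
rewrite ltr_pdivrMr // ltNge => /negP; apply.
have -> : m%:R * `|psi t| = `|psi (t *+ m)|.
  rewrite -normr_nat -normrM; congr normr.
  by rewrite /psi phiMn -(mulr_natl t) -(mulr_natl (phi t)); ring.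
exact: psiB.
Qed.

End AdditiveBounded.

Section Quadratic.
Context {R : realType} {n : nat}.
Implicit Types (x a b c z : 'rV[R]_n) (U : 'rV[R]_n -> R).

(** Djokovic's identity: with increments a, 2 b', 3 c', the mixed difference is a
    signed sum of pure third differences, one for each vertex of a cube; all terms
    other than those of the mixed difference cancel. *)
Lemma mixed_third U : (forall x h, third_diff U x h = 0) -> forall x a b c,
  U (x + a + b + c) - U (x + a + b) - U (x + a + c) - U (x + b + c)
  + U (x + a) + U (x + b) + U (x + c) - U x = 0.
Proof.
move=> U3 x a b0 c0; pose b := 2^-1 *: b0; pose c := 3^-1 *: c0.
have b2 : b0 = 2 *: b by rewrite scalerA mulfV ?scale1r // pnatr_eq0.
have c3 : c0 = 3 *: c by rewrite scalerA mulfV ?scale1r // pnatr_eq0.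
clearbody b c; rewrite {}b2 {}c3.
pose v (i j k : R) := x + (i *: a + j *: b + k *: c).
have line (i j k : R) y0 y1 y2 y3 : y1 = y0 + (v i j k - x) ->
    y2 = y0 + 2 *: (v i j k - x) -> y3 = y0 + 3 *: (v i j k - x) ->
    U y3 - 3 * U y2 + 3 * U y1 - U y0 = 0.
  by move=> -> -> ->; exact: U3.
have e1 : U (v (-2) (-1) 0) - 3 * U (v (-1) 0 1) + 3 * U (v 0 1 2) - U (v 1 2 3) = 0.
  by apply: (line (-1) (-1) (-1)); apply/rowP => t; rewrite !mxE; ring.
have e2 : U (v (-2) (-1) 0) - 3 * U (v (-1) 0 0) + 3 * U (v 0 1 0) - U (v 1 2 0) = 0.
  by apply: (line (-1) (-1) 0); apply/rowP => t; rewrite !mxE; ring.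
have e3 : U (v (-2) 0 0) - 3 * U (v (-1) 0 1) + 3 * U (v 0 0 2) - U (v 1 0 3) = 0.
  by apply: (line (-1) 0 (-1)); apply/rowP => t; rewrite !mxE; ring.
have e4 : U (v 0 (-1) 0) - 3 * U (v 0 0 1) + 3 * U (v 0 1 2) - U (v 0 2 3) = 0.
  by apply: (line 0 (-1) (-1)); apply/rowP => t; rewrite !mxE; ring.
have e5 : U (v (-2) 0 0) - 3 * U (v (-1) 0 0) + 3 * U (v 0 0 0) - U (v 1 0 0) = 0.
  by apply: (line (-1) 0 0); apply/rowP => t; rewrite !mxE; ring.
have e6 : U (v 0 (-1) 0) - 3 * U (v 0 0 0) + 3 * U (v 0 1 0) - U (v 0 2 0) = 0.
  by apply: (line 0 (-1) 0); apply/rowP => t; rewrite !mxE; ring.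
have e7 : U (v 0 0 0) - 3 * U (v 0 0 1) + 3 * U (v 0 0 2) - U (v 0 0 3) = 0.
  by apply: (line 0 0 (-1)); apply/rowP => t; rewrite !mxE; ring.
have -> : x + a + 2 *: b + 3 *: c = v 1 2 3 by apply/rowP => t; rewrite !mxE; ring.
have -> : x + a + 2 *: b = v 1 2 0 by apply/rowP => t; rewrite !mxE; ring.
have -> : x + a + 3 *: c = v 1 0 3 by apply/rowP => t; rewrite !mxE; ring.
have -> : x + 2 *: b + 3 *: c = v 0 2 3 by apply/rowP => t; rewrite !mxE; ring.
have -> : x + a = v 1 0 0 by apply/rowP => t; rewrite !mxE; ring.
have -> : x + 2 *: b = v 0 2 0 by apply/rowP => t; rewrite !mxE; ring.
have -> : x + 3 *: c = v 0 0 3 by apply/rowP => t; rewrite !mxE; ring.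
have -> : U x = U (v 0 0 0) by congr U; apply/rowP => t; rewrite !mxE; ring.
clearbody v; lra.
Qed.

(** By [mixed_third] the form U (a + b) - U a - U b is additive in each argument, and
    the growth condition makes it linear over the reals. The same condition rules
    out a linear part of U, that is, it forces U (2 z) = 4 U z. *)
Lemma third0_quadratic U (C : R) :
  0 <= C -> (forall x h, third_diff U x h = 0) -> (forall z, `|U z| <= C * `|z| ^+ 2) ->
  exists A : 'M[R]_n, A^T = A /\ forall z, U z = 2^-1 * dot (z *m A) z.
Proof.
move=> C0 U3 UC.
have U0 : U 0 = 0.
  by apply/eqP; rewrite -normr_le0 (le_trans (UC 0)) // normr0 expr2 mul0r mulr0.
have M := mixed_third U3.
pose beta a b := U (a + b) - U a - U b.
have betaC a b : beta a b = beta b a by rewrite /beta (addrC b); lra.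
have betaD a a' b : beta (a + a') b = beta a b + beta a' b.
  by have := M 0 a a' b; rewrite !add0r U0 /beta; lra.
(* d measures the linear part of U, so it is homogeneous of degree 1 under doubling,
   while it is bounded by a multiple of |z|^2 *)
have U4 z : U (2 *: z) = 4 * U z.
  pose d z := U (2 *: z) - 4 * U z.
  have dd y : d (2 *: y) = 2 * d y.
    have := U3 0 y; have := U3 y y; rewrite /third_diff /d !add0r U0.
    have -> : y + 3 *: y = 4 *: y by apply/rowP => t; rewrite !mxE; ring.
    have -> : y + 2 *: y = 3 *: y by apply/rowP => t; rewrite !mxE; ring.
    have -> : y + y = 2 *: y by apply/rowP => t; rewrite !mxE; ring.
    have -> : 2 *: (2 *: y) = 4 *: y by apply/rowP => t; rewrite !mxE; ring.
    lra.
  have dC y : `|d y| <= 8 * C * `|y| ^+ 2.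
    have h1 := UC (2 *: y); have h2 := UC y.
    rewrite normrZ normr_nat exprMn in h1.
    apply: le_trans (ler_normB _ _) _; rewrite normrM normr_nat.
    have : (2 : R) ^+ 2 = 4 by ring.
    lra.
  have dm m : d z = 2 ^+ m * d (2^-1 ^+ m *: z).
    elim: m => [|m ih]; first by rewrite !expr0 mul1r scale1r.
    rewrite ih exprSr -mulrA -dd scalerA; congr (_ * d (_ *: _)).
    by rewrite exprS mulrA mulfV ?mul1r // pnatr_eq0.
  suff : d z = 0 by rewrite /d; lra.
  apply/eqP; rewrite -normr_le0; apply/negP => /negP; rewrite -ltNge => p0.
  pose m := Num.bound (8 * C * `|z| ^+ 2 / `|d z|).
  have q0 : 0 <= 8 * C * `|z| ^+ 2 by apply: le_trans (dC z).
  have : 8 * C * `|z| ^+ 2 / `|d z| < m%:R by apply: archi_boundP; rewrite divr_ge0.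
  rewrite ltr_pdivrMr // ltNge => /negP; apply.
  have h2m : m%:R <= 2 ^+ m :> R by rewrite -natrX ler_nat ltnW // ltn_expl.
  apply: le_trans (_ : 2 ^+ m * `|d z| <= _); first by rewrite ler_pM2r.
  rewrite {1}(dm m) normrM (ger0_norm (exprn_ge0 m (ler0n R 2))).
  apply: le_trans (_ : 2 ^+ m * (2 ^+ m * (8 * C * `|2^-1 ^+ m *: z| ^+ 2)) <= _).
    by rewrite !ler_pM2l ?exprn_gt0.
  rewrite normrZ ger0_norm ?exprn_ge0 ?invr_ge0 // exprVn.
  have w0 : (2 : R) ^+ m != 0 by rewrite expf_neq0 // pnatr_eq0.
  move: (2 ^+ m) w0 => w w0.
  by rewrite le_eqVlt; apply/orP; left; apply/eqP; field.
have betazz z : beta z z = 2 * U z.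
  have -> : beta z z = U (2 *: z) - U z - U z by rewrite /beta scaler_nat mulr2n.
  by rewrite U4; lra.
have betaZ t a b : beta (t *: a) b = t * beta a b.
  rewrite -[in RHS](scale1r a).
  pose B := C * (`|a| + `|b|) ^+ 2 + C * `|a| ^+ 2 + C * `|b| ^+ 2.
  apply: (@additive_bounded_linear _ (fun s => beta (s *: a) b) B).
    by move=> s s'; rewrite scalerDl betaD.
  move=> s s1; rewrite /beta /B.
  have sa : `|s *: a| <= `|a| by rewrite normrZ ler_piMl.
  have mono x y : `|x| <= y -> C * `|x| ^+ 2 <= C * y ^+ 2.
    move=> xy; have y0 := le_trans (normr_ge0 _) xy.
    by rewrite ler_wpM2l // ler_sqr ?nnegrE.
  have h1 := UC (s *: a + b); have h2 := UC (s *: a); have h3 := UC b.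
  have m1 := mono (s *: a + b) (`|a| + `|b|) (le_trans (ler_normD _ _) (lerD sa (lexx _))).
  have m2 := mono _ _ sa.
  apply: le_trans (ler_normB _ _) _; apply: lerD; last exact: h3.
  apply: le_trans (ler_normB _ _) _; apply: lerD; lra.
pose A := \matrix_(i < n, j < n) beta (delta_mx 0 i) (delta_mx 0 j).
have beta0 b : beta 0 b = 0 by rewrite /beta add0r U0; lra.
have betaE z b : beta z b = \sum_i z 0 i * beta (delta_mx 0 i) b.
  rewrite {1}(row_sum_delta z).
  rewrite (@big_morph _ _ (fun z => beta z b) 0 +%R 0 +%R) //.
  by apply: eq_bigr => i _; rewrite betaZ.
exists A; split; first by apply/matrixP => i j; rewrite !mxE betaC.
move=> z; have : beta z z = dot (z *m A) z.
  rewrite betaE /dot; under eq_bigr => i _ do rewrite betaC betaE mulr_sumr.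
  rewrite exchange_big /=; apply: eq_bigr => j _; rewrite mxE mulr_suml.
  by apply: eq_bigr => i _; rewrite mxE betaC; ring.
rewrite betazz => <-; lra.
Qed.

End Quadratic.

(** * Blow-ups along an ultrafilter *)

Section Rescale.
Context {R : realType} {n : nat}.
Implicit Types (f g W : 'rV[R]_n -> R) (x y l p c z h : 'rV[R]_n) (K T r : R).

Definition rescale f x p r : 'rV[R]_n -> R :=
  fun z => (f (x + r *: z) - f x - r * dot p z) / r ^+ 2.

Lemma rescale_third f x p r z h : r != 0 ->
  third_diff (rescale f x p r) z h = third_diff f (x + r *: z) (r *: h) / r ^+ 2.
Proof.
move=> r0; rewrite /third_diff /rescale !dotDr !dotZr.
have E (t : R) : x + r *: (z + t *: h) = x + r *: z + t *: (r *: h).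
  by rewrite scalerDr addrA !scalerA (mulrC r).
have E1 : x + r *: (z + h) = x + r *: z + r *: h by rewrite scalerDr addrA.
rewrite !E E1; move: (f _) (f _) (f _) (f _) => a b d e; field.
exact: r0.
Qed.

Lemma rescale_semiconvex K f x p r : 0 < r -> semiconvex K f -> semiconvex K (rescale f x p r).
Proof.
move=> r0 hf z; have [P hP] := hf (x + r *: z).
exists (r^-1 *: (P - p)) => y; have := hP (x + r *: y).
have -> : x + r *: y - (x + r *: z) = r *: (y - z).
  by rewrite opprD addrACA subrr add0r scalerBr.
rewrite sqZ dotZr /rescale ler_pdivlMr ?exprn_gt0 //.
set A := f _; set B := f (_ + r *: y); move=> h.
have -> : ((A - f x - r * dot p z) / r ^+ 2 + dot (r^-1 *: (P - p)) (y - z)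
   - K * sq (y - z)) * r ^+ 2 =
   A + r * dot P (y - z) - K * (r ^+ 2 * sq (y - z)) - f x - r * dot p y.
  by rewrite dotZl dotBl (dotBr p); field; rewrite gt_eqF.
lra.
Qed.

Lemma rescale_bound K f x p r z : 0 < r ->
  `|f (x + r *: z) - f x - dot p (r *: z)| <= K * sq (r *: z) ->
  `|rescale f x p r z| <= K * sq z.
Proof.
move=> r0 h; rewrite /rescale normrM (ger0_norm (x := _^-1)) ?invr_ge0 ?sqr_ge0 //.
rewrite ler_pdivrMr ?exprn_gt0 //; move: h; rewrite dotZr sqZ.
by have -> : K * sq z * r ^+ 2 = K * (r ^+ 2 * sq z) by ring.
Qed.

Definition lip_const (N : nat) K T : R :=
  let M := N%:R * (K + 2 * K * N%:R * (T + 1) ^+ 2) in M + 2 * K * N%:R * T.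

(** The slope of a supporting paraboloid at y is controlled by the values of W at
    distance 1 from y. *)
Lemma semiconvex_lipschitz K W T : 0 < K -> 0 < T -> semiconvex K W ->
  (forall z, `|z| <= T + 1 -> `|W z| <= K * sq z) ->
  forall y z, `|y| <= T -> `|z| <= T -> `|W y - W z| <= lip_const n K T * `|y - z|.
Proof.
move=> K0 T0 lb bnd.
pose Wmax := K * n%:R * (T + 1) ^+ 2.
have bW z : `|z| <= T + 1 -> `|W z| <= Wmax.
  move=> zT; apply: le_trans (bnd z zT) _.
  rewrite /Wmax -mulrA ler_wpM2l ?(ltW K0) //.
  apply: le_trans (sq_norm_le _) _; apply: ler_wpM2l; first exact: ler0n.
  by rewrite ler_sqr ?nnegrE //; lra.
have half y z : `|y| <= T -> `|z| <= T -> W y - W z <= lip_const n K T * `|y - z|.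
  move=> yT zT; have [p hp] := lb y.
  have pB i : `|p 0 i| <= K + 2 * Wmax.
    have step (s : R) : `|s| = 1 -> s * p 0 i <= K + 2 * Wmax.
      move=> s1; have := hp (y + s *: delta_mx 0 i).
      have -> : y + s *: delta_mx 0 i - y = s *: delta_mx 0 i :> 'rV[R]_n by rewrite addrC addKr.
      have nd : `|s *: delta_mx 0 i : 'rV[R]_n| <= 1.
        apply: norm_le_coord => // j; rewrite !mxE normrM s1 mul1r eqxx andTb.
        by case: (j == i); rewrite ?normr1 ?normr0.
      have := bW (y + s *: delta_mx 0 i) (le_trans (ler_normD _ _) (lerD yT nd)).
      have := bW y; have yT1 : `|y| <= T + 1 by lra.
      move=> /(_ yT1); rewrite !ler_norml => /andP[a1 a2] /andP[b1 b2].
      rewrite dotZr dot_delta sqZ.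
      have -> : s ^+ 2 = 1 by rewrite -real_normK ?num_real // s1 expr1n.
      have -> : sq (delta_mx 0 i : 'rV[R]_n) = 1 by rewrite /sq dot_delta mxE !eqxx.
      lra.
    have := step 1 (normr1 _); have := step (-1) (normrN1 _).
    by rewrite ler_norml => h1 h2; apply/andP; split; lra.
  have pn : `|p| <= K + 2 * Wmax.
    have Wmax0 : 0 <= Wmax by rewrite /Wmax mulr_ge0 ?sqr_ge0 // mulr_ge0 ?ler0n // ltW.
    by apply: norm_le_coord => //; lra.
  have := hp z; have h1 := le_trans (ler_norm _) (dot_norm_le p (y - z)).
  have h2 := sq_norm_le (z - y); rewrite distrC in h2.
  have d0 := normr_ge0 (y - z).
  have dT : `|y - z| <= 2 * T by apply: le_trans (ler_normB _ _) _; lra.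
  have h3 : n%:R * (`|p| * `|y - z|) <= n%:R * ((K + 2 * Wmax) * `|y - z|).
    by apply: ler_wpM2l; rewrite ?ler0n // ler_wpM2r.
  have h4 : K * (n%:R * `|y - z| ^+ 2) <= K * (n%:R * (2 * T * `|y - z|)).
    rewrite ler_pM2l //; apply: ler_wpM2l; first exact: ler0n.
    by rewrite expr2 ler_wpM2r.
  have h5 : K * sq (z - y) <= K * (n%:R * `|y - z| ^+ 2) by rewrite ler_pM2l.
  have -> : dot p (z - y) = - dot p (y - z) by rewrite -dotNr opprB.
  have -> : lip_const n K T * `|y - z| = n%:R * ((K + 2 * Wmax) * `|y - z|)
     + K * (n%:R * (2 * T * `|y - z|)) by rewrite /lip_const /Wmax; ring.
  lra.
move=> y z yT zT; rewrite ler_norml; apply/andP; split; last exact: half.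
by have := half z y zT yT; rewrite distrC; lra.
Qed.

Lemma third_approx W L T z h z' h' e : 
  (forall y y', `|y| <= T -> `|y'| <= T -> `|W y - W y'| <= L * `|y - y'|) ->
  0 <= L -> 0 <= e <= 1 -> `|z| + 3 * `|h| + 4 <= T ->
  `|z - z'| <= e -> `|h - h'| <= e ->
  `|third_diff W z h| <= `|third_diff W z' h'| + 32 * (L * e).
Proof.
move=> lip L0 /andP[e0 e1] big zz hh.
have pt (t : R) : 0 <= t <= 3 -> `|W (z + t *: h) - W (z' + t *: h')| <= 4 * (L * e).
  move=> /andP[t0 t3].
  have h1 : `|z + t *: h| <= `|z| + 3 * `|h|.
    apply: le_trans (ler_normD _ _) _; rewrite lerD2l normrZ ger0_norm //.
    by rewrite ler_wpM2r.
  have h2 : `|(z + t *: h) - (z' + t *: h')| <= 4 * e.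
    have -> : (z + t *: h) - (z' + t *: h') = (z - z') + t *: (h - h').
      by rewrite scalerBr opprD addrACA.
    apply: le_trans (ler_normD _ _) _; rewrite normrZ (ger0_norm t0).
    have : t * `|h - h'| <= 3 * e by rewrite ler_pM.
    lra.
  have h3 : `|z' + t *: h'| <= T.
    have -> : z' + t *: h' = (z + t *: h) - ((z + t *: h) - (z' + t *: h')).
      by rewrite opprB [RHS]addrC subrK.
    by apply: le_trans (ler_normB _ _) _; lra.
  apply: le_trans (lip _ _ _ h3) _; first by lra.
  by rewrite mulrCA ler_wpM2l.
have p0 := pt 0; have p1 := pt 1; have p2 := pt 2; have p3 := pt 3.
rewrite !scale0r !addr0 in p0; rewrite !scale1r in p1.
have {p0}q0 : `|W z - W z'| <= 4 * (L * e) by apply: p0; apply/andP; split; lra.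
have {p1}q1 : `|W (z + h) - W (z' + h')| <= 4 * (L * e) by apply: p1; apply/andP; split; lra.
have {p2}q2 : `|W (z + 2 *: h) - W (z' + 2 *: h')| <= 4 * (L * e).
  by apply: p2; apply/andP; split; lra.
have {p3}q3 : `|W (z + 3 *: h) - W (z' + 3 *: h')| <= 4 * (L * e).
  by apply: p3; apply/andP; split; lra.
rewrite -lerBlDl.
apply: le_trans (lerB_dist _ _) _.
have -> : third_diff W z h - third_diff W z' h' = (W (z + 3 *: h) - W (z' + 3 *: h'))
  - 3 * (W (z + 2 *: h) - W (z' + 2 *: h')) + 3 * (W (z + h) - W (z' + h'))
  - (W z - W z') by rewrite /third_diff; ring.
move: q0 q1 q2 q3; rewrite !ler_norml => /andP[? ?] /andP[? ?] /andP[? ?] /andP[? ?].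
by apply/andP; split; lra.
Qed.

End Rescale.

Section UltraLimit.
Context {R : realType} {n : nat}.
Implicit Types (W : nat -> 'rV[R]_n -> R) (x y z h : 'rV[R]_n) (K T eps : R).

Lemma ultra_bounded_cvg (G : set_system nat) (a : nat -> R) B : UltraFilter G ->
  (\forall k \near G, `|a k| <= B) ->
  exists l, forall eps, 0 < eps -> \forall k \near G, `|a k - l| < eps.
Proof.
move=> UG bnd; have PG := @ultra_proper _ _ UG.
have cB : (a @ G) `[- B, B]%classic.
  by apply: filterS bnd => k; rewrite /= in_itv /= ler_norml.
have Pa : ProperFilter (a @ G) by exact: fmap_proper_filter.
have [l [_ cl]] := @segment_compact R (- B) B (a @ G) Pa cB.
exists l => eps e0.
have [//|far] := in_ultra_setVsetC [set k | `|a k - l| < eps] UG.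
have far' : (a @ G) [set y | ~ `|y - l| < eps] := far.
have near' : nbhs l [set y | `|y - l| < eps].
  by apply/nbhs_ballP; exists eps => //= y; rewrite /ball /= distrC.
by have [y [/= ? ?]] := cl [set y | ~ `|y - l| < eps] [set y | `|y - l| < eps] far' near'.
Qed.

Lemma floor_grid (m : nat) (t B : R) : (0 < m)%N -> `|t| <= B -> B + 1 <= m%:R ->
  let a := Num.floor (m%:R * t) in
  (absz a <= m ^ 2)%N /\ `|t - m%:R^-1 * a%:~R| <= m%:R^-1.
Proof.
move=> m0 tB Bm a; have mR : 0 < m%:R :> R by rewrite ltr0n.
have /andP[h1 h2] := floor_itv (m%:R * t).
rewrite -/a intrD in h1 h2; split.
  rewrite -(ler_nat R) natrX pmulrn abszE intr_norm.
  have : `|m%:R * t| <= m%:R * B by rewrite normrM (gtr0_norm mR) ler_pM2l.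
  have : m%:R * (B + 1) <= m%:R ^+ 2 by rewrite expr2 ler_pM2l.
  have : 1 <= m%:R :> R by rewrite ler1n.
  rewrite !ler_norml mulrDr mulr1 => c1 c2 /andP[c3 c4].
  by apply/andP; split; lra.
have E : m%:R^-1 * (m%:R * t) = t by rewrite mulKf // gt_eqF.
have i0 : 0 < m%:R^-1 :> R by rewrite invr_gt0.
rewrite -{1}E -mulrBr normrM (gtr0_norm i0) -[leRHS]mulr1 ler_pM2l //.
by rewrite ler_norml; apply/andP; split; lra.
Qed.

Lemma archi_inv (eps : R) : 0 < eps -> exists k0 : nat, forall k, (k0 <= k)%N ->
  (k.+1%:R)^-1 < eps.
Proof.
move=> e0; exists (Num.bound eps^-1) => k hk.
rewrite invf_plt ?posrE ?ltr0n //.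
apply: lt_trans (archi_boundP _) _; first by rewrite invr_ge0 ltW.
by rewrite ltr_nat ltnS.
Qed.

Lemma archi_big (B : R) : exists k0 : nat, forall k, (k0 <= k)%N -> B <= k.+1%:R.
Proof.
exists (Num.bound `|B|) => k hk.
apply: le_trans (ler_norm _) _; apply: le_trans (ltW (archi_boundP (normr_ge0 B))) _.
by rewrite ler_nat (leq_trans hk).
Qed.

Lemma near_oo (G : set_system nat) (P : nat -> Prop) : \oo `<=` G ->
  (exists k0 : nat, forall k, (k0 <= k)%N -> P k) -> \forall k \near G, P k.
Proof. by move=> oG [k0 hk]; apply: oG; exists k0. Qed.

Definition cball x (r : R) : set 'rV[R]_n := [set y | `|y - x| <= r].

Lemma cball_compact x (r : R) : compact (cball x r).
Proof.
rewrite /cball; have -> : [set y | `|y - x| <= r] = closed_ball_ (fun y => `|y|) x r.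
  by apply/seteqP; split=> y; rewrite /closed_ball_ /= distrC.
apply: bounded_closed_compact; last exact: closed_closed_ball_.
exists (`|x| + r); split; first exact: num_real.
move=> M hM y; rewrite /closed_ball_ /= => yr; apply: le_trans (ltW hM).
have -> : y = x - (x - y) by rewrite opprB addrC subrK.
by apply: le_trans (ler_normB _ _) _; rewrite lerD2l.
Qed.

Lemma le_eps (a b : R) : (forall eps, 0 < eps -> a <= b + eps) -> a <= b.
Proof. by move=> h; apply/ler_addgt0Pr => e; exact: h. Qed.

Lemma eq0_eps (a : R) : (forall eps, 0 < eps -> `|a| <= eps) -> a = 0.
Proof.
move=> h; apply/eqP; rewrite -normr_le0; apply: le_eps => eps e0.
by rewrite add0r h.
Qed.

Lemma third_dist (W U : 'rV[R]_n -> R) z h d :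
  `|W z - U z| <= d -> `|W (z + h) - U (z + h)| <= d ->
  `|W (z + 2 *: h) - U (z + 2 *: h)| <= d ->
  `|W (z + 3 *: h) - U (z + 3 *: h)| <= d ->
  `|third_diff U z h - third_diff W z h| <= 8 * d.
Proof.
rewrite /third_diff !ler_norml.
move=> /andP[? ?] /andP[? ?] /andP[? ?] /andP[? ?].
by apply/andP; split; lra.
Qed.

(** Any point z and increment h are within 1/k of the lattice, and W is Lipschitz. *)
Lemma third_from_grid (W : 'rV[R]_n -> R) L T z h (k : nat) (s : 'rV[R]_n) :
  (forall y z, `|y| <= T -> `|z| <= T -> `|W y - W z| <= L * `|y - z|) -> 0 <= L ->
  `|z| + 3 * `|h| + 4 <= T -> T <= k.+1%:R -> `|s| <= k.+1%:R^-1 ->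
  (forall a e : 'rV[int]_n,
     bounded_by (k.+1 ^ 2) a -> bounded_by (k.+1 ^ 2) e ->
     `|third_diff W (s + k.+1%:R^-1 *: emb a) (k.+1%:R^-1 *: emb e)| <= k.+1%:R^-1) ->
  `|third_diff W z h| <= k.+1%:R^-1 * (1 + 64 * L).
Proof.
move=> lk L0 zhT kbig; have nz := normr_ge0 z; have nh := normr_ge0 h.
have zk : `|z| + 1 <= k.+1%:R by lra.
have hk : `|h| + 1 <= k.+1%:R by lra.
have k4 : 4 <= k.+1%:R :> R by lra.
have w0 : 0 < k.+1%:R^-1 :> R by rewrite invr_gt0 ltr0n.
have w4 : k.+1%:R^-1 <= 4^-1 :> R by rewrite lef_pV2 ?posrE ?ltr0n.
pose a : 'rV[int]_n := \row_i Num.floor (k.+1%:R * z 0 i).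
pose e : 'rV[int]_n := \row_i Num.floor (k.+1%:R * h 0 i).
have gz i : (absz (a 0%R i) <= k.+1 ^ 2)%N /\ `|z 0 i - k.+1%:R^-1 * (a 0 i)%:~R| <= k.+1%:R^-1.
  by rewrite mxE; exact: floor_grid (coord_le_norm z i) zk.
have gh i : (absz (e 0%R i) <= k.+1 ^ 2)%N /\ `|h 0 i - k.+1%:R^-1 * (e 0 i)%:~R| <= k.+1%:R^-1.
  by rewrite mxE; exact: floor_grid (coord_le_norm h i) hk.
clearbody a e; move: w0 w4 gz gh; move: (k.+1%:R^-1) => w w0 w4 gz gh s1 hs.
have aB : bounded_by (k.+1 ^ 2) a by move=> i; have [] := gz i.
have eB : bounded_by (k.+1 ^ 2) e by move=> i; have [] := gh i.
have za : `|z - (s + w *: emb a)| <= 2 * w.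
  have -> : z - (s + w *: emb a) = (z - w *: emb a) - s by rewrite opprD addrA addrAC.
  apply: le_trans (ler_normB _ _) _.
  have : `|z - w *: emb a| <= w.
    apply: norm_le_coord => [|i]; first exact: ltW.
    by rewrite !mxE; have [] := gz i.
  clear -s1; lra.
have he : `|h - w *: emb e| <= 2 * w.
  apply: norm_le_coord => [|i]; first by rewrite mulr_ge0 // ltW.
  rewrite !mxE; have [_ h2] := gh i.
  by apply: le_trans h2 _; rewrite ler_peMl ?ler1n // ltW.
have e01 : 0 <= 2 * w <= 1 by clear -w0 w4; apply/andP; split; lra.
have := third_approx lk L0 e01 zhT za he.
by have := hs _ _ aB eB; clear; rewrite mulrDr mulr1; lra.
Qed.

(** The sequence is bounded at every point, so it has a limit along the ultrafilter,
    and no subsequence needs to be extracted. Equicontinuity makes the convergence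
    uniform on the unit ball. *)
Lemma blowup_quadratic (G : set_system nat) W K : UltraFilter G -> \oo `<=` G -> 0 < K ->
  (forall k, semiconvex K (W k)) ->
  (forall T, exists k0 : nat, forall k, (k0 <= k)%N ->
     forall z, `|z| <= T -> `|W k z| <= K * sq z) ->
  (forall k, exists s : 'rV[R]_n, `|s| <= k.+1%:R^-1 /\ forall a e : 'rV[int]_n,
     bounded_by (k.+1 ^ 2) a -> bounded_by (k.+1 ^ 2) e ->
     `|third_diff (W k) (s + k.+1%:R^-1 *: emb a) (k.+1%:R^-1 *: emb e)| <= k.+1%:R^-1) ->
  exists A : 'M[R]_n, [/\ A^T = A,
    forall z eps, 0 < eps -> \forall k \near G, `|W k z - 2^-1 * dot (z *m A) z| < eps &
    forall eps, 0 < eps -> \forall k \near G, forall z, `|z| <= 1 ->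
      `|W k z - 2^-1 * dot (z *m A) z| <= eps].
Proof.
move=> UG oG K0 lb bnd thd; have PG := @ultra_proper _ _ UG.
have exU z : exists l, forall eps, 0 < eps -> \forall k \near G, `|W k z - l| < eps.
  apply: (@ultra_bounded_cvg G (W ^~ z) (K * sq z)).
  apply: near_oo => //; have [k0 hk] := bnd `|z|; exists k0 => k /hk; exact.
have [U UP] := choice exU.
pose L T := lip_const n K T.
have lip T : 0 < T -> \forall k \near G, forall y z, `|y| <= T -> `|z| <= T ->
    `|W k y - W k z| <= L T * `|y - z|.
  move=> T0; apply: near_oo => //; have [k0 hk] := bnd (T + 1).
  by exists k0 => k /hk hb; apply: semiconvex_lipschitz.
have L0 T : 0 < T -> 0 <= L T.
  by move=> T0; rewrite /L /lip_const !(addr_ge0, mulr_ge0) ?ler0n ?(ltW K0) ?(ltW T0) // ltW.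
have U3 z h : third_diff U z h = 0.
  apply: eq0_eps => eps e0.
  pose T := `|z| + 3 * `|h| + 4.
  have T0 : 0 < T by rewrite /T; have := normr_ge0 z; have := normr_ge0 h; lra.
  pose d := eps / 16; have d0 : 0 < d by rewrite divr_gt0.
  pose d' := eps / (4 * (1 + 64 * L T)).
  have LT := L0 _ T0.
  have q0 : 0 < 4 * (1 + 64 * L T) by lra.
  have d'0 : 0 < d' by rewrite divr_gt0.
  near G => k.
  have lk : forall y z, `|y| <= T -> `|z| <= T -> `|W k y - W k z| <= L T * `|y - z|.
    by near: k; exact: lip.
  have a0 : `|W k z - U z| < d by near: k; exact: UP.
  have a1 : `|W k (z + h) - U (z + h)| < d by near: k; exact: UP.
  have a2 : `|W k (z + 2 *: h) - U (z + 2 *: h)| < d by near: k; exact: UP.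
  have a3 : `|W k (z + 3 *: h) - U (z + 3 *: h)| < d by near: k; exact: UP.
  have kd : k.+1%:R^-1 < d' by near: k; apply: near_oo => //; exact: archi_inv.
  have kbig : T <= k.+1%:R by near: k; apply: near_oo => //; exact: archi_big.
  have [s [s1 hs]] := thd k.
  have b4 : `|third_diff (W k) z h| <= k.+1%:R^-1 * (1 + 64 * L T).
    exact: (third_from_grid lk LT (lexx _) kbig s1 hs).
  have b1 : k.+1%:R^-1 * (4 * (1 + 64 * L T)) <= eps by rewrite -ler_pdivlMr // ltW.
  have b5 := third_dist (ltW a0) (ltW a1) (ltW a2) (ltW a3).
  have b6 : 8 * d = eps / 2 by rewrite /d; field.
  have add3 (a b q : R) : a <= eps / 2 -> b <= q -> 4 * q <= eps -> a + b <= eps.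
    by clear -e0; lra.
  have := ler_normD (third_diff U z h - third_diff (W k) z h) (third_diff (W k) z h).
  rewrite subrK mulrCA in b1 *; rewrite b6 in b5 => b7.
  exact: le_trans b7 (add3 _ _ _ b5 b4 b1).
have UB z : `|U z| <= K * n%:R * `|z| ^+ 2.
  apply: le_eps => eps e0.
  near G => k.
  have a0 : `|W k z - U z| < eps by near: k; exact: UP.
  have : `|W k z| <= K * sq z.
    near: k; apply: near_oo => //; have [k0 hk] := bnd `|z|; exists k0 => k /hk; exact.
  have : K * sq z <= K * (n%:R * `|z| ^+ 2) by rewrite ler_pM2l // sq_norm_le.
  have -> : U z = W k z - (W k z - U z) by ring.
  by rewrite mulrA => *; apply: le_trans (ler_normB _ _) _; lra.
have KN : 0 <= K * n%:R by rewrite mulr_ge0 ?ler0n // ltW.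
have [A [As AE]] := third0_quadratic KN U3 UB.
exists A; split=> // [z|]; first by rewrite -AE; exact: UP.
have lipU T y z : 0 < T -> `|y| <= T -> `|z| <= T -> `|U y - U z| <= L T * `|y - z|.
  move=> T0 yT zT; apply: le_eps => eps e0.
  have e2 : 0 < eps / 2 by rewrite divr_gt0.
  near G => k.
  have lk : forall y z, `|y| <= T -> `|z| <= T -> `|W k y - W k z| <= L T * `|y - z|.
    by near: k; exact: lip.
  have a0 : `|W k y - U y| < eps / 2 by near: k; exact: UP.
  have a1 : `|W k z - U z| < eps / 2 by near: k; exact: UP.
  have := lk _ _ yT zT; move: a0 a1; rewrite !ltr_norml !ler_norml.
  by move=> /andP[? ?] /andP[? ?] /andP[? ?]; apply/andP; split; lra.
move=> eps e0.
have cpt : compact [set z : 'rV[R]_n | `|z| <= 1].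
  have -> : [set z : 'rV[R]_n | `|z| <= 1] = [set z | `|z - 0| <= 1].
    by apply/seteqP; split=> z /=; rewrite subr0.
  exact: cball_compact.
have L20 := L0 2 (ltr0n _ 2).
move/compact_near_coveringP : cpt.
move=> /(_ _ G (fun k z => `|W k z - 2^-1 * dot (z *m A) z| <= eps) _); apply.
move=> z /= z1.
pose d := minr 1 (eps / (4 * (L 2 + 1))).
have q0 : 0 < 4 * (L 2 + 1) by lra.
have d0 : 0 < d by rewrite lt_min ltr01 divr_gt0.
have dL : d * (4 * (L 2 + 1)) <= eps by rewrite -ler_pdivlMr // ge_min lexx orbT.
have d1 : d <= 1 by rewrite ge_min lexx.
have e4 : 0 < eps / 4 by rewrite divr_gt0.
near=> z' k; rewrite /= -AE.
have zz : `|z - z'| < d.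
  by near: z'; apply/nbhs_ballP; exists d => //= y; rewrite -ball_normE.
have z'2 : `|z'| <= 2.
  have -> : z' = z - (z - z') by rewrite opprB addrC subrK.
  by apply: le_trans (ler_normB _ _) _; lra.
have z2 : `|z| <= 2 by lra.
have lk : forall y z, `|y| <= 2 -> `|z| <= 2 -> `|W k y - W k z| <= L 2 * `|y - z|.
  by near: k; exact: lip.
have a0 : `|W k z - U z| < eps / 4 by near: k; exact: UP.
have h1 := lk _ _ z2 z'2.
have h2 := lipU 2 z z' (ltr0n _ 2) z2 z'2.
have h3 : L 2 * `|z - z'| <= L 2 * d by apply: ler_wpM2l => //; exact: ltW.
move: dL h1 h2 a0; rewrite mulrDr mulr1 mulrDr !ltr_norml !ler_norml.
by move=> dL /andP[? ?] /andP[? ?] /andP[? ?]; apply/andP; split; lra.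
Unshelve. all: end_near.
Qed.

End UltraLimit.

(** * Simultaneous quadratic approximation *)

Section Sums.
Context {R : realType} {n : nat}.
Implicit Types (f g : 'rV[R]_n -> R) (x y z l p c : 'rV[R]_n) (K r rho sigma delta eta : R).

(** Both blow-ups are taken at the contact points and scales of [good_scale], which
    serve f and g at once; maximality of f + g - l. at these points passes to the
    limit and makes the sum of the two quadratic forms nonpositive. *)
Theorem simultaneous_quadratic f g K x0 sigma rho delta : 0 < K -> semiconvex K f -> semiconvex K g ->
  0 < sigma -> sigma < rho -> 0 < delta ->
  (forall l, `|l| <= delta -> exists x, `|x - x0| <= sigma /\ contact f g x0 rho l x) ->
  exists A B : 'M[R]_n, [/\ A^T = A, B^T = B,
    forall y, dot (y *m A) y + dot (y *m B) y <= 0 &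
    forall eta, 0 < eta -> exists l x p q r,
      [/\ `|l| <= delta /\ `|x - x0| <= sigma, contact f g x0 rho l x, p + q = l,
       0 < r <= eta &
       forall y, `|y| <= r ->
         `|f (x + y) - f x - dot p y - 2^-1 * dot (y *m A) y| <= eta * r ^+ 2 /\
         `|g (x + y) - g x - dot q y - 2^-1 * dot (y *m B) y| <= eta * r ^+ 2]].
Proof.
move=> K0 hf hg s0 sr d0 hct.
pose M (k : nat) : R := k.+1%:R.
have M0 k : 0 < M k by rewrite ltr0n.
have M1 k : 1 <= M k by rewrite ler1n.
(* good_scale is used on boxes of radius (k + 1)^2 lattice steps r k, so that after
   rescaling by rr k = (k + 1) * r k the lattice becomes dense as k grows *)
pose eta (k : nat) : R := (M k)^-1 ^+ 2.
have eta0 k : 0 < eta k by rewrite exprn_gt0 // invr_gt0.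
have D k := good_scale K0 hf hg s0 sr d0 hct (k.+1 ^ 2) (eta0 k).
have {D}D k : exists t : 'rV[R]_n * 'rV[R]_n * 'rV[R]_n * R * ('rV[R]_n * 'rV[R]_n),
    let: (l, x, c, r, (p, q)) := t in
    [/\ `|l| <= delta /\ `|x - x0| <= sigma, contact f g x0 rho l x /\
      (0 < r <= eta k /\ `|c - x| <= r), p + q = l, below K f x p /\ below K g x q &
      forall z e : 'rV[int]_n, bounded_by (k.+1 ^ 2) z -> bounded_by (k.+1 ^ 2) e ->
      `|third_diff f (c + r *: emb z) (r *: emb e)| <= eta k * r ^+ 2 /\
      `|third_diff g (c + r *: emb z) (r *: emb e)| <= eta k * r ^+ 2].
  have [l [x [c [r [[ld xs] ct r0 cr th]]]]] := D k.
  have [p hp] := hf x; have [q hq] := hg x.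
  exists (l, x, c, r, (p, q)); split=> //.
  exact: contact_slope (ltW K0) (le_lt_trans xs sr) ct hp hq.
have [t tP] := choice D.
pose l k := (t k).1.1.1.1; pose x k := (t k).1.1.1.2; pose c k := (t k).1.1.2.
pose r k := (t k).1.2; pose p k := (t k).2.1; pose q k := (t k).2.2.
have {}tP k : [/\ `|l k| <= delta /\ `|x k - x0| <= sigma, contact f g x0 rho (l k) (x k) /\
      (0 < r k <= eta k /\ `|c k - x k| <= r k), p k + q k = l k,
      below K f (x k) (p k) /\ below K g (x k) (q k) &
      forall z e : 'rV[int]_n, bounded_by (k.+1 ^ 2) z -> bounded_by (k.+1 ^ 2) e ->
      `|third_diff f (c k + r k *: emb z) (r k *: emb e)| <= eta k * r k ^+ 2 /\
      `|third_diff g (c k + r k *: emb z) (r k *: emb e)| <= eta k * r k ^+ 2].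
  have := tP k; rewrite /l /x /c /r /p /q.
  by case: (t k) => [[[[? ?] ?] ?] [? ?]].
clearbody l x c r p q; clear D t.
pose rr k := M k * r k.
have r0 k : 0 < r k by have [_ [_ [/andP[]]]] := tP k.
have rr0 k : 0 < rr k by rewrite mulr_gt0.
have rrM k : rr k <= (M k)^-1.
  have [_ [_ [/andP[_ h] _]] _ _ _] := tP k.
  by rewrite /rr mulrC -ler_pdivlMr //; apply: le_trans h _.
have gap0 : 0 < rho - sigma by rewrite subr_gt0.
have inQ k y : `|y - x k| <= rho - sigma -> `|y - x0| <= rho.
  have [[_ xs] _ _ _ _] := tP k.
  move=> h1; have -> : y - x0 = (y - x k) + (x k - x0) by rewrite addrA subrK.
  by apply: le_trans (ler_normD _ _) _; lra.
have absb (a b d : R) : b - d <= a -> a <= b + d -> `|a - b| <= d.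
  by move=> *; rewrite ler_norml; apply/andP; split; lra.
have sandf k y : `|y - x k| <= rho - sigma ->
    `|f y - f (x k) - dot (p k) (y - x k)| <= K * sq (y - x k).
  have [_ [ct _] e [bf bg] _] := tP k; move=> /inQ yQ.
  have := contact_above ct bg e yQ; have := bf y. 
  by move=> h1 h2; apply: absb; lra.
have sandg k y : `|y - x k| <= rho - sigma ->
    `|g y - g (x k) - dot (q k) (y - x k)| <= K * sq (y - x k).
  have [_ [ct _] e [bf bg] _] := tP k; move=> /inQ yQ.
  have ct' : contact g f x0 rho (l k) (x k).
    by move=> z /ct; rewrite (addrC (g z)) (addrC (g _)).
  have e' : q k + p k = l k by rewrite addrC.
  have := contact_above ct' bf e' yQ; have := bg y. 
  by move=> h1 h2; apply: absb; lra.
have smallT T : exists k0 : nat, forall k, (k0 <= k)%N -> forall z, `|z| <= T ->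
    `|rr k *: z| <= rho - sigma.
  pose T' := `|T| + 1; have T'0 : 0 < T' by rewrite ltr_wpDl.
  have [k0 hk] := archi_inv (divr_gt0 gap0 T'0); exists k0 => k /hk.
  rewrite ltr_pdivlMr // => h z zT; rewrite normrZ (gtr0_norm (rr0 k)).
  apply: le_trans (ltW h).
  apply: (@le_trans _ _ ((M k)^-1 * `|z|)); first by rewrite ler_wpM2r // rrM.
  rewrite ler_wpM2l ?invr_ge0 ?(ltW (M0 k)) //.
  by apply: le_trans zT _; rewrite /T'; have := ler_norm T; lra.
have shift k z : x k + rr k *: z - x k = rr k *: z by rewrite addrC addKr.
have thr (u : 'rV[R]_n -> R) (P : nat -> 'rV[R]_n) :
    (forall k (z e : 'rV[int]_n), bounded_by (k.+1 ^ 2) z -> bounded_by (k.+1 ^ 2) e ->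
      `|third_diff u (c k + r k *: emb z) (r k *: emb e)| <= eta k * r k ^+ 2) ->
    forall k, exists s : 'rV[R]_n, `|s| <= (M k)^-1 /\ forall a e : 'rV[int]_n,
     bounded_by (k.+1 ^ 2) a -> bounded_by (k.+1 ^ 2) e ->
     `|third_diff (rescale u (x k) (P k) (rr k)) (s + (M k)^-1 *: emb a) ((M k)^-1 *: emb e)|
       <= (M k)^-1.
  move=> hu k; have [_ [_ [_ cx]] _ _ _] := tP k.
  exists ((rr k)^-1 *: (c k - x k)); split.
    rewrite normrZ gtr0_norm ?invr_gt0 // /rr invfM -mulrA ler_piMr ?invr_ge0 ?(ltW (M0 k)) //.
    by rewrite mulrC ler_pdivrMr // mul1r.
  move=> a e aB eB; rewrite rescale_third ?gt_eqF //.
  have Er : rr k * (M k)^-1 = r k by rewrite /rr mulrAC divff ?mul1r // gt_eqF.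
  have -> : rr k *: ((M k)^-1 *: emb e) = r k *: emb e by rewrite scalerA Er.
  have -> : x k + rr k *: ((rr k)^-1 *: (c k - x k) + (M k)^-1 *: emb a) = c k + r k *: emb a.
    by rewrite scalerDr !scalerA Er divff ?gt_eqF // scale1r addrA (addrC (x k)) subrK.
  rewrite normrM (ger0_norm (x := _^-1)) ?invr_ge0 ?sqr_ge0 //.
  rewrite ler_pdivrMr ?exprn_gt0 //; apply: le_trans (hu _ _ _ aB eB) _.
  have -> : (M k)^-1 * rr k ^+ 2 = M k * r k ^+ 2 by rewrite /rr; field; rewrite gt_eqF.
  rewrite ler_pM2r ?exprn_gt0 //.
  apply: le_trans (M1 k); rewrite /eta exprVn invf_le1 ?exprn_gt0 //.
  by rewrite exprn_ege1.
have bndr (u : 'rV[R]_n -> R) (P : nat -> 'rV[R]_n) :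
    (forall k y, `|y - x k| <= rho - sigma ->
     `|u y - u (x k) - dot (P k) (y - x k)| <= K * sq (y - x k)) ->
    forall T, exists k0 : nat, forall k, (k0 <= k)%N -> forall z, `|z| <= T ->
     `|rescale u (x k) (P k) (rr k) z| <= K * sq z.
  move=> hu T; have [k0 hk] := smallT T; exists k0 => k /hk h z zT.
  by apply: rescale_bound => //; have := hu k (x k + rr k *: z); rewrite shift; apply; apply: h.
have [G [UG oG]] := ultraFilterLemma eventually_filter.
have PG := @ultra_proper _ _ UG.
have [A [As Apt Aun]] := blowup_quadratic UG oG K0
  (fun k => rescale_semiconvex (x k) (p k) (rr0 k) hf) (bndr f p sandf)
  (thr f p (fun k (z e : 'rV[int]_n) zB eB => (let: And5 _ _ _ _ h := tP k in h z e zB eB).1)).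
have [B [Bs Bpt Bun]] := blowup_quadratic UG oG K0
  (fun k => rescale_semiconvex (x k) (q k) (rr0 k) hg) (bndr g q sandg)
  (thr g q (fun k (z e : 'rV[int]_n) zB eB => (let: And5 _ _ _ _ h := tP k in h z e zB eB).2)).
exists A, B; split=> //.
  move=> y; apply: le_eps => eps e0; rewrite add0r.
  have e4 : 0 < eps / 4 by rewrite divr_gt0.
  near G => k.
  have a1 : `|rescale f (x k) (p k) (rr k) y - 2^-1 * dot (y *m A) y| < eps / 4.
    by near: k; exact: Apt.
  have a2 : `|rescale g (x k) (q k) (rr k) y - 2^-1 * dot (y *m B) y| < eps / 4.
    by near: k; exact: Bpt.
  have yk : `|rr k *: y| <= rho - sigma.
    near: k; apply: near_oo => //; have [k0 hk] := smallT `|y|.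
    by exists k0 => k /hk; apply.
  have [_ [ct _] e _ _] := tP k.
  have yQ : `|x k + rr k *: y - x0| <= rho by apply: (inQ k); rewrite shift.
  have := ct _ yQ; rewrite -e dotDr !dotDl !dotZr => h1.
  have : rescale f (x k) (p k) (rr k) y + rescale g (x k) (q k) (rr k) y <= 0.
    rewrite /rescale -mulrDl pmulr_lle0 ?invr_gt0 ?exprn_gt0 //; lra.
  move: a1 a2; rewrite !ltr_norml => /andP[? ?] /andP[? ?] ?; lra.
move=> et et0.
near G => k.
have a1 : forall z, `|z| <= 1 ->
    `|rescale f (x k) (p k) (rr k) z - 2^-1 * dot (z *m A) z| <= et.
  by near: k; exact: Aun.
have a2 : forall z, `|z| <= 1 ->
    `|rescale g (x k) (q k) (rr k) z - 2^-1 * dot (z *m B) z| <= et.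
  by near: k; exact: Bun.
have ek : (M k)^-1 < et by near: k; apply: near_oo => //; exact: archi_inv.
have [xs [ct _] e _ _] := tP k.
exists (l k), (x k), (p k), (q k), (rr k); split=> //.
  by rewrite rr0 /= (le_trans (rrM k)) // ltW.
move=> y yr; pose z := (rr k)^-1 *: y.
have yz : y = rr k *: z by rewrite /z scalerA divff ?scale1r // gt_eqF.
have z1 : `|z| <= 1.
  by rewrite /z normrZ gtr0_norm ?invr_gt0 // mulrC ler_pdivrMr // mul1r.
clearbody z.
have conv (u : 'rV[R]_n -> R) (P : 'rV[R]_n) (C : 'M[R]_n) :
    `|rescale u (x k) P (rr k) z - 2^-1 * dot (z *m C) z| <= et ->
    `|u (x k + y) - u (x k) - dot P y - 2^-1 * dot (y *m C) y| <= et * rr k ^+ 2.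
  rewrite -ler_pdivrMr ?exprn_gt0 // => h; apply: le_trans h.
  rewrite -[X in _ / X](ger0_norm (sqr_ge0 _)) -normf_div yz -scalemxAl !dotZl !dotZr /rescale.
  rewrite le_eqVlt; apply/orP; left; apply/eqP; congr normr.
  by field; rewrite gt_eqF.
by split; apply: conv; [exact: a1 | exact: a2].
Unshelve. all: end_near.
Qed.

End Sums.

(** * Paraboloids and second-order expansions *)

Section Quad.
Context {R : realType} {n : nat}.
Implicit Types (a : R) (x y z h p c : 'rV[R]_n) (A B : 'M[R]_n) (f phi : 'rV[R]_n -> R).

Definition quad a p A c : 'rV[R]_n -> R :=
  fun x => a + dot p (x - c) + 2^-1 * dot ((x - c) *m A) (x - c).

Lemma dot_mulmx_sym A x y : A^T = A -> dot (x *m A) y = dot (y *m A) x.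
Proof.
move=> As; rewrite !dot_mulmx.
have -> : (x *m A *m y^T) = (y *m A *m x^T)^T by rewrite !trmx_mul trmxK As mulmxA.
by rewrite mxE.
Qed.

Lemma quad_step a p A c x h : A^T = A ->
  quad a p A c (x + h) =
  quad a p A c x + dot (p + (x - c) *m A) h + 2^-1 * dot (h *m A) h.
Proof.
move=> As; rewrite /quad (addrAC x h); move: (x - c) => w.
by rewrite mulmxDl !(dotDl, dotDr) (dot_mulmx_sym h w As); field.
Qed.

Lemma quad_center a p A c : quad a p A c c = a.
Proof. by rewrite /quad subrr mul0mx dot0r dot0l; ring. Qed.

(** Such an expansion along a line identifies the directional derivative without any
    appeal to differentiation rules. *)
Lemma derive_expansion f x v (al be : R) :
  (forall h : R, f (x + h *: v) = f x + h * al + h ^+ 2 * be) -> 'D_v f x = al.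
Proof.
move=> fE; apply: cvg_lim => //.
apply/cvgrPdist_lt => eps e0; rewrite near_withinE.
near=> h => h0; rewrite /= (addrC (h *: v)) fE.
have -> : h^-1 *: (f x + h * al + h ^+ 2 * be - f x) = al + h * be.
  by rewrite /GRing.scale /=; field.
have -> : al - (al + h * be) = - (h * be) by ring.
rewrite normrN normrM.
have h1 : `|h| < eps / (`|be| + 1).
  near: h; apply/nbhs_ballP; exists (eps / (`|be| + 1)) => /=.
    by rewrite divr_gt0 // ltr_wpDl.
  by move=> y; rewrite /ball /= sub0r normrN.
rewrite ltr_pdivlMr ?ltr_wpDl // in h1.
by have := normr_ge0 h; have := normr_ge0 be; lra.
Unshelve. all: end_near.
Qed.

Lemma partial_quad a p A c i x : A^T = A ->
  partial i (quad a p A c) x = (p + (x - c) *m A) 0 i.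
Proof.
move=> As; rewrite /partial -(dot_delta (p + _)).
apply: (@derive_expansion _ _ _ _ (2^-1 * dot (delta_mx 0 i *m A) (delta_mx 0 i))) => h.
by rewrite quad_step // -scalemxAl !dotZr !dotZl; ring.
Qed.

Lemma grad_quad a p A c x : A^T = A -> grad (quad a p A c) x = p + (x - c) *m A.
Proof. by move=> As; apply/rowP => i; rewrite mxE partial_quad. Qed.

Lemma hess_quad a p A c x : A^T = A -> hess (quad a p A c) x = A.
Proof.
move=> As; apply/matrixP => i j; rewrite mxE.
have -> : partial j (quad a p A c) = fun y => (p + (y - c) *m A) 0 j.
  by apply/funext => y; exact: partial_quad.
rewrite /partial.
have -> : A i j = (row i A) 0 j by rewrite mxE.
apply: (@derive_expansion _ _ _ _ 0) => h.
rewrite addrAC mulmxDl -scalemxAl -rowE !mxE; ring.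
Qed.

Lemma differentiable_sum_fun (m : nat) (W : normedModType R) (f : 'I_m -> 'rV[R]_n -> W) x :
  (forall i, differentiable (f i) x) -> differentiable (fun y => \sum_i f i y) x.
Proof.
move=> df; have -> : (fun y => \sum_i f i y) = \sum_i f i by apply/funext => y; rewrite fct_sumE.
exact: differentiable_sum.
Qed.

Lemma differentiable_affine p A c x :
  differentiable (fun y => p + (y - c) *m A : 'rV[R]_n) x.
Proof.
have -> : (fun y => p + (y - c) *m A) = cst (p - c *m A) + (fun y => \sum_i y 0 i *: row i A).
  apply/funext => y; rewrite -[RHS]/(_ + _) -mulmx_sum_row mulmxBl /cst.
  by rewrite addrA addrAC.
apply: differentiableD; first exact: differentiable_cst.
apply: differentiable_sum_fun => i.
by apply: differentiableZl; exact: differentiable_coord.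
Qed.

Lemma differentiable_quad a p A c x : differentiable (quad a p A c) x.
Proof.
have dc q B i y : differentiable (fun y => (q + (y - c) *m B) 0 i : R) y.
  apply: (@differentiable_comp _ _ _ _ (fun y => q + (y - c) *m B)
     (fun N : 'rV[R]_n => N 0 i)); first exact: differentiable_affine.
  exact: differentiable_coord.
have dot_d q B q' B' : differentiable (fun y => dot (q + (y - c) *m B) (q' + (y - c) *m B')) x.
  apply: differentiable_sum_fun => i.
  by apply: (differentiableM (dc q B i x) (dc q' B' i x)).
have -> : quad a p A c = cst a + (fun y => dot (p + (y - c) *m 0) (0 + (y - c) *m 1%:M))
    + 2^-1 *: (fun y => dot (0 + (y - c) *m A) (0 + (y - c) *m 1%:M)).
  by apply/funext => y; rewrite /quad -[RHS]/(_ + _ + _ * _) mulmx0 mulmx1 addr0 !add0r.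
apply: differentiableD; last exact/differentiableZ/dot_d.
by apply: differentiableD; [exact: differentiable_cst | exact: dot_d].
Qed.

Lemma C2_quad a p A c x : A^T = A -> C2_near (quad a p A c) x.
Proof.
move=> As; near=> y; split.
- exact: differentiable_quad.
- have -> : grad (quad a p A c) = fun y => p + (y - c) *m A.
    by apply/funext => z; exact: grad_quad.
  exact: differentiable_affine.
- have -> : hess (quad a p A c) = cst A by apply/funext => z; exact: hess_quad.
  exact: cst_continuous.
Unshelve. all: end_near.
Qed.

Lemma continuous_quad a p A c : continuous (quad a p A c).
Proof. by move=> x; exact: differentiable_continuous (differentiable_quad a p A c x). Qed.

End Quad.

Section Taylor.
Context {R : realType} {n : nat}.
Implicit Types (x y z h p c a b : 'rV[R]_n) (A B : 'M[R]_n) (phi : 'rV[R]_n -> R) (eps : R).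

Lemma derive_grad phi x h : differentiable phi x -> 'D_h phi x = dot (grad phi x) h.
Proof.
move=> dphi; rewrite deriveE // {1}(row_sum_delta h) linear_sum /dot.
apply: eq_bigr => i _; rewrite linearZ /= mxE /partial deriveE //.
by rewrite /GRing.scale /= mulrC.
Qed.

Lemma path_is_derive phi x h (s : R) : differentiable phi (x + s *: h) ->
  is_derive s 1 (fun t => phi (x + t *: h)) (dot (grad phi (x + s *: h)) h).
Proof.
move=> dphi; rewrite -derive_grad //.
have E : (fun t : R => t^-1 *: (((fun t => phi (x + t *: h)) \o shift s) (t *: 1) - phi (x + s *: h)))
  = (fun t : R => t^-1 *: ((phi \o shift (x + s *: h)) (t *: h) - phi (x + s *: h))).
  apply/funext => t /=; congr (_ *: (phi _ - _)).
  by rewrite [t *: 1]mulr1 scalerDl addrCA.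
have D := diff_derivable (v := h) dphi.
by split; rewrite /derivable /derive E.
Qed.

Lemma MVT_path phi psi x y h :
  (forall s : R, 0 <= s <= 1 -> differentiable phi (x + s *: h)) ->
  (forall s : R, 0 <= s <= 1 -> differentiable psi (y + s *: h)) ->
  exists c : R, 0 <= c <= 1 /\
    (phi (x + h) - psi (y + h)) - (phi x - psi y) =
      dot (grad phi (x + c *: h) - grad psi (y + c *: h)) h.
Proof.
move=> dphi dpsi.
pose g (t : R) := phi (x + t *: h) - psi (y + t *: h).
have dg (s : R) : 0 <= s <= 1 ->
    is_derive s 1 g (dot (grad phi (x + s *: h) - grad psi (y + s *: h)) h).
  move=> s01; have d1 := path_is_derive (dphi s s01).
  by have d2 := path_is_derive (dpsi s s01); rewrite dotBl; exact: is_deriveB.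
have hd (s : R) : s \in `]0, 1[%R ->
    is_derive s 1 g (dot (grad phi (x + s *: h) - grad psi (y + s *: h)) h).
  by rewrite in_itv /= => /andP[s0 s1]; apply: dg; rewrite !ltW.
have cg : {within `[0, 1], continuous g}.
  apply: derivable_within_continuous => s; rewrite in_itv /= => s01.
  by have [] := dg s s01.
have [c] := MVT_segment ler01 hd cg.
rewrite in_itv /= => c01; rewrite /g !scale1r !scale0r !addr0 subr0 mulr1 => E.
by exists c.
Qed.

Lemma grad_expansion phi x0 eps : differentiable (grad phi) x0 -> 0 < eps ->
  \forall h \near (0 : 'rV[R]_n),
    `|grad phi (x0 + h) - grad phi x0 - h *m hess phi x0| <= eps * `|h|.
Proof.
move=> dg e0.
have dE h : 'd (grad phi) x0 h = h *m hess phi x0.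
  rewrite {1}(row_sum_delta h) linear_sum mulmx_sum_row.
  apply: eq_bigr => i _; rewrite linearZ; congr (_ *: _); rewrite -deriveE //.
  rewrite derive_mx; last exact: diff_derivable.
  apply/rowP => j; rewrite mxE [RHS]mxE [RHS]mxE.
  have -> : (fun y => grad phi y 0 j) = partial j phi by apply/funext => y; rewrite mxE.
  by [].
have /eqaddoP/(_ _ e0) := diff_locally dg.
apply: filterS => h /=; rewrite -[X in `|X|]/(grad phi (h + x0) - (grad phi x0 + 'd (grad phi) x0 h)).
by rewrite dE opprD addrA (addrC h).
Qed.

Lemma near0_ball (P : 'rV[R]_n -> Prop) : (\forall h \near (0 : 'rV[R]_n), P h) ->
  exists2 d : R, 0 < d & forall h, `|h| < d -> P h.
Proof.
move=> /nbhs_ballP[d /= d0 hd]; exists d => // h hh; apply: hd.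
by rewrite -ball_normE /= sub0r normrN.
Qed.

Lemma near_shift (P : 'rV[R]_n -> Prop) x0 : (\forall x \near x0, P x) ->
  exists2 d : R, 0 < d & forall h, `|h| < d -> P (x0 + h).
Proof.
move=> /nbhs_ballP[d /= d0 hd]; exists d => // h hh; apply: hd.
by rewrite -ball_normE /= opprD addNKr normrN.
Qed.

(** The mean value theorem for phi (. + s b) - phi and the differentiability of the
    gradient at x0 evaluate the second difference with increments s a, s b up to
    o(s^2); that second difference is symmetric in a and b. *)
Lemma hess_sym phi x0 : C2_near phi x0 -> (hess phi x0)^T = hess phi x0.
Proof.
move=> c2; set H := hess phi x0.
have [_ dg _] := nbhs_singleton c2.
have [d1 d10 hd1] : exists2 d : R, 0 < d & forall h, `|h| < d -> differentiable phi (x0 + h).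
  by apply: (@near_shift (fun x => differentiable phi x)); apply: filterS c2 => y [].

suff key a b : `|a| <= 1 -> `|b| <= 1 -> dot (b *m H) a = dot (a *m H) b.
  apply/matrixP => i j; rewrite mxE.
  have nd k : `|delta_mx 0 k : 'rV[R]_n| <= 1.
    apply: norm_le_coord => // l; rewrite mxE eqxx andTb.
    by case: (l == k); rewrite ?normr1 ?normr0.
  have := key (delta_mx 0 i) (delta_mx 0 j) (nd i) (nd j).
  by rewrite !dot_delta -!rowE !mxE.
move=> a1 b1; apply/eqP; rewrite -subr_eq0; apply/eqP.
have main a' b' eps : `|a'| <= 1 -> `|b'| <= 1 -> 0 < eps ->
    exists2 t : R, 0 < t & forall s : R, 0 < s -> s < t ->
    `|phi (x0 + s *: b' + s *: a') - phi (x0 + s *: a') - (phi (x0 + s *: b') - phi x0)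
      - s ^+ 2 * dot (b' *m H) a'| <= s ^+ 2 * (n%:R * (3 * eps)).
  move=> a'1 b'1 e0.
  have [d2 d20 hd2] := near0_ball (grad_expansion dg e0).
  exists (minr d1 d2 / 2); first by rewrite divr_gt0 // lt_min d10 d20.
  move=> s s0 sd.
  have md1 : minr d1 d2 <= d1 by rewrite ge_min lexx.
  have md2 : minr d1 d2 <= d2 by rewrite ge_min lexx orbT.
  have sd1 : 2 * s < d1 by lra.
  have sd2 : 2 * s < d2 by lra.
  have sm (c : R) (w : 'rV[R]_n) : 0 <= c <= 1 -> `|w| <= 1 -> `|c *: (s *: w)| <= s.
    move=> /andP[c0 c1] w1; rewrite !normrZ (ger0_norm c0) (gtr0_norm s0).
    have h1 : s * `|w| <= s * 1 by rewrite ler_pM2l.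
    have h2 : c * (s * `|w|) <= 1 * (s * `|w|) by rewrite ler_wpM2r // mulr_ge0 // ltW.
    lra.
  have o01 : 0 <= (1 : R) <= 1 by rewrite ler01 lexx.
  have sb : `|s *: b'| <= s.
    by have := sm 1 b' o01 b'1; rewrite scale1r.
  have D1 (c : R) : 0 <= c <= 1 -> differentiable phi (x0 + s *: b' + c *: (s *: a')).
    move=> c01; rewrite -addrA; apply: hd1.
    by have := ler_normD (s *: b') (c *: (s *: a')); have := sm c a' c01 a'1; lra.
  have D2 (c : R) : 0 <= c <= 1 -> differentiable phi (x0 + c *: (s *: a')).
    by move=> c01; apply: hd1; have := sm c a' c01 a'1; lra.
  have [c [c01 E]] := MVT_path D1 D2.
  rewrite E.
  set u := s *: b' + c *: (s *: a'); set w := c *: (s *: a').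
  have wn : `|w| <= s by apply: sm.
  have un : `|u| <= 2 * s by have := ler_normD (s *: b') w; rewrite -/u; lra.
  have U := hd2 u; have W := hd2 w.
  have {}U : `|grad phi (x0 + u) - grad phi x0 - u *m H| <= eps * (2 * s).
    by apply: le_trans (U _) _; [lra | rewrite ler_pM2l].
  have {}W : `|grad phi (x0 + w) - grad phi x0 - w *m H| <= eps * s.
    by apply: le_trans (W _) _; [lra | rewrite ler_pM2l].
  rewrite -addrA -/u.
  have -> : dot (grad phi (x0 + u) - grad phi (x0 + w)) (s *: a') - s ^+ 2 * dot (b' *m H) a'
     = dot ((grad phi (x0 + u) - grad phi x0 - u *m H)
            - (grad phi (x0 + w) - grad phi x0 - w *m H)) (s *: a').
    have -> : s ^+ 2 * dot (b' *m H) a' = dot ((u - w) *m H) (s *: a').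
      by rewrite /u addrK -scalemxAl dotZl dotZr mulrA.
    by rewrite -dotBl; congr dot; rewrite mulmxBl !opprD !opprK; apply/rowP => i; rewrite !mxE; ring.
  apply: le_trans (dot_norm_le _ _) _.
  have -> : s ^+ 2 * (n%:R * (3 * eps)) = n%:R * ((eps * (2 * s) + eps * s) * s) by ring.
  apply: ler_wpM2l; first exact: ler0n.
  apply: ler_pM => //; last by have := sm 1 a' o01 a'1; rewrite scale1r.
  by apply: le_trans (ler_normB _ _) _; apply: lerD.
apply/eqP; rewrite -normr_le0; apply/ler_addgt0Pr => eps e0; rewrite add0r.
pose eps' := eps / (6 * n%:R + 1).
have q0 : 0 < 6 * n%:R + 1 :> R by rewrite ltr_wpDl // mulr_ge0 // ler0n.
have e'0 : 0 < eps' by rewrite divr_gt0.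
have eE : eps' * (6 * n%:R + 1) = eps by rewrite divfK // gt_eqF.
have [t1 t10 h1] := main a b eps' a1 b1 e'0.
have [t2 t20 h2] := main b a eps' b1 a1 e'0.
pose s := minr t1 t2 / 2.
have m0 : 0 < minr t1 t2 by rewrite lt_min t10 t20.
have s0 : 0 < s by rewrite divr_gt0.
have mt1 : minr t1 t2 <= t1 by rewrite ge_min lexx.
have mt2 : minr t1 t2 <= t2 by rewrite ge_min lexx orbT.
have st1 : s < t1 by rewrite /s; lra.
have st2 : s < t2 by rewrite /s; lra.
have := h1 s s0 st1; have := h2 s s0 st2; rewrite (addrAC x0 (s *: b) (s *: a)).
set P := phi _; set P1 := phi _; set P2 := phi _ => k1 k2.
have s2 : 0 < s ^+ 2 by rewrite exprn_gt0.
rewrite -(ler_pM2l s2) -{1}(gtr0_norm s2) -normrM.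
have -> : s ^+ 2 * (dot (b *m H) a - dot (a *m H) b) =
  (P - P1 - (P2 - phi x0) - s ^+ 2 * dot (a *m H) b)
  - (P - P2 - (P1 - phi x0) - s ^+ 2 * dot (b *m H) a) by ring.
apply: le_trans (ler_normB _ _) _; apply: le_trans (lerD k1 k2) _.
rewrite -mulrDr ler_pM2l // -eE.
have n0 : 0 <= n%:R :> R by exact: ler0n.
by clear -e'0 n0; nra.
Qed.

(** The mean value theorem is applied to phi minus its second-order polynomial, whose
    gradient is o(|h|) because the gradient of phi is differentiable at x0. *)
Lemma taylor_upper phi x0 eps : C2_near phi x0 -> 0 < eps ->
  \forall x \near x0,
    phi x <= quad (phi x0) (grad phi x0) (hess phi x0) x0 x + eps * sq (x - x0).
Proof.
move=> c2 e0; have Hs := hess_sym c2; set H := hess phi x0 in Hs *.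
have [_ dg _] := nbhs_singleton c2.
have [d1 d10 hd1] : exists2 d : R, 0 < d & forall h, `|h| < d -> differentiable phi (x0 + h).
  by apply: (@near_shift (fun x => differentiable phi x)); apply: filterS c2 => y [].
pose eps' := eps / (n%:R + 1).
have q0 : 0 < n%:R + 1 :> R by rewrite ltr_wpDl // ler0n.
have e'0 : 0 < eps' by rewrite divr_gt0.
have eE : eps' * (n%:R + 1) = eps by rewrite divfK // gt_eqF.
have [d2 d20 hd2] := near0_ball (grad_expansion dg e'0).
pose Q := quad (phi x0) (grad phi x0) H x0.
have step h : `|h| < minr d1 d2 -> phi (x0 + h) <= Q (x0 + h) + eps * sq h.
  rewrite lt_min => /andP[hd hd'].
  have sm (c : R) : 0 <= c <= 1 -> `|c *: h| <= `|h|.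
    by move=> /andP[c0 c1]; rewrite normrZ ger0_norm // ler_piMl.
  have D1 (c : R) : 0 <= c <= 1 -> differentiable phi (x0 + c *: h).
    by move=> c01; apply: hd1; apply: le_lt_trans (sm c c01) hd.
  have D2 (c : R) : 0 <= c <= 1 -> differentiable Q (x0 + c *: h).
    by move=> _; exact: differentiable_quad.
  have [c [c01]] := MVT_path D1 D2.
  rewrite /Q quad_center subrr subr0 grad_quad // -/Q addrAC subrr add0r => E.
  have small : `|grad phi (x0 + c *: h) - (grad phi x0 + c *: h *m H)| <= eps' * `|h|.
    rewrite opprD addrA; apply: le_trans (hd2 _ _) _; first exact: le_lt_trans (sm c c01) hd'.
    by rewrite ler_pM2l ?sm.
  have := le_trans (ler_norm _) (dot_norm_le (grad phi (x0 + c *: h) - (grad phi x0 + c *: h *m H)) h).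
  rewrite -E.
  have h1 : n%:R * (`|grad phi (x0 + c *: h) - (grad phi x0 + c *: h *m H)| * `|h|) <=
     n%:R * (eps' * `|h| * `|h|).
    by apply: ler_wpM2l; [exact: ler0n | rewrite ler_wpM2r].
  have h2 : n%:R * (eps' * `|h| * `|h|) <= eps * sq h.
    have -> : n%:R * (eps' * `|h| * `|h|) = (eps' * n%:R) * `|h| ^+ 2 by ring.
    apply: (@le_trans _ _ (eps * `|h| ^+ 2)); last by rewrite ler_pM2l // norm_sq_le.
    by apply: ler_wpM2r; [exact: sqr_ge0 | rewrite -eE mulrDr mulr1 lerDl ltW].
  lra.
apply/nbhs_ballP; exists (minr d1 d2) => /=; first by rewrite lt_min d10 d20.
move=> x; rewrite -ball_normE /= distrC => xd.
by have := step _ xd; rewrite addrC subrK.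
Qed.

End Taylor.

(** * Upper semicontinuous functions and sup-convolutions *)

Section UltraCompact.

Lemma ultra_compact_cvg (T : topologicalType) (G : set_system nat) (B : set T) (a : nat -> T) :
  UltraFilter G -> compact B -> (forall k, B (a k)) ->
  exists l, B l /\ forall N, nbhs l N -> \forall k \near G, N (a k).
Proof.
move=> UG cB aB; have PG := @ultra_proper _ _ UG.
have Pa : ProperFilter (a @ G) by exact: fmap_proper_filter.
have FB : (a @ G) B by apply: (@filterS _ G _ setT) => [k _|]; [exact: aB | exact: filterT].
have [l [Bl cl]] := cB (a @ G) Pa FB.
exists l; split=> // N Nl.
have [//|far] := in_ultra_setVsetC [set k | N (a k)] UG.
have far' : (a @ G) (~` N) := far.
by have [y [/= ? ?]] := cl (~` N) N far' Nl.
Qed.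

End UltraCompact.

Section UscMax.
Context {R : realType} {T : topologicalType}.
Implicit Types (psi : T -> \bar R) (B : set T).

Lemma ereal_between (x : \bar R) (b : R) : (x < b%:E)%E ->
  exists a : R, (x < a%:E)%E /\ a < b.
Proof.
case: x => [c||] //; rewrite ?lte_fin => cb.
  by exists ((c + b) / 2); rewrite lte_fin; split; lra.
by exists (b - 1); split; [exact: ltNyr | lra].
Qed.

Lemma ereal_add_split (x y : \bar R) (r : R) : (x < +oo)%E -> (y < +oo)%E ->
  (x + y < r%:E)%E -> exists c d : R, [/\ (x < c%:E)%E, (y < d%:E)%E & c + d < r].
Proof.
case: x => [a||] //; case: y => [b||] //= _ _.
- rewrite -EFinD lte_fin => h; pose g := (r - (a + b)) / 4.
  by exists (a + g), (b + g); rewrite !lte_fin /g; split; lra.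
- by exists (a + 1), (r - a - 2); rewrite ltNyr lte_fin; split=> //; lra.
- by exists (r - b - 2), (b + 1); rewrite ltNyr lte_fin; split=> //; lra.
- by exists 0, (r - 1); rewrite !ltNyr; split=> //; lra.
Qed.

(** The superlevel sets generate a filter on B; by semicontinuity no point of B has a
    larger value than a cluster point of this filter. *)
Lemma usc_max psi B : compact B -> (exists w a, B w /\ (a%:E < psi w)%E) ->
  (forall z, B z -> (psi z < +oo)%E) ->
  (forall z (a : R), B z -> (psi z < a%:E)%E ->
     \forall z' \near z, B z' -> (psi z' < a%:E)%E) ->
  exists z, B z /\ forall z', B z' -> (psi z' <= psi z)%E.
Proof.
move=> cB [w0 [a0 [Bw0 aw0]]] fin usc.
pose D := [set a : R | exists w, B w /\ (a%:E < psi w)%E].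
pose E (a : R) := [set z | B z /\ (a%:E < psi z)%E].
have FF : ProperFilter (filter_from D E).
  apply: filter_from_proper; last by move=> a [w [Bw aw]]; exists w.
  apply: filter_from_filter; first by exists a0, w0.
  move=> a b Da Db; have [ab|ba] := leP a b.
    exists b => // z [Bz bz]; split; split=> //.
    by apply: le_lt_trans bz; rewrite lee_fin.
  exists a => // z [Bz az]; split; split=> //.
  by apply: le_lt_trans az; rewrite lee_fin ltW.
have FB : filter_from D E B by exists a0; [exists w0 | move=> z []].
have [z [Bz cl]] := cB _ FF FB.
exists z; split=> // z1 Bz1; rewrite leNgt; apply/negP => lt1.
have [b zb1] : exists b : R, psi z1 = b%:E.
  move: lt1 (fin _ Bz1); case: (psi z1) => [b||] //; first by exists b.
  by rewrite ltNge leNye.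
rewrite zb1 in lt1; have [a [za ab]] := ereal_between lt1.
have Da : D a by exists z1; rewrite zb1 lte_fin.
have FE : filter_from D E (E a) by exists a.
have [y [[By ay] yB]] := cl _ _ FE (usc z a Bz za).
by have := lt_trans ay (yB By); rewrite ltxx.
Qed.

End UscMax.

Section SupConvolution.
Context {R : realType} {n : nat}.
Implicit Types (X : set 'rV[R]_n) (u v : 'rV[R]_n -> \bar R) (x y z c : 'rV[R]_n) (b t rho : R).

Lemma USC_near X u z (a : R) : open X -> USC X u -> X z -> (u z < a%:E)%E ->
  \forall y \near z, (u y < a%:E)%E.
Proof.
move=> oX uu Xz za; have [_ h] := uu z Xz.
have Xn : nbhs z X by apply: open_nbhs_nbhs.
by near=> y; apply: (near (h a za) y) => //; near: y.
Unshelve. all: end_near.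
Qed.

Lemma USC_add X u v : open X -> USC X u -> USC X v -> USC X (fun x => u x + v x)%E.
Proof.
move=> oX uu vv x Xx; have [ux _] := uu x Xx; have [vx _] := vv x Xx.
split; first by rewrite lte_add_pinfty.
move=> a /(ereal_add_split ux vx)[c [d [uc vd cd]]].
have nu := USC_near oX uu Xx uc; have nv := USC_near oX vv Xx vd.
near=> y => _.
have h1 : (u y < c%:E)%E by near: y.
have h2 : (v y < d%:E)%E by near: y.
by apply: lt_trans (lteD h1 h2) _; rewrite -EFinD lte_fin.
Unshelve. all: end_near.
Qed.

Lemma sq_quad b t c z : b + t * sq (c - z) = quad b 0 (2 * t)%:M c z.
Proof.
by rewrite -opprB sqN /quad mul_mx_scalar dotZl dot0l addr0 mulrA mulKf ?pnatr_eq0.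
Qed.

Lemma sq_continuous b t c : continuous (fun z => b + t * sq (c - z)).
Proof.
have -> : (fun z => b + t * sq (c - z)) = quad b 0 (2 * t)%:M c.
  by apply/funext => z; exact: sq_quad.
exact: continuous_quad.
Qed.

(** f is the supremum over the ball of u z - t |x - z|^2. It is described through a
    point Z x at which the supremum is attained, because this point carries test
    functions of f over to u. *)
Definition supconv u x0 rho t (f : 'rV[R]_n -> R) (Z : 'rV[R]_n -> 'rV[R]_n) :=
  forall x, [/\ cball x0 rho (Z x), u (Z x) = (f x + t * sq (x - Z x))%:E &
    forall z, cball x0 rho z -> (u z <= (f x + t * sq (x - z))%:E)%E].

Lemma supconv_exists X u x0 rho t (a0 : R) : open X -> USC X u -> 0 <= rho ->
  cball x0 rho `<=` X -> u x0 = a0%:E -> exists f Z, supconv u x0 rho t f Z.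
Proof.
move=> oX uu rho0 sX ux0.
suff pt x : exists p : R * 'rV[R]_n, [/\ cball x0 rho p.2,
    u p.2 = (p.1 + t * sq (x - p.2))%:E &
    forall z, cball x0 rho z -> (u z <= (p.1 + t * sq (x - z))%:E)%E].
  have [F FP] := choice pt; exists (fun x => (F x).1), (fun x => (F x).2).
  exact: FP.
pose psi z := (u z - (t * sq (x - z))%:E)%E.
have Bx0 : cball x0 rho x0 by rewrite /cball /= subrr normr0.
have [|z Bz|z b Bz|z [Bz zmax]] := @usc_max R _ psi (cball x0 rho) (@cball_compact R n x0 rho).
- exists x0, (a0 - t * sq (x - x0) - 1); split=> //.
  by rewrite /psi ux0 -EFinB lte_fin; lra.
- have [uz _] := uu _ (sX _ Bz); move: uz; rewrite /psi.
  by case: (u z) => [c||] // _; rewrite -EFinB ltry.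
- rewrite /psi lteBlDr // => /ereal_between[c [uc cb]].
  have nu := USC_near oX uu (sX _ Bz) uc.
  have ns : \forall z' \near z, c < b + t * sq (x - z').
    exact: (cvgr_gt _ (@sq_continuous b t x z)).
  near=> z' => _; rewrite lteBlDr //.
  have h1 : (u z' < c%:E)%E by near: z'.
  have h2 : c < b + t * sq (x - z') by near: z'.
  by apply: lt_trans h1 _; rewrite -EFinD lte_fin.
have [r ur] : exists r, u z = r%:E.
  have := zmax _ Bx0; have [uz _] := uu _ (sX _ Bz); move: uz; rewrite /psi ux0 -EFinB.
  by case: (u z) => [c||] //; exists c.
exists (r - t * sq (x - z), z); split=> //=; first by rewrite subrK.
by move=> z' /zmax; rewrite /psi ur leeBlDr // -EFinB -EFinD.
Unshelve. all: end_near.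
Qed.

(** The paraboloid of y |-> u z - t |y - z|^2 at z = Z x lies below f. *)
Lemma supconv_below u x0 rho t f Z x : supconv u x0 rho t f Z ->
  below t f x ((- 2 * t) *: (x - Z x)).
Proof.
move=> sc y; have [BZ uZ _] := sc x; have [_ _ /(_ _ BZ)] := sc y.
rewrite uZ lee_fin.
have -> : y - Z x = (y - x) + (x - Z x) by rewrite addrA subrK.
rewrite (sqD (y - x)) dotZl (dotC (x - Z x)).
set d := dot _ _; set s1 := sq _; set s2 := sq _ => h.
lra.
Qed.

Lemma supconv_semiconvex u x0 rho t f Z : supconv u x0 rho t f Z -> semiconvex t f.
Proof. by move=> sc x; exists ((- 2 * t) *: (x - Z x)); exact: supconv_below sc. Qed.

Lemma supconv_lipschitz u x0 rho t f Z (T : R) : 0 < t -> 0 <= rho -> 0 <= T ->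
  supconv u x0 rho t f Z -> exists2 C : R, 0 <= C &
  forall y z, cball x0 T y -> cball x0 T z -> `|f y - f z| <= C * `|y - z|.
Proof.
move=> t0 rho0 T0 sc.
pose P := 2 * t * (T + rho).
have n0 : 0 <= n%:R :> R by exact: ler0n.
have P0 : 0 <= P by rewrite /P mulr_ge0 ?addr_ge0 // mulr_ge0 // ltW.
pose C := n%:R * P + t * n%:R * (2 * T).
have C0 : 0 <= C.
  apply: addr_ge0; first exact: mulr_ge0.
  by rewrite !mulr_ge0 // ltW.
exists C => //.
have half y z : cball x0 T y -> cball x0 T z -> f y - f z <= C * `|y - z|.
  rewrite /cball /= => yT zT; have h := supconv_below y sc z.
  have [BZ _ _] := sc y.
  have pn : `|(- 2 * t) *: (y - Z y)| <= P.
    rewrite normrZ mulNr normrN (ger0_norm (x := 2 * t)) ?mulr_ge0 ?(ltW t0) //.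
    apply: ler_wpM2l; first by rewrite mulr_ge0 // ltW.
    have -> : y - Z y = (y - x0) - (Z y - x0) by apply/rowP => i; rewrite !mxE; ring.
    by apply: le_trans (ler_normB _ _) _; apply: lerD.
  have d2 : `|y - z| <= 2 * T.
    have -> : y - z = (y - x0) - (z - x0) by apply/rowP => i; rewrite !mxE; ring.
    by apply: le_trans (ler_normB _ _) _; lra.
  have := le_trans (ler_norm _) (dot_norm_le ((- 2 * t) *: (y - Z y)) (y - z)).
  have -> : dot ((- 2 * t) *: (y - Z y)) (y - z) = - dot ((- 2 * t) *: (y - Z y)) (z - y).
    by rewrite -dotNr opprB.
  have h1 : n%:R * (`|(- 2 * t) *: (y - Z y)| * `|y - z|) <= n%:R * (P * `|y - z|).
    by apply: ler_wpM2l => //; rewrite ler_wpM2r.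
  have h2 : t * sq (z - y) <= t * (n%:R * (2 * T * `|y - z|)).
    rewrite ler_pM2l //; apply: le_trans (sq_norm_le _) _; apply: ler_wpM2l => //.
    by rewrite distrC expr2 ler_wpM2r.
  have -> : C * `|y - z| = n%:R * (P * `|y - z|) + t * (n%:R * (2 * T * `|y - z|)).
    by rewrite /C; ring.
  by move: h; lra.
move=> y z yT zT; rewrite ler_norml; apply/andP; split; last exact: half.
by have := half z y zT yT; rewrite distrC; lra.
Qed.

Lemma supconv_continuous u x0 rho t f Z : 0 < t -> 0 <= rho ->
  supconv u x0 rho t f Z -> continuous f.
Proof.
move=> t0 rho0 sc x.
have T0 : 0 <= `|x - x0| + 1 by rewrite addr_ge0.
have [C C0 lip] := supconv_lipschitz t0 rho0 T0 sc.
apply/(cvgrPdist_lt (FF := nbhs_filter x)) => eps e0.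
have C1 : 0 < C + 1 by rewrite ltr_wpDl.
pose d := minr 1 (eps / (C + 1)).
have d0 : 0 < d by rewrite lt_min ltr01 divr_gt0.
have dC : d * (C + 1) <= eps by rewrite -ler_pdivlMr // ge_min lexx orbT.
have d1 : d <= 1 by rewrite ge_min lexx.
apply/nbhs_ballP; exists d => //= y; rewrite -ball_normE /= => xy.
have xT : cball x0 (`|x - x0| + 1) x by rewrite /cball /=; lra.
have yT : cball x0 (`|x - x0| + 1) y.
  rewrite /cball /=; have -> : y - x0 = (x - x0) - (x - y) by apply/rowP => i; rewrite !mxE; ring.
  by apply: le_trans (ler_normB _ _) _; lra.
apply: le_lt_trans (lip _ _ xT yT) _; apply: lt_le_trans dC.
apply: (@le_lt_trans _ _ (`|x - y| * (C + 1))); last by rewrite ltr_pM2r.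
by rewrite mulrC mulrDr mulr1 lerDl.
Qed.

(** As e tends to 0 the penalty forces x, z, z' to a common limit y, and by
    semicontinuity q y <= u y + v y, which leaves only y = x0. *)
Lemma penalization_localizes X u v x0 rho (sigma : R) (q : 'rV[R]_n -> R) :
  open X -> USC X u -> USC X v -> cball x0 rho `<=` X -> continuous q -> 0 < sigma ->
  (forall y, cball x0 rho y -> y != x0 -> (u y + v y < (q y)%:E)%E) ->
  exists2 e : R, 0 < e & forall x z z' (a b : R),
    cball x0 rho x -> cball x0 rho z -> cball x0 rho z' -> u z = a%:E -> v z' = b%:E ->
    q x - e <= a + b - e^-1 * (sq (x - z) + sq (x - z')) ->
    [/\ `|x - x0| < sigma, `|z - x0| < sigma & `|z' - x0| < sigma].
Proof.
move=> oX uu vv sX cq s0 strict; apply: contrapT => bad.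
have {bad}bad (k : nat) : exists p : 'rV[R]_n * 'rV[R]_n * 'rV[R]_n * R * R,
    let: (x, z, z', a, b) := p in
    [/\ cball x0 rho x, cball x0 rho z & cball x0 rho z'] /\
    [/\ u z = a%:E, v z' = b%:E,
      q x - k.+1%:R^-1 <= a + b - k.+1%:R * (sq (x - z) + sq (x - z')) &
      ~ [/\ `|x - x0| < sigma, `|z - x0| < sigma & `|z' - x0| < sigma]].
  apply: contrapT => none; apply: bad; exists k.+1%:R^-1; first by rewrite invr_gt0 ltr0n.
  move=> x z z' a b Bx Bz Bz' ua vb; rewrite invrK => le; apply: contrapT => far.
  by apply: none; exists (x, z, z', a, b).
have [p pP] := choice bad.
pose x k := (p k).1.1.1.1; pose z k := (p k).1.1.1.2; pose z' k := (p k).1.1.2.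
pose a k := (p k).1.2; pose b k := (p k).2.
have {}pP k : [/\ cball x0 rho (x k), cball x0 rho (z k) & cball x0 rho (z' k)] /\
    [/\ u (z k) = (a k)%:E, v (z' k) = (b k)%:E,
      q (x k) - k.+1%:R^-1 <= a k + b k - k.+1%:R * (sq (x k - z k) + sq (x k - z' k)) &
      ~ [/\ `|x k - x0| < sigma, `|z k - x0| < sigma & `|z' k - x0| < sigma]].
  by have := pP k; rewrite /x /z /z' /a /b; case: (p k) => [[[[? ?] ?] ?] ?].
clearbody x z z' a b; clear bad p.
have [G [UG oG]] := ultraFilterLemma eventually_filter.
have PG := @ultra_proper _ _ UG.
have cB := @cball_compact R n x0 rho.
have [xl [Bxl xP]] := ultra_compact_cvg UG cB (fun k => let: conj (And3 h _ _) _ := pP k in h).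
have [zl [Bzl zP]] := ultra_compact_cvg UG cB (fun k => let: conj (And3 _ h _) _ := pP k in h).
have [zl' [Bzl' zP']] := ultra_compact_cvg UG cB (fun k => let: conj (And3 _ _ h) _ := pP k in h).
have [ufin _] := uu _ (sX _ Bzl); have [vfin _] := vv _ (sX _ Bzl').
have below_real (w : \bar R) : (w < +oo)%E -> exists c : R, (w < c%:E)%E.
  case: w => [c||] // _; first by exists (c + 1); rewrite lte_fin; lra.
  by exists 0; exact: ltNyr.
have nbd (w : 'rV[R]_n) (d : R) : 0 < d -> nbhs w [set y | `|y - w| < d].
  by move=> d0; apply/nbhs_ballP; exists d => //= y; rewrite -ball_normE /= distrC.
have qn (w : 'rV[R]_n) (d : R) : 0 < d -> nbhs w [set y | q w - d < q y].
  by move=> d0; have h : q w - d < q w; [lra | exact: (cvgr_gt _ (cq w) _ h)].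
have [[exz exz']|ne] := pselect (zl = xl /\ zl' = xl).
  rewrite exz exz' in zP zP' ufin vfin.
  have [ex0|/eqP ne0] := eqVneq xl x0.
    have s_near := nbd x0 sigma s0.
    rewrite ex0 in xP zP zP'.
    near G => k.
    have [_ [_ _ _ far]] := pP k; apply: far; split.
    - by near: k; exact: xP _ s_near.
    - by near: k; exact: zP _ s_near.
    - by near: k; exact: zP' _ s_near.
  have lt_q := strict _ Bxl (introN eqP ne0).
  have [c [d [uc vd cd]]] := ereal_add_split ufin vfin lt_q.
  pose g := (q xl - (c + d)) / 2; have g0 : 0 < g by rewrite divr_gt0 // subr_gt0.
  have m1 := zP _ (USC_near oX uu (sX _ Bxl) uc).
  have m2 := zP' _ (USC_near oX vv (sX _ Bxl) vd).
  have m3 := xP _ (qn xl g g0).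
  near G => k.
  have [_ [uz vz le _]] := pP k.
  have h1 : (u (z k) < c%:E)%E by near: k; exact: m1.
  have h2 : (v (z' k) < d%:E)%E by near: k; exact: m2.
  have h3 : q xl - g < q (x k) by near: k; exact: m3.
  have h4 : k.+1%:R^-1 < g by near: k; apply: near_oo => //; exact: archi_inv.
  move: h1 h2; rewrite uz vz !lte_fin => h1 h2.
  have h5 : 0 <= k.+1%:R * (sq (x k - z k) + sq (x k - z' k)).
    by rewrite mulr_ge0 ?ler0n // addr_ge0 // sq_ge0.
  have gE : 2 * g = q xl - (c + d) by rewrite /g; field.
  move: h1 h2 h3 h4 h5 gE le; clear.
  by move: (_ * (_ + _)) (_^-1) => w1 w2; lra.
have [c uc] := below_real _ ufin; have [d vd] := below_real _ vfin.
pose s := `|xl - zl| + `|xl - zl'|.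
have sp : 0 < s.
  rewrite lt_neqAle addr_ge0 // andbT eq_sym; apply/eqP => s00; apply: ne.
  have h1 := normr_ge0 (xl - zl); have h2 := normr_ge0 (xl - zl').
  have e1 : `|xl - zl| = 0 by rewrite /s in s00; lra.
  have e2 : `|xl - zl'| = 0 by rewrite /s in s00; lra.
  by split; apply/esym/eqP; rewrite -subr_eq0 -normr_eq0 ?e1 ?e2.
pose g := s / 8; have g0 : 0 < g by rewrite divr_gt0.
have gE : 8 * g = `|xl - zl| + `|xl - zl'| by rewrite /g -/s; field.
have m1 := zP _ (USC_near oX uu (sX _ Bzl) uc).
have m2 := zP' _ (USC_near oX vv (sX _ Bzl') vd).
have m3 := xP _ (qn xl 1 ltr01).
have m4 := xP _ (nbd xl g g0).
have m5 := zP _ (nbd zl g g0).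
have m6 := zP' _ (nbd zl' g g0).
near G => k.
have [_ [uz vz le _]] := pP k.
have h1 : (u (z k) < c%:E)%E by near: k; exact: m1.
have h2 : (v (z' k) < d%:E)%E by near: k; exact: m2.
have h3 : q xl - 1 < q (x k) by near: k; exact: m3.
have k1 : `|x k - xl| < g by near: k; exact: m4.
have k2 : `|z k - zl| < g by near: k; exact: m5.
have k3 : `|z' k - zl'| < g by near: k; exact: m6.
have big : (c + d - q xl + 3) / (g ^+ 2) <= k.+1%:R.
  by near: k; apply: near_oo => //; exact: archi_big.
move: h1 h2; rewrite uz vz !lte_fin => h1 h2.
have t1 : `|xl - zl| <= `|x k - z k| + 2 * g.
  have -> : xl - zl = (x k - z k) - (x k - xl) + (z k - zl) by apply/rowP => i; rewrite !mxE; ring.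
  apply: le_trans (ler_normD _ _) _; have := ler_normB (x k - z k) (x k - xl); lra.
have t2 : `|xl - zl'| <= `|x k - z' k| + 2 * g.
  have -> : xl - zl' = (x k - z' k) - (x k - xl) + (z' k - zl') by apply/rowP => i; rewrite !mxE; ring.
  apply: le_trans (ler_normD _ _) _; have := ler_normB (x k - z' k) (x k - xl); lra.
have sum_big : g ^+ 2 <= sq (x k - z k) + sq (x k - z' k).
  have n1 := norm_sq_le (x k - z k); have n2 := norm_sq_le (x k - z' k).
  have p1 := normr_ge0 (x k - z k); have p2 := normr_ge0 (x k - z' k).
  have [l1|l1] := leP g `|x k - z k|.
    have : g ^+ 2 <= `|x k - z k| ^+ 2 by rewrite ler_sqr ?nnegrE // ltW.
    by have := sq_ge0 (x k - z' k); lra.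
  have l2 : g <= `|x k - z' k| by clear -t1 t2 l1 gE g0; lra.
  have : g ^+ 2 <= `|x k - z' k| ^+ 2 by rewrite ler_sqr ?nnegrE // ltW.
  by have := sq_ge0 (x k - z k); lra.
have g2 : 0 < g ^+ 2 by rewrite exprn_gt0.
have : k.+1%:R * g ^+ 2 <= k.+1%:R * (sq (x k - z k) + sq (x k - z' k)).
  by rewrite ler_wpM2l // ler0n.
rewrite ler_pdivrMr // in big.
have : k.+1%:R^-1 <= 1 :> R by rewrite invf_le1 ?ltr0n // ler1n.
move: h1 h2 h3 le big; clear.
by move: (_ * (_ + _)) (_ * _ ^+ 2) (_^-1) => w1 w2 w3; lra.
Unshelve. all: end_near.
Qed.

End SupConvolution.

(** * Jets and test functions *)

Section Jets.
Context {R : realType} {n : nat}.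
Implicit Types (x y z p c : 'rV[R]_n) (A B : 'M[R]_n) (J : jet R n) (F M : set (jet R n)).

Lemma symmetric_trP A : reflect (A^T = A) (A \is symmetricmx).
Proof.
rewrite is_hermitianmxE expr0 scale1r map_mx_id //.
by apply: (iffP eqP) => [{2}->|{1}<-].
Qed.

Lemma jetsP J : jets R n J <-> J.2^T = J.2.
Proof. by split=> [/symmetric_trP|/symmetric_trP]. Qed.

Definition jet_close (e : R) J J' :=
  [/\ `|J'.1.1 - J.1.1| < e, `|J'.1.2 - J.1.2| < e & `|J'.2 - J.2| < e].

Lemma jet_ball (e : R) J J' : ball J e J' <-> jet_close e J J'.
Proof.
rewrite /jet_close (distrC J'.1.1) (distrC J'.1.2) (distrC J'.2).
rewrite -[ball J e J']/((ball J.1.1 e J'.1.1 /\ ball J.1.2 e J'.1.2) /\ ball J.2 e J'.2).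
by rewrite -!ball_normE; split=> [[[]]|[]].
Qed.

Lemma jet_intP F J : F `<=` jets R n -> jet_int F J ->
  exists2 e : R, 0 < e & forall J', jets R n J' -> jet_close e J J' -> F J'.
Proof.
move=> sF iF; have {iF} : nbhs_subspace (J : subspace (jets R n)) F := iF.
have [jJ|nJ] := pselect (jets R n J); last first.
  by rewrite -nbhs_subspace_out // => h; case: nJ; apply: sF; apply: (h J).
rewrite -nbhs_subspace_in // => /nbhs_ballP[e e0 he]; exists e => // J' jJ' /jet_ball JJ'.
exact: he.
Qed.

Lemma jet_int_of F J (e : R) : jets R n J -> 0 < e ->
  (forall J', jets R n J' -> jet_close e J J' -> F J') -> jet_int F J.
Proof.
move=> jJ e0 h; suff : nbhs_subspace (J : subspace (jets R n)) F by [].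
rewrite -nbhs_subspace_in //.
apply/nbhs_ballP; exists e => // J' /jet_ball JJ' jJ'.
exact: h.
Qed.

Lemma norm_mulmx x A : `|x *m A| <= n%:R * (`|x| * `|A|).
Proof.
apply: norm_le_coord => [|j]; first by rewrite mulr_ge0 ?ler0n // mulr_ge0.
rewrite mxE; apply: le_trans (ler_norm_sum _ _ _) _.
apply: (@le_trans _ _ (\sum_(i < n) `|x| * `|A|)).
  apply: ler_sum => i _; rewrite normrM ler_pM ?coord_le_norm //.
  rewrite [leRHS]/normr /= mx_normrE.
  by apply/bigmax_geP; right => /=; exists (i, j).
by rewrite sumr_const card_ord mulr_natl.
Qed.

Lemma norm_scalar_mx (a : R) : `|a%:M : 'M[R]_n| <= `|a|.
Proof.
rewrite [leLHS]/normr /= mx_normrE; apply/bigmax_leP; split => // -[i j] _ /=.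
by rewrite mxE; case: (i == j); rewrite ?mulr1n // mulr0n normr0.
Qed.

Lemma dot_mulmx_le A x : `|dot (x *m A) x| <= n%:R * (n%:R * `|A|) * sq x.
Proof.
apply: le_trans (dot_norm_le _ _) _.
have h := norm_mulmx x A.
have s := norm_sq_le x; have n0 : 0 <= n%:R :> R by exact: ler0n.
apply: (@le_trans _ _ (n%:R * (n%:R * (`|x| * `|A|) * `|x|))).
  by apply: ler_wpM2l => //; apply: ler_wpM2r.
have -> : n%:R * (n%:R * (`|x| * `|A|) * `|x|) = n%:R * (n%:R * `|A|) * `|x| ^+ 2 by ring.
by apply: ler_wpM2l => //; rewrite !mulr_ge0.
Qed.

Lemma semiconvexW (K K' : R) (f : 'rV[R]_n -> R) : K <= K' -> semiconvex K f -> semiconvex K' f.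
Proof.
move=> KK hf x; have [p hp] := hf x; exists p => y; apply: le_trans (hp y).
by rewrite lerD2l lerN2 ler_wpM2r // sq_ge0.
Qed.

Lemma semiconvex_sub_quad K (f : 'rV[R]_n -> R) a p A c : A^T = A -> semiconvex K f ->
  semiconvex (K + n%:R * (n%:R * `|A|)) (fun x => f x - quad a p A c x).
Proof.
move=> As hf x; have [P hP] := hf x; exists (P - (p + (x - c) *m A)) => y.
have := hP y.
have -> : quad a p A c y = quad a p A c (x + (y - x)) by rewrite addrC subrK.
rewrite (quad_step _ _ _ _ _ As) dotBl.
have := le_trans (ler_norm _) (dot_mulmx_le A (y - x)).
have : 0 <= n%:R * (n%:R * `|A|) * sq (y - x) by rewrite !mulr_ge0 ?ler0n // sq_ge0.
rewrite (mulrDl K); set w := n%:R * _ * _; lra.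
Qed.

Lemma quad_recenter a p A c c' : A^T = A ->
  quad a p A c = quad (quad a p A c c') (p + (c' - c) *m A) A c'.
Proof.
move=> As; apply/funext => x; rewrite -{1}(subrK c' x) (addrC (x - c')).
by rewrite (quad_step _ _ _ _ _ As) [RHS]/quad.
Qed.

Lemma quadD a p A a' p' A' c x :
  quad a p A c x + quad a' p' A' c x = quad (a + a') (p + p') (A + A') c x.
Proof. by rewrite /quad mulmxDr !dotDl; ring. Qed.

(** The additional term 3 eta |y|^2 exceeds the error on the boundary of the ball, so
    that the maximum of the difference is attained inside. *)
Lemma touching_paraboloid (f : 'rV[R]_n -> R) x p A (eta r : R) : continuous f ->
  A^T = A -> 0 < eta -> 0 < r ->
  (forall y, `|y| <= r ->
     `|f (x + y) - f x - dot p y - 2^-1 * dot (y *m A) y| <= eta * r ^+ 2) ->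
  exists2 y0, `|y0| < r & forall y, `|y| <= r ->
     f (x + y) - f (x + y0) <=
     quad 0 p (A + (6 * eta)%:M) x (x + y) - quad 0 p (A + (6 * eta)%:M) x (x + y0).
Proof.
move=> cf As eta0 r0 close; set A' := A + _.
have As' : A'^T = A' by rewrite /A' raddfD /= As tr_scalar_mx.
pose Q := quad 0 p A' x.
pose T z := f z - Q z.
have cT : continuous T by move=> z; apply: continuousB; [exact: cf | exact: continuous_quad].
have B0 : cball x r !=set0 by exists x; rewrite /cball /= subrr normr0 ltW.
have [m mB mmax] := EVT_max_rV B0 (@cball_compact R n x r) (continuous_subspaceT cT).
rewrite inE in mB; rewrite /cball /= in mB.
have {}mmax y : `|y| <= r -> T (x + y) <= T m.
  by move=> yr; apply: mmax; rewrite inE /cball /= addrAC subrr add0r.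
pose y0 := m - x; have mE : m = x + y0 by rewrite /y0 addrC subrK.
rewrite {}mE in mmax mB *; clearbody y0; rewrite addrAC subrr add0r in mB.
have QE y : Q (x + y) = dot p y + 2^-1 * dot (y *m A) y + 3 * eta * sq y.
  have E : x + y - x = y by rewrite addrAC subrr add0r.
  rewrite /Q /quad E add0r /A' mulmxDr mul_mx_scalar dotDl dotZl.
  by rewrite -/(sq y); field.
exists y0; last first.
  by move=> y /mmax; rewrite /T /Q; lra.
rewrite lt_neqAle mB andbT; apply/eqP => y0r.
have := mmax 0; rewrite normr0 => /(_ (ltW r0)); rewrite /T !QE addr0.
rewrite dot0r mul0mx dot0l sq0 => h0.
have := close y0 mB; rewrite ler_norml => /andP[_ h1].
have := norm_sq_le y0; rewrite y0r => h2.
have h3 : eta * r ^+ 2 <= eta * sq y0 by rewrite ler_pM2l.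
have : 0 < eta * r ^+ 2 by rewrite mulr_gt0 // exprn_gt0.
lra.
Qed.

(** Translating the paraboloid from x to Z x turns it into a test function for u, since
    f (x + (y - Z x)) is at least u y - t |x - Z x|^2. *)
Lemma supconv_jet F X u x0 rho t (f : 'rV[R]_n -> R) Z x p A c a : open X ->
  subharmonic F X u -> cball x0 rho `<=` X -> supconv u x0 rho t f Z -> A^T = A ->
  `|Z x - x0| < rho ->
  (\forall y \near x, f y - f x <= quad a p A c y - quad a p A c x) ->
  F (f x + t * sq (x - Z x), p + (x - c) *m A, A).
Proof.
move=> oX [_ su] sX sc As zr touch.
have [BZ uZ _] := sc x.
pose val := f x + t * sq (x - Z x).
pose psi := quad (val - (quad a p A c x - a)) p A (c - x + Z x).
have psiE y : psi y = val + (quad a p A c (x + (y - Z x)) - quad a p A c x).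
  rewrite /psi /quad; have -> : y - (c - x + Z x) = x + (y - Z x) - c.
    by apply/rowP => i; rewrite !mxE; ring.
  by ring.
have psiZ : psi (Z x) = val by rewrite psiE subrr addr0 subrr addr0.
have := su (Z x) psi (sX _ BZ) (C2_quad _ _ _ _ As); rewrite /jet_of psiZ.
rewrite grad_quad // hess_quad //.
have -> : Z x - (c - x + Z x) = x - c by apply/rowP => i; rewrite !mxE; ring.
apply; last exact: uZ.
have [d d0 hd] := near_shift touch.
have g0 : 0 < rho - `|Z x - x0| by rewrite subr_gt0.
apply/nbhs_ballP; exists (minr d (rho - `|Z x - x0|)) => /=; first by rewrite lt_min d0 g0.
move=> y; rewrite -ball_normE /= lt_min distrC => /andP[yd yr].
have By : cball x0 rho y.
  rewrite /cball /=; have -> : y - x0 = (y - Z x) + (Z x - x0) by rewrite addrA subrK.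
  by apply: le_trans (ler_normD _ _) _; lra.
have [_ _ /(_ _ By) le] := sc (x + (y - Z x)).
apply: le_trans le _; rewrite lee_fin psiE /val.
have -> : x + (y - Z x) - y = x - Z x by apply/rowP => i; rewrite !mxE; ring.
by have := hd _ yd; lra.
Qed.

End Jets.

Section Addition.
Context {R : realType} {n : nat}.
Implicit Types (x y z p c : 'rV[R]_n) (A B : 'M[R]_n) (J E : jet R n) (F M : set (jet R n)).

(** The jet Jv, whose opposite belongs to the dual of F, differs from the jet in F by an
    element of N x 0 x P and a jet close to (-s, -p, -A). All jets near Jv are of this
    form too, hence in F + M and so in F, which makes Jv an interior point of F. *)
Lemma incompatible_jets M F (e s al be : R) p P Q A A1 B1 :
  nonpos `*` [set 0] `*` psd `<=` M -> F `<=` jets R n -> jet_monotone M F -> 0 < e ->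
  A^T = A -> A1^T = A1 -> B1^T = B1 ->
  (forall J, jets R n J -> jet_close e (- s, - p, - A) J -> M J) ->
  F (al, P, A1) -> jet_dual F (be, Q, B1) ->
  s - e / 2 <= al + be -> `|P + Q - p| <= e / 2 ->
  (forall x, dot (x *m A1) x + dot (x *m B1) x <= dot (x *m A) x + e / 2 * sq x) -> False.
Proof.
move=> cM sF FM e0 As A1s B1s ball Fu [Jv [jJv nJv] JvE] hs hp hA; apply: nJv.
have JvE' : Jv = (- be, - Q, - B1) by rewrite -[Jv]opprK JvE.
pose cI : 'M[R]_n := (e / 2)%:M.
have cIs : cI^T = cI by rewrite tr_scalar_mx.
pose m : jet R n := (- be - al + (s - e / 2), 0, - B1 - A1 + (A + cI)).
have Mm : M m.
  apply: cM; split=> //=; first by split=> //=; rewrite /nonpos /=; lra.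
  split; first by apply/symmetric_trP; rewrite !(raddfD, raddfN) /= B1s A1s As cIs.
  move=> x; rewrite -dot_mulmx !mulmxDr !mulmxN !dotDl !dotNl.
  have -> : dot (x *m cI) x = e / 2 * sq x by rewrite mul_mx_scalar dotZl.
  by have := hA x; lra.
have Fm : F ((al, P, A1) + m) by apply: FM; exists (al, P, A1) => //; exists m.
apply: (@jet_int_of _ _ F Jv (e / 4)) => //; first by rewrite divr_gt0.
move=> [[r w] C] /jetsP /= Cs [/= c1 c2 c3]; rewrite JvE' /= in c1 c2 c3.
pose N : jet R n := (r + be - (s - e / 2), w - P, C + B1 - (A + cI)).
have -> : (r, w, C) = (al, P, A1) + m + N.
  rewrite /m /N; congr (_, _, _) => /=; first by ring.
    by rewrite addr0 addrC subrK.
  by apply/matrixP => i j; rewrite !mxE; ring.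
apply: FM; exists ((al, P, A1) + m) => //; exists N => //.
apply: ball; first by apply/jetsP; rewrite /= !(raddfD, raddfN) /= Cs B1s As cIs.
have e2 : `|e / 2| = e / 2 by rewrite gtr0_norm // divr_gt0.
split=> /=.
- have -> : r + be - (s - e / 2) - - s = (r - - be) + e / 2 by ring.
  by apply: le_lt_trans (ler_normD _ _) _; rewrite e2; lra.
- have -> : w - P - - p = (w - - Q) - (P + Q - p) by apply/rowP => i; rewrite !mxE; ring.
  by apply: le_lt_trans (ler_normB _ _) _; lra.
- have -> : C + B1 - (A + cI) - - A = (C - - B1) - cI by apply/matrixP => i j; rewrite !mxE; ring.
  apply: le_lt_trans (ler_normB _ _) _.
  by have := @norm_scalar_mx R n (e / 2); rewrite e2 -/cI; lra.
Qed.

End Addition.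

(** * The theorem on sums and the addition theorem *)

Section SumsUsc.
Context {R : realType} {n : nat}.
Implicit Types (x y z p l : 'rV[R]_n) (A B : 'M[R]_n) (F G : set (jet R n)).

Lemma supconv_above u x0 rho t f Z (a : R) : supconv u x0 rho t f Z -> 0 <= rho ->
  u x0 = a%:E -> a <= f x0.
Proof.
move=> sc rho0 ux0.
have Bx0 : cball x0 rho x0 by rewrite /cball /= subrr normr0.
by have [_ _ /(_ _ Bx0)] := sc x0; rewrite ux0 lee_fin subrr sq0 mulr0 addr0.
Qed.

Lemma contact_exists (f g : 'rV[R]_n -> R) x0 (rho : R) l : continuous f -> continuous g ->
  0 <= rho -> exists2 x, cball x0 rho x & contact f g x0 rho l x.
Proof.
move=> cf cg rho0; pose T x := f x + g x - dot l x.
have cT : continuous T.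
  have -> : T = (fun x => f x + g x - quad 0 l 0 0 x).
    by apply/funext => x; rewrite /T /quad subr0 mulmx0 dot0l mulr0 addr0 add0r.
  move=> x; apply: (@continuousB _ _ _ (fun x => f x + g x) (quad 0 l 0 0)).
    by apply: (@continuousD _ _ _ f g); [exact: cf | exact: cg].
  exact: continuous_quad.
have B0 : cball x0 rho !=set0 by exists x0; rewrite /cball /= subrr normr0.
have [m mB mmax] := EVT_max_rV B0 (@cball_compact R n x0 rho) (continuous_subspaceT cT).
rewrite inE in mB; exists m => // y yr; apply: mmax; rewrite inE; exact: yr.
Qed.

Lemma dot_small l y (d r : R) : `|l| <= d -> `|y| <= r -> `|dot l y| <= d * (n%:R * r).
Proof.
move=> ll yr; apply: le_trans (dot_norm_le _ _) _.
have -> : n%:R * (`|l| * `|y|) = `|l| * (n%:R * `|y|) by ring.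
by apply: ler_pM; rewrite ?mulr_ge0 ?ler_wpM2l.
Qed.

Lemma contact_value (f g : 'rV[R]_n -> R) x0 (rho d : R) l x : 0 <= rho -> `|l| <= d ->
  cball x0 rho x -> contact f g x0 rho l x ->
  f x0 + g x0 - d * (n%:R * rho) <= f x + g x.
Proof.
move=> rho0 ll Bx ct; have := ct x0; rewrite subrr normr0 => /(_ rho0).
have := dot_small ll Bx; rewrite ler_norml dotBr => /andP[h1 h2].
lra.
Qed.

Lemma small_scale (m : R) (L : seq R) : 0 < m -> (forall a, a \in L -> 0 <= a) ->
  exists2 eta : R, 0 < eta <= m & forall a, a \in L -> eta * a <= m.
Proof.
move=> m0; elim: L => [|b L ih] L0; first by exists m; rewrite ?m0 /=.
have [a aL|eta /andP[eta0 etam] h] := ih; first by rewrite L0 // inE aL orbT.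
have b0 : 0 <= b by rewrite L0 // inE eqxx.
have b1 : 0 < b + 1 by rewrite ltr_wpDl.
have e0 : 0 < minr eta (m / (b + 1)) by rewrite lt_min eta0 divr_gt0.
exists (minr eta (m / (b + 1))); first by rewrite e0 ge_min etam.
move=> a; rewrite inE => /orP[/eqP->|aL].
  apply: le_trans (_ : minr eta (m / (b + 1)) * (b + 1) <= _).
    by rewrite ler_pM2l // lerDl.
  by rewrite -ler_pdivlMr // ge_min lexx orbT.
apply: le_trans (h a aL); apply: ler_wpM2r; last by rewrite ge_min lexx.
by rewrite L0 // inE aL orbT.
Qed.

Lemma near_center (k Q : 'rV[R]_n -> R) x y0 (r : R) : `|y0| < r ->
  (forall y, `|y| <= r -> k (x + y) - k (x + y0) <= Q (x + y) - Q (x + y0)) ->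
  \forall y \near x + y0, k y - k (x + y0) <= Q y - Q (x + y0).
Proof.
move=> y0r h; apply/nbhs_ballP; exists (r - `|y0|) => /=; first by rewrite subr_gt0.
move=> y; rewrite -ball_normE /= distrC => yy.
have -> : y = x + (y - x) by rewrite addrC subrK.
apply: h; have -> : y - x = (y - (x + y0)) + y0 by apply/rowP => i; rewrite !mxE; ring.
by apply: le_trans (ler_normD _ _) _; rewrite -lerBrDr ltW.
Qed.

Lemma approx_value (f : 'rV[R]_n -> R) x y p B (eta r : R) : 0 <= r -> r <= 1 -> 0 <= eta ->
  eta <= 1 -> `|y| <= r ->
  `|f (x + y) - f x - dot p y - 2^-1 * dot (y *m B) y| <= eta * r ^+ 2 ->
  f x + dot p y - r * (n%:R * (n%:R * `|B|) * n%:R + 1) <= f (x + y).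
Proof.
move=> r0 r1 eta0 eta1 yr; rewrite ler_norml => /andP[c1 _].
have n0 : 0 <= n%:R :> R by exact: ler0n.
have rr : r ^+ 2 <= r by rewrite expr2 ler_piMl.
have syr : sq y <= n%:R * r.
  apply: le_trans (sq_norm_le _) _; apply: ler_wpM2l => //; apply: le_trans rr.
  by rewrite ler_sqr ?nnegrE.
have : `|dot (y *m B) y| <= n%:R * (n%:R * `|B|) * (n%:R * r).
  by apply: le_trans (dot_mulmx_le _ _) _; apply: ler_wpM2l => //; rewrite !mulr_ge0.
have w0 : 0 <= n%:R * (n%:R * `|B|) * (n%:R * r) by rewrite !mulr_ge0.
have er : eta * r ^+ 2 <= r by apply: le_trans rr; rewrite ler_piMl ?sqr_ge0.
rewrite ler_norml => /andP[b1 _].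
have -> : r * (n%:R * (n%:R * `|B|) * n%:R + 1) = n%:R * (n%:R * `|B|) * (n%:R * r) + r.
  by ring.
lra.
Qed.

Lemma mulmx_small y B (a r : R) : `|y| <= r -> 0 <= a ->
  `|y *m (B + a%:M)| <= r * (n%:R * (`|B| + a)).
Proof.
move=> yr a0; apply: le_trans (norm_mulmx _ _) _; rewrite mulrCA.
apply: ler_pM => //; apply: ler_wpM2l; first exact: ler0n.
apply: le_trans (ler_normD _ _) _; rewrite lerD2l.
by apply: le_trans (norm_scalar_mx _) _; rewrite ger0_norm.
Qed.

(** The second-order information at a strict maximum of u + v - q, for q a paraboloid.
    The sup-convolutions f, f2 of u, v still sum to a function with its maxima near
    x0, and [simultaneous_quadratic] applies to f and f2 - q; the paraboloids that it
    provides touch f and f2 at points close to x0, from which [supconv_jet] leads back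
    to u and v. *)
Theorem theorem_on_sums F G (X : set 'rV[R]_n) u v x0 (s : R) p A (rho e : R) (a0 b0 : R) :
  open X -> subharmonic F X u -> subharmonic G X v -> cball x0 rho `<=` X -> 0 < rho ->
  A^T = A -> u x0 = a0%:E -> v x0 = b0%:E -> a0 + b0 = s ->
  (forall y, cball x0 rho y -> y != x0 -> (u y + v y < (quad s p A x0 y)%:E)%E) ->
  0 < e -> exists (al be : R) (P Q : 'rV[R]_n) (A1 B1 : 'M[R]_n),
    [/\ A1^T = A1 /\ B1^T = B1, F (al, P, A1) /\ G (be, Q, B1),
      s - e <= al + be, `|P + Q - p| <= e &
      forall y, dot (y *m A1) y + dot (y *m B1) y <= dot (y *m A) y + e * sq y].
Proof.
move=> oX hu hv sX rho0 As ua0 vb0 ab strict e0.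
have [uscu _] := hu; have [uscv _] := hv.
have n0 : 0 <= n%:R :> R by exact: ler0n.
pose q := quad s p A x0.
have q0 : q x0 = s by rewrite /q quad_center.
have cq : continuous q by exact: continuous_quad.
have [d1 d10 hd1] : exists2 d : R, 0 < d & forall h, `|h| < d -> s - e / 4 < q (x0 + h).
  apply: (@near_shift _ _ (fun y => s - e / 4 < q y)).
  have h : s - e / 4 < q x0 by rewrite q0 ltrBlDr ltrDl divr_gt0.
  exact: (cvgr_gt _ (cq x0) _ h).
have [sigma sg0 [sg1 sg2 sg3]] : exists2 sigma : R, 0 < sigma &
    [/\ sigma <= rho / 2, sigma < d1 & sigma * (n%:R * `|A|) <= e / 8].
  pose mm := minr (minr (rho / 2) (d1 / 2)) (e / 8).
  have mm0 : 0 < mm by rewrite !lt_min !divr_gt0.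
  have [b|sg /andP[sg0 sgm] h] := @small_scale mm [:: n%:R * `|A|] mm0.
    by rewrite inE => /eqP ->; exact: mulr_ge0.
  have h1 : mm <= rho / 2 by rewrite !ge_min lexx.
  have h2 : mm <= d1 / 2 by rewrite !ge_min lexx orbT.
  have h3 : mm <= e / 8 by rewrite !ge_min lexx !orbT.
  exists sg => //; split.
  - exact: le_trans sgm h1.
  - by clear -sgm h2 d10; lra.
  - by apply: le_trans h3; apply: h; rewrite inE.
have sgr : sigma < rho by clear -sg1 rho0; lra.
have [e' e'0 loc] := penalization_localizes oX uscu uscv sX cq sg0 strict.
pose t := e'^-1; have t0 : 0 < t by rewrite invr_gt0.
have [f [Z1 scf]] := supconv_exists t oX uscu (ltW rho0) sX ua0.
have [f2 [Z2 scf2]] := supconv_exists t oX uscv (ltW rho0) sX vb0.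
pose g x := f2 x - q x.
pose K := t + n%:R * (n%:R * `|A|).
have K0 : 0 < K by rewrite ltr_wpDr // !mulr_ge0.
have semif : semiconvex K f by apply: semiconvexW (supconv_semiconvex scf); rewrite lerDl !mulr_ge0.
have semig : semiconvex K g by exact: semiconvex_sub_quad As (supconv_semiconvex scf2).
have cf : continuous f by exact: supconv_continuous t0 (ltW rho0) scf.
have cf2 : continuous f2 by exact: supconv_continuous t0 (ltW rho0) scf2.
have cg : continuous g by move=> x; apply: continuousB; [exact: cf2 | exact: cq].
have fg0 : 0 <= f x0 + g x0.
  have := supconv_above scf (ltW rho0) ua0; have := supconv_above scf2 (ltW rho0) vb0.
  by rewrite /g q0 -ab; clear; lra.
have locw x : cball x0 rho x -> - e' <= f x + g x ->
    [/\ `|x - x0| < sigma, `|Z1 x - x0| < sigma & `|Z2 x - x0| < sigma].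
  move=> Bx h; have [B1 u1 _] := scf x; have [B2 v2 _] := scf2 x.
  apply: (loc x (Z1 x) (Z2 x) _ _ Bx B1 B2 u1 v2).
  by move: h; rewrite -/t mulrDr /g; clear; lra.
have [del del0 [del1 del2 del3]] : exists2 del : R, 0 < del &
    [/\ del * (n%:R * rho) <= e' / 2, del * (n%:R * rho) <= e / 8 & del <= e / 8].
  pose mm := minr (e' / 2) (e / 8).
  have mm0 : 0 < mm by rewrite !lt_min !divr_gt0.
  have [b|d /andP[dd0 dm] h] := @small_scale mm [:: n%:R * rho] mm0.
    by rewrite inE => /eqP ->; rewrite mulr_ge0 // ltW.
  have h1 : mm <= e' / 2 by rewrite !ge_min lexx.
  have h2 : mm <= e / 8 by rewrite !ge_min lexx orbT.
  have h3 := h (n%:R * rho) (mem_head _ _).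
  by exists d => //; split; [exact: le_trans h1 | exact: le_trans h2 | exact: le_trans h2].
have value l x : `|l| <= del -> cball x0 rho x -> contact f g x0 rho l x ->
    - (del * (n%:R * rho)) <= f x + g x.
  move=> ll Bx ct; have := contact_value (ltW rho0) ll Bx ct.
  by move: fg0; clear; lra.
have hct l : `|l| <= del -> exists x, `|x - x0| <= sigma /\ contact f g x0 rho l x.
  move=> ll; have [m mB ct] := contact_exists x0 l cf cg (ltW rho0).
  exists m; split=> //; have [|h _ _] := locw m mB; last exact: ltW.
  by have := value l m ll mB ct; move: del1 e'0; clear; lra.
have [A1 [B1 [A1s B1s AB app]]] := simultaneous_quadratic K0 semif semig sg0 sgr del0 hct.
have [C1 C10 lip1] := supconv_lipschitz t0 (ltW rho0) (ltW rho0) scf.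
have [C2 C20 lip2] := supconv_lipschitz t0 (ltW rho0) (ltW rho0) scf2.
(* every error term below is at most r, or eta, times one of these constants *)
pose c1 := n%:R * (`|A1| + 6); pose c2 := n%:R * (`|B1| + 6); pose c3 := n%:R * `|A|.
pose h1 := n%:R * (n%:R * `|A1|) * n%:R + 1; pose h2 := n%:R * (n%:R * `|B1|) * n%:R + 1.
pose h3 := del * n%:R.
pose m := minr (minr 1 (e / 24)) (minr (rho / 2) (e' / 6)).
have m0 : 0 < m by rewrite !lt_min ltr01 !divr_gt0.
have m1 : m <= 1 by rewrite !ge_min lexx.
have m2 : m <= e / 24 by rewrite !ge_min lexx orbT.
have m3 : m <= rho / 2 by rewrite !ge_min lexx !orbT.
have m4 : m <= e' / 6 by rewrite !ge_min lexx !orbT.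
have [|eta /andP[eta0 etam] err] := @small_scale m [:: C1; C2; c1; c2; c3; h1; h2; h3] m0.
  move=> a; rewrite !inE; do 7?[case/orP]; move=> /eqP -> //;
    by rewrite ?addr_ge0 // ?mulr_ge0 ?addr_ge0 ?mulr_ge0 // ltW.
have [l [x [pf [pg [r [[ll xs] ct pE /andP[r0 reta] close]]]]]] := app eta eta0.
have eta1 : eta <= 1 by exact: le_trans m1.
have r1 : r <= 1 by exact: le_trans eta1.
have rm : r <= m by exact: le_trans etam.
have errr a : a \in [:: C1; C2; c1; c2; c3; h1; h2; h3] -> 0 <= a -> r * a <= m.
  by move=> aL a_0; apply: le_trans (err a aL); apply: ler_wpM2r.
have [y1 y1r t1] := touching_paraboloid cf A1s eta0 r0 (fun y yr => (close y yr).1).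
have [y2 y2r t2] := touching_paraboloid cg B1s eta0 r0 (fun y yr => (close y yr).2).
have xB y : `|y| <= r -> cball x0 rho (x + y).
  move=> yr; rewrite /cball /= addrAC; apply: le_trans (ler_normD _ _) _.
  by move: xs yr rm m3 sg1; clear; lra.
have xb : cball x0 rho x by rewrite -[x]addr0; apply: xB; rewrite normr0 ltW.
have wx := value l x ll xb ct.
have w_near y : `|y| <= r -> - e' <= f (x + y) + g (x + y).
  move=> yr; have [k1 k2] := close y yr.
  have v1 := approx_value (ltW r0) r1 (ltW eta0) eta1 yr k1.
  have v2 := approx_value (ltW r0) r1 (ltW eta0) eta1 yr k2.
  have b1 : r * h1 <= m by apply: errr; rewrite ?inE ?eqxx ?orbT // addr_ge0 // !mulr_ge0.
  have b2 : r * h2 <= m by apply: errr; rewrite ?inE ?eqxx ?orbT // addr_ge0 // !mulr_ge0.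
  have b3 : r * h3 <= m by apply: errr; rewrite ?inE ?eqxx ?orbT // mulr_ge0 // ltW.
  have := dot_small ll yr; rewrite ler_norml -pE dotDl => /andP[b4 _].
  have b5 : del * (n%:R * r) = r * h3 by rewrite /h3; ring.
  rewrite b5 in b4; move: v1 v2 b1 b2 b3 b4 wx del1 m4; rewrite -/h1 -/h2; clear.
  by move: (r * h1) (r * h2) (r * h3) => *; lra.
have [_ z1 _] := locw _ (xB _ (ltW y1r)) (w_near _ (ltW y1r)).
have [x2s _ z2] := locw _ (xB _ (ltW y2r)) (w_near _ (ltW y2r)).
(* test functions for u and v; q is recentered at x to be added to the one for g *)
pose A1' := A1 + (6 * eta)%:M; pose B1' := B1 + (6 * eta)%:M.
have A1's : A1'^T = A1' by rewrite /A1' raddfD /= A1s tr_scalar_mx.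
have B1's : B1'^T = B1' by rewrite /B1' raddfD /= B1s tr_scalar_mx.
have BAs : (B1' + A)^T = B1' + A by rewrite raddfD /= B1's As.
have Ju := supconv_jet oX hu sX scf A1's (lt_trans z1 sgr) (near_center y1r t1).
pose q2 := quad (q x) (p + (x - x0) *m A) A x.
have qq2 : q = q2 by rewrite /q (quad_recenter _ _ _ x As).
have touch2 : \forall y \near x + y2, f2 y - f2 (x + y2) <=
    quad (0 + q x) (pg + (p + (x - x0) *m A)) (B1' + A) x y
    - quad (0 + q x) (pg + (p + (x - x0) *m A)) (B1' + A) x (x + y2).
  have E y : quad (0 + q x) (pg + (p + (x - x0) *m A)) (B1' + A) x y
      = quad 0 pg B1' x y + q y.
    by rewrite -quadD; congr (_ + _); rewrite -[LHS]/(q2 y) -qq2.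
  have := near_center y2r t2; apply: filterS => y; rewrite !E /g -/B1'; clear; lra.
have Jv := supconv_jet oX hv sX scf2 BAs (lt_trans z2 sgr) touch2.
do 6!eexists; split; [split; [exact: A1's | exact: BAs] | split; [exact: Ju | exact: Jv] | | |].
- have s1 := mulr_ge0 (ltW t0) (sq_ge0 (x + y1 - Z1 (x + y1))).
  have s2 := mulr_ge0 (ltW t0) (sq_ge0 (x + y2 - Z2 (x + y2))).
  have L (C : R) (k : 'rV[R]_n -> R) y : 0 <= C -> `|y| < r -> r * C <= m ->
     (forall y z, cball x0 rho y -> cball x0 rho z -> `|k y - k z| <= C * `|y - z|) ->
     k x - m <= k (x + y).
    move=> C0 yr rC lip; have := lip _ _ xb (xB _ (ltW yr)).
    have -> : x - (x + y) = - y by rewrite opprD addNKr.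
    rewrite normrN ler_norml => /andP[_ h].
    have : C * `|y| <= r * C by rewrite mulrC ler_wpM2r // ltW.
    by move: h rC; clear; lra.
  have l1 : f x - m <= f (x + y1).
    by apply: (L C1) => //; apply: errr; rewrite ?inE ?eqxx.
  have l2 : f2 x - m <= f2 (x + y2).
    by apply: (L C2) => //; apply: errr; rewrite ?inE ?eqxx ?orbT.
  have qx : s - e / 4 < q x.
    have -> : x = x0 + (x - x0) by rewrite addrC subrK.
    by apply: hd1; apply: le_lt_trans sg2.
  by move: s1 s2 l1 l2 qx del2 wx m2 e0; rewrite /g; clear; lra.
- have -> : pf + (x + y1 - x) *m A1' +
     (pg + (p + (x - x0) *m A) + (x + y2 - x) *m (B1' + A)) - p =
     l + (y1 *m A1' + (y2 *m B1' + (x + y2 - x0) *m A)).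
    have E y : x + y - x = y by rewrite addrAC subrr add0r.
    have E2 : x + y2 - x0 = (x - x0) + y2 by rewrite addrAC.
    rewrite !E E2 -pE (mulmxDr y2) (mulmxDl (x - x0) y2 A).
    move: (_ *m A1') (_ *m B1') (_ *m A) (y2 *m A) => v1 v2 v3 v4.
    by apply/rowP => i; rewrite !mxE; ring.
  have six : 0 <= 6 * eta by rewrite mulr_ge0 // ltW.
  have six6 : 6 * eta <= 6 by rewrite ler_piMr.
  have b1 : `|y1 *m A1'| <= m.
    apply: le_trans (mulmx_small _ (ltW y1r) six) _.
    apply: le_trans (_ : r * c1 <= _); last first.
      by apply: errr; rewrite ?inE ?eqxx ?orbT // mulr_ge0 // addr_ge0.
    by rewrite ler_pM2l // ler_wpM2l // lerD2l.
  have b2 : `|y2 *m B1'| <= m.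
    apply: le_trans (mulmx_small _ (ltW y2r) six) _.
    apply: le_trans (_ : r * c2 <= _); last first.
      by apply: errr; rewrite ?inE ?eqxx ?orbT // mulr_ge0 // addr_ge0.
    by rewrite ler_pM2l // ler_wpM2l // lerD2l.
  have b3 : `|(x + y2 - x0) *m A| <= e / 8.
    apply: le_trans (norm_mulmx _ _) _; apply: le_trans sg3.
    by rewrite mulrCA ler_wpM2r ?mulr_ge0 // ltW.
  apply: le_trans (ler_normD _ _) _; apply: le_trans (lerD ll (ler_normD _ _)) _.
  have := ler_normD (y2 *m B1') ((x + y2 - x0) *m A).
  by move: b1 b2 b3 del3 m2 e0; clear; lra.
- move=> y; have := AB y; rewrite /A1' /B1' !mulmxDr !dotDl !mul_mx_scalar !dotZl -!/(sq y).
  have : 12 * eta * sq y <= e * sq y.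
    by apply: ler_wpM2r; [exact: sq_ge0 | move: etam m2 e0; clear; lra].
  by clear; lra.
Qed.

End SumsUsc.

Theorem theorem7p4 (R : realType) (n : nat) (M F : set (jet R n))
    (hM : monotonicity_cone M) (hF : subequation F) (hFM : jet_monotone M F)
    (X : set 'rV[R]_n) (hX : open X) (u v : 'rV[R]_n -> \bar R)
    (hu : subharmonic F X u) (hv : subharmonic (jet_dual F) X v) :
  subharmonic (jet_dual M) X (fun x => (u x + v x)%E).
Proof.
have [uscu _] := hu; have [uscv _] := hv.
split; first exact: USC_add.
move=> x0 phi Xx0 c2 touch eq0.
have As := hess_sym c2; set A := hess phi x0 in As.
set p := grad phi x0; set s := phi x0.
have [a0 ua0] : exists a, u x0 = a%:E.
  have [ux _] := uscu x0 Xx0; have [vx _] := uscv x0 Xx0; move: eq0 ux vx.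
  by case: (u x0) => [a||] //; exists a.
have [b0 vb0] : exists b, v x0 = b%:E.
  have [vx _] := uscv x0 Xx0; move: eq0 vx; rewrite ua0.
  by case: (v x0) => [b||] //; exists b.
have ab : a0 + b0 = s by move: eq0; rewrite ua0 vb0 -EFinD => -[].
have sF : F `<=` jets R n by have [[_ [? _]] _ _ _] := hF.
have [[sM _] _ coneM _] := hM.
exists (- jet_of phi x0); last by rewrite opprK.
split; first by apply/jetsP; rewrite /= raddfN /= As.
move=> /(jet_intP sM)[e e0 ball]; move: ball; rewrite /jet_of -/A -/p -/s => ball.
(* enlarging the Hessian makes the maximum strict, and e / 16 keeps the jet in the ball *)
pose kap := e / 16; have kap0 : 0 < kap by rewrite divr_gt0.
pose Aq := A + (4 * kap)%:M.
have Aqs : Aq^T = Aq by rewrite /Aq raddfD /= As tr_scalar_mx.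
have qE x : quad s p Aq x0 x = quad s p A x0 x + 2 * kap * sq (x - x0).
  by rewrite /quad /Aq mulmxDr mul_mx_scalar dotDl dotZl -/(sq (x - x0)); field.
have [rho rho0 hrho] : exists2 rho : R, 0 < rho & forall y, cball x0 rho y ->
    [/\ X y, (u y + v y <= (phi y)%:E)%E & phi y <= quad s p A x0 y + kap * sq (y - x0)].
  have nX : nbhs x0 X by apply: open_nbhs_nbhs.
  have tay := taylor_upper c2 kap0; rewrite -/A -/p -/s in tay.
  have all_near : \forall y \near x0, [/\ X y, (u y + v y <= (phi y)%:E)%E &
      phi y <= quad s p A x0 y + kap * sq (y - x0)] by near=> y; split; near: y.
  have [d d0 hd] := near_shift all_near.
  exists (d / 2) => [|y yd]; first by rewrite divr_gt0.
  have -> : y = x0 + (y - x0) by rewrite addrC subrK.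
  by apply: hd; apply: le_lt_trans yd _; rewrite ltr_pdivrMr // ltr_pMr // ltr1n.
have sX : cball x0 rho `<=` X by move=> y /hrho[].
have strict y : cball x0 rho y -> y != x0 -> (u y + v y < (quad s p Aq x0 y)%:E)%E.
  move=> /hrho[_ h1 h2] yx; apply: le_lt_trans h1 _; rewrite lte_fin qE.
  apply: le_lt_trans h2 _; rewrite ltrD2l.
  have sp : 0 < sq (y - x0).
    rewrite lt_neqAle sq_ge0 andbT eq_sym; apply/eqP => z0; case/eqP: yx.
    by apply/eqP; rewrite -subr_eq0; apply/eqP/sq_eq0; rewrite z0.
  by rewrite ltr_pM2r // ltr_pMl // ltr1n.
have e4 : 0 < e / 4 by rewrite divr_gt0.
have [al [be [P [Q [A1 [B1 [[A1s B1s] [Fu Gv] hs hp hA]]]]]]] :=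
  theorem_on_sums hX hu hv sX rho0 Aqs ua0 vb0 ab strict e4.
apply: (incompatible_jets coneM sF hFM e0 As A1s B1s ball Fu Gv).
- by rewrite /=; move: hs e0; clear; lra.
- by rewrite /=; move: hp e0; clear; lra.
- move=> y; have := hA y; rewrite /Aq mulmxDr dotDl mul_mx_scalar dotZl -/(sq y) /kap.
  by move: (sq_ge0 y); clear; lra.
Unshelve. all: end_near.
Qed.
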